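(* Fix a double poset $a=(V,<_{\mathrm W},<_{\mathrm S})$ belonging to the family $\mathcal{A}$ described in the context. Then there is an algorithm which, given a permutation $\Pi\in\mathfrak S(n)$, computes the number $$\#\mathrm{Mor}\big(a,\iota(\Pi)\big)$$ of double poset morphisms from $a$ to $\iota(\Pi)$ in time $\tilde{\mathcal O}(n^{5/3})$ and space $\tilde{\mathcal O}(n)$.
   Context: A finite strict double poset is a triple $(A,P_A,Q_A)$ where $A$ is a finite set and $P_A,Q_A\subseteq A\times A$ are strict partial orders (asymmetric, transitive relations). A morphism $f:(A,P_A,Q_A)\to(B,P_B,Q_B)$ is a map $f:A\to B$ such that $(x,y)\in P_A\Rightarrow (f(x),f(y))\in P_B$ and $(x,y)\in Q_A\Rightarrow(f(x),f(y))\in Q_B$; $\mathrm{Mor}(d,d')$ denotes the set of morphisms. For $\sigma\in\mathfrak S(n)$ (permutations of $[n]=\{1,\dots,n\}$) let $\iota(\sigma)=([n],\{(i,j):i<j\},\{(i,j):\sigma(i)<\sigma(j)\})$. The family $\mathcal A$: a member is obtained as follows. Choose whether the vertex $2$ is present. The vertex set is $V=C\cup D$, where the core is $C=\{1,2,3,4\}$ (or $C=\{1,3,4\}$ if $2$ is absent) and $D$ is a finite (possibly empty) set of further vertices, equipped with a parent map $p:D\to V\setminus\{4\}$ such that following parents from any $x\in D$ eventually reaches an element of $C\setminus\{4\}$ (so $D$ forms rooted trees hanging from the vertices $1,2,3$, resp. $1,3$). Define generating relations $R_{\mathrm W},R_{\mathrm S}$ on $V$ (a pair $(x,y)$ meaning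 $x$ is below $y$): - If $2$ is present: $R_{\mathrm W}\ni(1,2),(2,3)$ and $R_{\mathrm S}\ni(2,1),(3,2)$; in both relations $(1,4),(2,4),(3,4)$. - If $2$ is absent: $R_{\mathrm W}\ni(1,3)$, $R_{\mathrm S}\ni(3,1)$; in both relations $(1,4),(3,4)$. - For every $x\in D$: $(x,p(x))\in R_{\mathrm W}$ and $(x,p(x))\in R_{\mathrm S}$. Then $<_{\mathrm W}$ and $<_{\mathrm S}$ are the transitive closures of $R_{\mathrm W}$ and $R_{\mathrm S}$, and $a=(V,<_{\mathrm W},<_{\mathrm S})$. (For $D=\emptyset$ with $2$ present, $a=\iota([3\,2\,1\,4])$.) The double poset $a$ is fixed; $\tilde{\mathcal O}$ hides polylogarithmic factors in $n$ (and constants depending on $a$). *)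

(* Defs.v *)
From HB Require Import structures.
From mathcomp Require Import all_boot all_order all_algebra all_fingroup.
From mathcomp Require Import all_classical all_reals all_analysis.
From Stdlib Require Import Relation_Operators.
Import Order.TTheory GRing.Theory Num.Theory.

Set Implicit Arguments.
Unset Strict Implicit.
Unset Printing Implicit Defensive.

(** * Finite strict double posets *)

Record dposet := DPoset {
  car :> finType;
  dltP : rel car;
  dltQ : rel car;
  dltP_asym : forall x y, dltP x y -> ~~ dltP y x;
  dltP_trans : transitive dltP;
  dltQ_asym : forall x y, dltQ x y -> ~~ dltQ y x;
  dltQ_trans : transitive dltQ }.

Definition Mor (a b : dposet) : {set {ffun a -> b}} :=
  [set f : {ffun a -> b} | [forall x, forall y,
     (dltP x y ==> dltP (f x) (f y)) && (dltQ x y ==> dltQ (f x) (f y))]].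

Section Iota.
Variables (n : nat) (s : 'S_n).

Let iotaP : rel 'I_n := fun i j => (i < j)%N.
Let iotaQ : rel 'I_n := fun i j => (s i < s j)%N.

Fact iotaP_asym i j : iotaP i j -> ~~ iotaP j i.
Proof. by rewrite /iotaP -leqNgt; apply: ltnW. Qed.

Fact iotaP_trans : transitive iotaP.
Proof. by move=> j i k; apply: ltn_trans. Qed.

Fact iotaQ_asym i j : iotaQ i j -> ~~ iotaQ j i.
Proof. by rewrite /iotaQ -leqNgt; apply: ltnW. Qed.

Fact iotaQ_trans : transitive iotaQ.
Proof. by move=> j i k; apply: ltn_trans. Qed.

Definition iota_perm : dposet :=
  DPoset iotaP_asym iotaP_trans iotaQ_asym iotaQ_trans.

End Iota.

(** * Transitive closure of a relation on a finite type *)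

Definition tclosure (T : finType) (e : rel T) : rel T :=
  fun x y => [exists z, e x z && connect e z y].

Lemma tclosureP (T : finType) (e : rel T) x y :
  reflect (clos_trans T e x y) (tclosure e x y).
Proof.
apply: (iffP existsP) => [[z /andP[exz /connectP[q]]]|].
  elim: q x z exz => [|u q IH] x z exz /= => [_ ->|/andP[ezu eq] yE].
    exact: t_step.
  by apply: t_trans (IH z u ezu eq yE); apply: t_step.
elim=> {x y} [x y exy|x y z _ [u /andP[exu uy]] _ [v /andP[eyv vz]]].
  by exists y; rewrite exy connect0.
exists u; rewrite exu /=; apply: connect_trans uy _.
exact: connect_trans (connect1 eyv) vz.
Qed.

Lemma tclosure_trans (T : finType) (e : rel T) : transitive (tclosure e).
Proof.
move=> y x z /tclosureP xy /tclosureP yz; apply/tclosureP; exact: t_trans yz.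
Qed.

Lemma tclosure_asym (T : finType) (e : rel T) (rk : T -> nat) :
  (forall x y, e x y -> (rk x < rk y)%N) ->
  forall x y, tclosure e x y -> ~~ tclosure e y x.
Proof.
move=> rkP; have lt x y : tclosure e x y -> (rk x < rk y)%N.
  move=> /tclosureP; elim=> {x y} [x y /rkP //|x y z _ xy _ yz].
  exact: ltn_trans yz.
move=> x y /lt xy; apply/negP => /lt; apply/negP.
by rewrite -leqNgt ltnW.
Qed.

(** * The family of tree-shaped double posets *)

(** [h] tells whether the vertex 2 is present; core vertices keep their
    labels 1, ..., 4 as natural numbers (through [val]). *)
Definition core_seq (h : bool) : seq nat :=
  if h then [:: 1; 2; 3; 4]%N else [:: 1; 3; 4]%N.

Definition core (h : bool) : finType := seq_sub (core_seq h).

Definition coreW (h : bool) : seq (nat * nat) :=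
  if h then [:: (1, 2); (2, 3); (1, 4); (2, 4); (3, 4)]%N
  else [:: (1, 3); (1, 4); (3, 4)]%N.

Definition coreS (h : bool) : seq (nat * nat) :=
  if h then [:: (2, 1); (3, 2); (1, 4); (2, 4); (3, 4)]%N
  else [:: (3, 1); (1, 4); (3, 4)]%N.

Section Family.
Variables (h : bool) (D : finType) (p : D -> core h + D).

(** One step of following parents; core vertices are left in place. *)
Definition follow (v : core h + D) : core h + D :=
  if v is inr x then p x else v.

Definition rooted_trees : Prop :=
  (forall x (c : core h), p x = inl c -> val c <> 4%N) /\
  (forall x, exists k (c : core h),
     val c <> 4%N /\ iter k follow (inr x) = inl c).

Definition gen_rel (r : seq (nat * nat)) : rel (core h + D) :=
  fun u v => match u, v with
    | inl i, inl j => (val i, val j) \in r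
    | inl _, inr _ => false
    | inr x, _ => p x == v
    end.

Definition genW := gen_rel (coreW h).
Definition genS := gen_rel (coreS h).

Hypothesis hp : rooted_trees.

Lemma gen_rank (r : seq (nat * nat)) (crk : nat -> nat) :
  (forall i j, (i, j) \in r -> (crk i < crk j)%N) ->
  exists rk : core h + D -> nat,
    forall u v, gen_rel r u v -> (rk u < rk v)%N.
Proof.
move=> crkP.
pose isl (v : core h + D) := if v is inl _ then true else false.
have ex x : exists k, isl (iter k follow (inr x)).
  by have [k [c [_ kE]]] := hp.2 x; exists k; rewrite kE.
pose dep x := ex_minn (ex x).
pose N := \max_x dep x.
have depN x : (dep x <= N)%N by apply: leq_bigmax.
exists (fun v => match v with
                 | inl i => (N + crk (val i)).+1
                 | inr x => N - dep x end)%N.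
case=> [i|x] [j|y] //=.
- by move/crkP; rewrite ltnS ltn_add2l.
- by move=> _; rewrite ltnS (leq_trans (leq_subr _ _)) ?leq_addr.
move=> /eqP pE; have lt : (dep y < dep x)%N.
  rewrite {2}/dep; case: ex_minnP => -[|k] //; rewrite iterSr /= pE => kE _.
  by rewrite ltnS /dep; case: ex_minnP => m _; apply.
by rewrite ltn_sub2l // (leq_trans lt).
Qed.

Lemma genW_asym u v : tclosure genW u v -> ~~ tclosure genW v u.
Proof.
have [|rk rkP] := @gen_rank (coreW h) id; last exact: tclosure_asym rkP _ _.
move=> i j; rewrite /coreW; case: h; rewrite !inE => H.
  by repeat case/orP: H => [/eqP[-> ->] //|H]; move/eqP: H => [-> ->].
by repeat case/orP: H => [/eqP[-> ->] //|H]; move/eqP: H => [-> ->].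
Qed.

Lemma genS_asym u v : tclosure genS u v -> ~~ tclosure genS v u.
Proof.
have [|rk rkP] := @gen_rank (coreS h) (fun i => if i == 4 then 4 else 4 - i)%N;
  last exact: tclosure_asym rkP _ _.
move=> i j; rewrite /coreS; case: h; rewrite !inE => H.
  by repeat case/orP: H => [/eqP[-> ->] //|H]; move/eqP: H => [-> ->].
by repeat case/orP: H => [/eqP[-> ->] //|H]; move/eqP: H => [-> ->].
Qed.

Definition tree_dposet : dposet :=
  DPoset genW_asym (@tclosure_trans _ genW) genS_asym (@tclosure_trans _ genS).

End Family.

Variant familyA : dposet -> Prop :=
  FamilyA (h : bool) (D : finType) (p : D -> core h + D)
    (hp : rooted_trees p) : familyA (tree_dposet hp).

(** * The word RAM

    Programs are structured (while) programs acting on finitely many registers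
    and on a random-access memory of [s] words of [w] bits.  Arithmetic is
    modulo [2 ^ w], except that subtraction is truncated; every operation costs
    one unit of time, and an access outside the [s] memory words is a fault.
    The number of registers is a constant of the program, so that [s] is the
    space used up to an additive constant; it includes the input. *)

Variant binop := OpAdd | OpSub | OpMul | OpDiv | OpMod | OpLt | OpEq.

Inductive expr :=
| Const of nat
| Reg of nat
| Fetch of expr
| Bin of binop & expr & expr.

Inductive cmd :=
| Skip
| Assign of nat & expr
| Store of expr & expr
| Then of cmd & cmd
| If of expr & cmd & cmd
| While of expr & cmd.

Record state := State { reg_of : nat -> nat; mem_of : nat -> nat }.

Section Semantics.
Variables (w s : nat).

Definition eval_binop (o : binop) (x y : nat) : nat :=
  match o with
  | OpAdd => (x + y) %% 2 ^ w
  | OpSub => x - y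
  | OpMul => (x * y) %% 2 ^ w
  | OpDiv => x %/ y
  | OpMod => x %% y
  | OpLt => (x < y) %% 2 ^ w
  | OpEq => (x == y) %% 2 ^ w
  end%N.

Fixpoint eval (st : state) (e : expr) : option nat :=
  match e with
  | Const k => Some (k %% 2 ^ w)%N
  | Reg r => Some (reg_of st r)
  | Fetch e1 =>
      if eval st e1 is Some a then
        if (a < s)%N then Some (mem_of st a) else None
      else None
  | Bin o e1 e2 =>
      if (eval st e1, eval st e2) is (Some x, Some y)
      then Some (eval_binop o x y) else None
  end.

Fixpoint cost (e : expr) : nat :=
  match e with
  | Const _ | Reg _ => 1
  | Fetch e1 => (cost e1).+1
  | Bin _ e1 e2 => (cost e1 + cost e2).+1
  end%N.

(** [exec st c t st']: started in [st], the program [c] halts in [st'] without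
    fault after [t] units of time. *)
Inductive exec : state -> cmd -> nat -> state -> Prop :=
| ExecSkip st : exec st Skip 1 st
| ExecAssign st r e v : eval st e = Some v ->
    exec st (Assign r e) (cost e).+1
      (State [eta reg_of st with r |-> v] (mem_of st))
| ExecStore st e1 e2 a v : eval st e1 = Some a -> eval st e2 = Some v ->
    (a < s)%N ->
    exec st (Store e1 e2) (cost e1 + cost e2).+1
      (State (reg_of st) [eta mem_of st with a |-> v])
| ExecThen st st1 st2 c1 c2 t1 t2 :
    exec st c1 t1 st1 -> exec st1 c2 t2 st2 ->
    exec st (Then c1 c2) (t1 + t2) st2
| ExecIfTrue st st1 e c1 c2 v t : eval st e = Some v -> v != 0%N ->
    exec st c1 t st1 -> exec st (If e c1 c2) (cost e + t).+1 st1
| ExecIfFalse st st1 e c1 c2 t : eval st e = Some 0%N ->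
    exec st c2 t st1 -> exec st (If e c1 c2) (cost e + t).+1 st1
| ExecWhileTrue st st1 st2 e c v t1 t2 : eval st e = Some v -> v != 0%N ->
    exec st c t1 st1 -> exec st1 (While e c) t2 st2 ->
    exec st (While e c) (cost e + t1 + t2).+1 st2
| ExecWhileFalse st e c : eval st e = Some 0%N ->
    exec st (While e c) (cost e).+1 st.

End Semantics.

(** The input is [n] in register 0 and the one-line notation of the permutation
    (with values [0, ..., n - 1]) in the first [n] memory words. *)
Definition input_state (n : nat) (s : 'S_n) : state :=
  State (fun r => if r == 0 then n else 0)%N
        (fun i => nth 0%N [seq val (s j) | j <- enum 'I_n] i).

(** A word length that is Theta(log n) for every fixed [c]. *)
Definition word_length (c n : nat) : nat := (c.+1 * (trunc_log 2 n).+1)%N.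

(** A single program computes [f] (result in register 0) on all permutations of
    all sizes, on a word RAM with words of O(log n) bits. *)
Definition computable_within (f : forall n, 'S_n -> nat)
    (time space : nat -> nat) : Prop :=
  exists (c : nat) (prog : cmd), forall (n : nat) (s : 'S_n),
    exists (t : nat) (st : state),
      [/\ exec (word_length c n) (space n) (input_state s) prog t st,
          (t <= time n)%N & reg_of st 0 = f n s].

(** * Soft-O: big-O up to polylogarithmic factors *)

Local Open Scope classical_set_scope.
Local Open Scope ring_scope.

Definition softO (R : realType) (f : nat -> nat) (g : nat -> R) : Prop :=
  exists k : nat,
    (fun n => (f n)%:R : R^o) =O_\oo (fun n => g n * ln n%:R ^+ k : R^o).

(* Main.v *)
(** A word-RAM algorithm.  Write the permutation as the point set (i, s i) and let
    x < y mean that x is strictly south-west of y.  The trees hanging from the core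
    are summed out leaf by leaf: a vertex gets at the point y the weight
    W(y) = prod_c sum_{x < y} W_c(x) over its children c, which is a dominance sum.
    What remains is to count points i, k, l (vertices 1, 3, 4) with positions
    i < k < l and values s k < s i < s l, weighted by W_1(i) W_3(k) and, if vertex 2
    is present, by the sum K(i, k) of W_2 over the rectangle spanned by i and k.

    Cut positions and values into strips of width b ~ n^{1/3}.
    - If i is in a lower value strip than l, then the condition s i < s l depends
      only on the strip of l, so one near-linear sweep for each of the n^{2/3}
      strips suffices.  Similarly, by transposing the permutation, if k is in an
      earlier position strip than l.  The first case is counted without its overlap
      with the second.
    - Otherwise i is one of the b points in the value strip of l, and k one of the b
      points in its position strip, so that all n b^2 = n^{5/3} triples can be
      enumerated, K(i, k) being obtained from a segment tree. *)

Require Import Defs.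
From HB Require Import structures.
From mathcomp Require Import all_boot all_order all_algebra all_fingroup.
From mathcomp Require Import all_classical all_reals all_analysis.
From Stdlib Require Import Relation_Operators.
From mathcomp Require Import zify ring.
Import Defs Order.TTheory GRing.Theory Num.Theory.

Set Implicit Arguments.
Unset Strict Implicit.
Unset Printing Implicit Defensive.

(** * Hoare triples with running time *)

(** Vertex 4 must lie to the right of vertex 3 and above vertex 1. These constraints concern two
    different points, so one sweep cannot enforce both; a strip index replaces one of the two
    comparisons wherever the strips differ.

    The sums K(i, k) are two-dimensional, yet a one-dimensional segment tree suffices. The rectangle
    is cut into two differences of prefix sums, one over the points left of k and one over the
    points left of i, and each is read at the moment when a left-to-right insertion reaches k or i.
    For this reason the triples are enumerated twice when vertex 2 is present.

    Products of weights may exceed a word and the cases are combined by subtraction. All weights are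
    therefore residues modulo 2^w. The final count is at most n^|V|, which is below 2^w for the
    chosen word length, so its residue determines it. *)

Definition set_reg (st : state) (r v : nat) : state :=
  State [eta reg_of st with r |-> v] (mem_of st).

Definition set_mem (st : state) (a v : nat) : state :=
  State (reg_of st) [eta mem_of st with a |-> v].

Section Triples.
Variables (w s : nat).

(** Total correctness with an upper bound on the running time, so that bounds may be rounded up at
    any point. *)
Definition triple (st : state) (c : cmd) (T : nat) (Q : state -> Prop) :=
  exists t st', [/\ exec w s st c t st', t <= T & Q st'].

Implicit Types (st : state) (c : cmd) (e : expr) (Q : state -> Prop).

Lemma triple_le st c T T' Q : triple st c T Q -> T <= T' -> triple st c T' Q.
Proof. by move=> [t [st' [ex tT q]]] TT; exists t, st'; split=> //; lia. Qed.

Lemma triple_skip st Q : Q st -> triple st Skip 1 Q.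
Proof. by move=> q; exists 1, st; split=> //; constructor. Qed.

Lemma triple_assign st r e v Q :
  eval w s st e = Some v -> Q (set_reg st r v) ->
  triple st (Assign r e) (cost e).+1 Q.
Proof. by move=> ev q; exists (cost e).+1, (set_reg st r v); split=> //; constructor. Qed.

Lemma triple_store st e1 e2 a v Q :
  eval w s st e1 = Some a -> eval w s st e2 = Some v -> a < s ->
  Q (set_mem st a v) -> triple st (Store e1 e2) (cost e1 + cost e2).+1 Q.
Proof.
move=> ev1 ev2 lt q; exists (cost e1 + cost e2).+1, (set_mem st a v).
by split=> //; constructor.
Qed.

Lemma triple_then st c1 c2 T1 T2 Q1 Q :
  triple st c1 T1 Q1 -> (forall st1, Q1 st1 -> triple st1 c2 T2 Q) ->
  triple st (Then c1 c2) (T1 + T2) Q.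
Proof.
move=> [t1 [st1 [ex1 le1 q1]]] /(_ _ q1) [t2 [st2 [ex2 le2 q2]]].
exists (t1 + t2), st2; split=> //; last by lia.
exact: ExecThen ex1 ex2.
Qed.

Lemma triple_seq_assign st r e v c2 T2 Q :
  eval w s st e = Some v -> triple (set_reg st r v) c2 T2 Q ->
  triple st (Then (Assign r e) c2) ((cost e).+1 + T2) Q.
Proof.
move=> ev tr; apply: (@triple_then _ _ _ _ _ (eq (set_reg st r v))).
  exact: triple_assign ev erefl.
by move=> _ <-.
Qed.

Lemma triple_seq_store st e1 e2 a v c2 T2 Q :
  eval w s st e1 = Some a -> eval w s st e2 = Some v -> a < s ->
  triple (set_mem st a v) c2 T2 Q ->
  triple st (Then (Store e1 e2) c2) ((cost e1 + cost e2).+1 + T2) Q.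
Proof.
move=> ev1 ev2 lt tr; apply: (@triple_then _ _ _ _ _ (eq (set_mem st a v))).
  exact: triple_store ev1 ev2 lt erefl.
by move=> _ <-.
Qed.

(** The times of both branches are added instead of maximized, which keeps all bounds polynomial. *)
Lemma triple_if st e c1 c2 v T1 T2 Q :
  eval w s st e = Some v ->
  (v != 0 -> triple st c1 T1 Q) -> (v = 0 -> triple st c2 T2 Q) ->
  triple st (If e c1 c2) (cost e + (T1 + T2)).+1 Q.
Proof.
move=> ev h1 h2; case: (eqVneq v 0) => [v0|v0].
  have [t [st' [ex le q]]] := h2 v0; exists (cost e + t).+1, st'.
  by split=> //; [apply: ExecIfFalse ex; rewrite ev v0|lia].
have [t [st' [ex le q]]] := h1 v0; exists (cost e + t).+1, st'.
by split=> //; [apply: ExecIfTrue ev v0 ex|lia].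
Qed.

(* [k] bounds the number of remaining iterations. *)
Lemma triple_while (I : nat -> state -> Prop) st e c Tc k Q :
  I k st ->
  (forall k st, I k st -> exists2 v, eval w s st e = Some v &
     (v = 0 -> Q st) /\
     (v != 0 -> exists2 k', k = k'.+1 & triple st c Tc (I k'))) ->
  triple st (While e c) (k.+1 * (cost e + Tc).+1) Q.
Proof.
move=> Ik step; elim: k st Ik => [|k IH] st Ik.
  have [v ev [v0 vS]] := step _ _ Ik.
  case: (eqVneq v 0) => [vE|/vS [k'] //].
  exists (cost e).+1, st; split; [|lia|exact: v0].
  by apply: ExecWhileFalse; rewrite ev vE.
have [v ev [v0 vS]] := step _ _ Ik.
case: (eqVneq v 0) => [vE|vN0].
  exists (cost e).+1, st; split; [|lia|exact: v0].
  by apply: ExecWhileFalse; rewrite ev vE.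
have [k' [<-] [t1 [st1 [ex1 le1 I1]]]] := vS vN0.
have [t2 [st2 [ex2 le2 q]]] := IH _ I1.
exists (cost e + t1 + t2).+1, st2; split=> //; last by lia.
exact: ExecWhileTrue ev vN0 ex1 ex2.
Qed.

Definition For (r : nat) (lo hi : expr) (c : cmd) : cmd :=
  Then (Assign r lo)
    (While (Bin OpLt (Reg r) hi)
       (Then c (Assign r (Bin OpAdd (Reg r) (Const 1))))).

Hypothesis w_gt0 : 0 < w.

Let M_gt1 : 1 < 2 ^ w.
Proof. by rewrite -{1}(expn0 2) ltn_exp2l. Qed.

Lemma eval_const st k : k < 2 ^ w -> eval w s st (Const k) = Some k.
Proof. by move=> h /=; rewrite modn_small. Qed.

Lemma eval_add st e1 e2 x y :
  eval w s st e1 = Some x -> eval w s st e2 = Some y -> x + y < 2 ^ w ->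
  eval w s st (Bin OpAdd e1 e2) = Some (x + y).
Proof. by move=> /= -> -> h; rewrite modn_small. Qed.

Lemma eval_mul st e1 e2 x y :
  eval w s st e1 = Some x -> eval w s st e2 = Some y -> x * y < 2 ^ w ->
  eval w s st (Bin OpMul e1 e2) = Some (x * y).
Proof. by move=> /= -> -> h; rewrite modn_small. Qed.

Lemma eval_sub st e1 e2 x y :
  eval w s st e1 = Some x -> eval w s st e2 = Some y ->
  eval w s st (Bin OpSub e1 e2) = Some (x - y).
Proof. by move=> /= -> ->. Qed.

Lemma eval_div st e1 e2 x y :
  eval w s st e1 = Some x -> eval w s st e2 = Some y ->
  eval w s st (Bin OpDiv e1 e2) = Some (x %/ y).
Proof. by move=> /= -> ->. Qed.

Lemma eval_mod st e1 e2 x y :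
  eval w s st e1 = Some x -> eval w s st e2 = Some y ->
  eval w s st (Bin OpMod e1 e2) = Some (x %% y).
Proof. by move=> /= -> ->. Qed.

Lemma eval_lt st e1 e2 x y :
  eval w s st e1 = Some x -> eval w s st e2 = Some y ->
  eval w s st (Bin OpLt e1 e2) = Some (x < y : nat).
Proof. by move=> /= -> -> /=; rewrite modn_small //; case: (x < y) => //; lia. Qed.

Lemma eval_eq st e1 e2 x y :
  eval w s st e1 = Some x -> eval w s st e2 = Some y ->
  eval w s st (Bin OpEq e1 e2) = Some (x == y : nat).
Proof. by move=> /= -> -> /=; rewrite modn_small //; case: (x == y) => //; lia. Qed.

(** The upper limit is evaluated anew at every test, so the invariant has to fix its value. The 7
    pays for comparison, increment and the loop step. *)
Lemma triple_for (I : nat -> state -> Prop) st r lo hi c l h Tc Q :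
  eval w s st lo = Some l -> l <= h -> h < 2 ^ w ->
  I l (set_reg st r l) ->
  (forall i st', I i st' -> reg_of st' r = i -> eval w s st' hi = Some h) ->
  (forall i st', l <= i < h -> reg_of st' r = i -> I i st' ->
     triple st' c Tc
       (fun st'' => reg_of st'' r = i /\ I i.+1 (set_reg st'' r i.+1))) ->
  (forall st', reg_of st' r = h -> I h st' -> Q st') ->
  triple st (For r lo hi c)
    ((cost lo).+1 + (h - l).+1 * (cost hi + Tc + 7)) Q.
Proof.
move=> evlo lh hM Il evhi body fin; apply: triple_seq_assign evlo _.
(* The while rule counts remaining iterations, so the invariant is read at [h - k]. *)
pose J k st' := [/\ reg_of st' r = h - k, l + k <= h & I (h - k) st'].
apply: triple_le.
  apply: (@triple_while J _ _ _ (Tc + 4) (h - l)) => [|k st' [rk lk Ik]].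
    by split; rewrite ?subKn //= ?eqxx //; lia.
  exists (h - k < h : nat).
    apply: eval_lt; last exact: evhi Ik rk.
    by rewrite /= rk.
  split=> [ge|lt].
    have k0 : k = 0 by lia.
    by apply: fin; rewrite ?rk -?[X in I X]k0; move: rk Ik; rewrite k0 subn0.
  case: k rk lk Ik lt => [|k] rk lk Ik lt; first by lia.
  exists k => //.
  have hk : (h - k.+1).+1 = h - k by lia.
  apply: triple_then (body _ _ _ rk Ik) _; first by lia.
  move=> st2 [rE]; rewrite hk => I2.
  apply: (@triple_assign _ _ _ (h - k)).
    by rewrite /= rE !modn_small; [congr Some| | |]; lia.
  by split=> //=; [rewrite eqxx | lia].
rewrite /=; nia.
Qed.

(* Only addresses and loop bounds are tracked as exact naturals; weights are
   read in the ring Z/2^w, where subtraction makes sense and overflow is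
   harmless. *)

Local Notation W := 'Z_(2 ^ w).
Local Open Scope ring_scope.

Definition evalR st e (v : W) := exists2 x, eval w s st e = Some x & x%:R = v.

Lemma evalR_eval st e x : eval w s st e = Some x -> evalR st e x%:R.
Proof. by exists x. Qed.

Lemma evalR_add st e1 e2 v1 v2 :
  evalR st e1 v1 -> evalR st e2 v2 -> evalR st (Bin OpAdd e1 e2) (v1 + v2).
Proof.
move=> [x1 e1E <-] [x2 e2E <-]; eexists; first by rewrite /= e1E e2E; reflexivity.
by rewrite /= Zp_nat_mod // natrD.
Qed.

Lemma evalR_mul st e1 e2 v1 v2 :
  evalR st e1 v1 -> evalR st e2 v2 -> evalR st (Bin OpMul e1 e2) (v1 * v2).
Proof.
move=> [x1 e1E <-] [x2 e2E <-]; eexists; first by rewrite /= e1E e2E; reflexivity.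
by rewrite /= Zp_nat_mod // natrM.
Qed.

Lemma evalR_reg st r v : (reg_of st r)%:R = v -> evalR st (Reg r) v.
Proof. by move=> <-; exists (reg_of st r). Qed.

Lemma triple_seq_assignR st r e v c2 T2 Q :
  evalR st e v ->
  (forall x, x%:R = v -> triple (set_reg st r x) c2 T2 Q) ->
  triple st (Then (Assign r e) c2) ((cost e).+1 + T2) Q.
Proof. by move=> [x ev xv] h; apply: triple_seq_assign ev (h x xv). Qed.

Lemma triple_assignR st r e v Q :
  evalR st e v -> (forall x, x%:R = v -> Q (set_reg st r x)) ->
  triple st (Assign r e) (cost e).+1 Q.
Proof. by move=> [x ev xv] h; apply: triple_assign ev (h x xv). Qed.

End Triples.

(** * The program *)

(* The memory is cut into arrays of [N] words.
   Arrays: 0 = input permutation, 1 = its inverse, 2-3 and 4-5 = segment trees,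
   6-8 = weights of the transposed problem, from 9 on = weights of the vertices.
   Registers: 0 = n, 1 = N, 2 = strip width b, 3 = -1 modulo the word size,
   4 = running total. *)
Definition addr (k : nat) (e : expr) : expr :=
  Bin OpAdd (Bin OpMul (Const k) (Reg 1)) e.

Definition get (k : nat) (e : expr) : expr := Fetch (addr k e).

(* A segment tree occupies the arrays [k] and [k.+1]: the node [q] has children
   [2q] and [2q+1], the leaves are the nodes [N, ..., 2N-1].
   Registers: 8 = key, 7 = increment, 6 = result, 5 = current node. *)
Definition upd (k : nat) : cmd :=
  Then (Assign 5 (Bin OpAdd (Reg 1) (Reg 8)))
    (While (Reg 5)
       (Then (Store (addr k (Reg 5)) (Bin OpAdd (get k (Reg 5)) (Reg 7)))
          (Assign 5 (Bin OpDiv (Reg 5) (Const 2))))).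

Definition qry (k : nat) : cmd :=
  Then (Assign 5 (Bin OpAdd (Reg 1) (Reg 8)))
    (Then (Assign 6 (Const 0))
       (While (Bin OpLt (Const 1) (Reg 5))
          (Then
             (If (Bin OpMod (Reg 5) (Const 2))
                (Assign 6 (Bin OpAdd (Reg 6)
                             (get k (Bin OpSub (Reg 5) (Const 1)))))
                Skip)
             (Assign 5 (Bin OpDiv (Reg 5) (Const 2)))))).

Definition clear (k : nat) : cmd :=
  For 5 (Const 0) (Bin OpMul (Const 2) (Reg 1)) (Store (addr k (Reg 5)) (Const 0)).

(** The sweep goes by position and the tree is keyed by value. Querying before inserting restricts
    the sum to points strictly to the left. Since [dst] is multiplied in place, one call per child
    builds up the product over all children. *)
Definition dominate (src dst : nat) : cmd :=
  Then (clear 2)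
    (For 10 (Const 0) (Reg 0)
       (Then (Assign 8 (get 0 (Reg 10)))
       (Then (qry 2)
       (Then (Store (addr dst (Reg 10)) (Bin OpMul (get dst (Reg 10)) (Reg 6)))
       (Then (Assign 7 (get src (Reg 10)))
          (upd 2)))))).

(* One sweep by increasing position for a fixed strip number q (register 11):
   tree 2 collects weights of vertex 1 with value strip < q, tree 4 those of the
   inversions so started (through vertex 2 if [h]); keys are reversed, so that
   prefix sums range over larger values.  Register 13 is the total weight over
   positions before i, register 14 its value at the start of the position strip
   of i, and register 9 the coefficient of the latter. *)
Definition sweep_mid (h : bool) (U2 : nat) : cmd :=
  if h then
    Then (qry 2)
    (Then (Assign 17 (Bin OpMul (get U2 (Reg 10)) (Reg 6)))
    (Then (Assign 7 (Reg 19)) (upd 2)))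
  else Assign 17 (Reg 19).

Definition sweep_step (h : bool) (P U1 U2 U3 : nat) : cmd :=
  Then (Assign 15 (get P (Reg 10)))
  (Then (Assign 8 (Bin OpSub (Bin OpSub (Reg 1) (Const 1)) (Reg 15)))
  (Then (Assign 19 (Bin OpMul (Bin OpLt (Bin OpDiv (Reg 15) (Reg 2)) (Reg 11))
                              (get U1 (Reg 10))))
  (Then (sweep_mid h U2)
  (Then (qry 4)
  (Then (Assign 18 (Bin OpMul (get U3 (Reg 10)) (Reg 6)))
  (Then (If (Bin OpMod (Reg 10) (Reg 2)) Skip (Assign 14 (Reg 13)))
  (Then (If (Bin OpEq (Bin OpDiv (Reg 15) (Reg 2)) (Reg 11))
           (Assign 4 (Bin OpAdd (Reg 4)
                        (Bin OpAdd (Reg 13) (Bin OpMul (Reg 9) (Reg 14)))))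
           Skip)
  (Then (Assign 13 (Bin OpAdd (Reg 13) (Reg 18)))
  (Then (Assign 7 (Reg 17))
     (upd 4)))))))))).

Definition sweep (h : bool) (P U1 U2 U3 : nat) : cmd :=
  Then (clear 2) (Then (clear 4)
  (Then (Assign 13 (Const 0)) (Then (Assign 14 (Const 0))
    (For 10 (Const 0) (Reg 0) (sweep_step h P U1 U2 U3))))).

Definition strips (h : bool) (P U1 U2 U3 : nat) : cmd :=
  Then (Assign 12 (Bin OpAdd (Bin OpDiv (Reg 0) (Reg 2)) (Const 1)))
    (For 11 (Const 0) (Reg 12) (sweep h P U1 U2 U3)).

(* For the alpha in register 20, enumerates the lambda > alpha in its strip, and
   for each of them the kappa in the strip of [P lambda] below [P lambda].  With
   [tr = false], (alpha, lambda) = positions of (3, 4) and kappa is the value of 1;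
   with [tr = true] (arrays exchanged), (alpha, lambda) = values of (1, 4) and
   kappa is the position of 3.  The number of vertices 2 in the rectangle spanned
   by 1 and 3 is a difference of two segment-tree queries at the time of 3 minus
   one at the time of 1, hence the two passes. *)
Definition pairs_add (h tr : bool) (U1 U3 : nat) : cmd :=
  if h then
    Then (Assign 8 (Reg (if tr then 26 else 25)))
    (Then (qry 2)
    (Then (Assign 27 (Reg 6))
    (Then (Assign 8 (Reg (if tr then 20 else 21)))
    (Then (qry 2)
      (Assign 4 (Bin OpAdd (Reg 4)
        (Bin OpMul (Bin OpMul (get U1 (Reg 26)) (get U3 (Reg 20)))
           (Bin OpAdd (Reg 27) (Bin OpMul (Reg 3) (Reg 6)))))))))) 
  else Assign 4 (Bin OpAdd (Reg 4)
         (Bin OpMul (get U1 (Reg 26)) (get U3 (Reg 20)))).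

Definition pairs_step (h tr : bool) (Qk U1 U3 : nat) : cmd :=
  Then (Assign 26 (get Qk (Reg 25)))
    (If (Bin OpMul (Bin OpLt (Reg 21) (Reg 25)) (Bin OpLt (Reg 26) (Reg 20)))
       (pairs_add h tr U1 U3) Skip).

Definition pairs_row (h tr : bool) (Pk Qk U1 U3 : nat) : cmd :=
  Then (Assign 24 (get Pk (Reg 23)))
    (For 25 (Bin OpMul (Bin OpDiv (Reg 24) (Reg 2)) (Reg 2)) (Reg 24)
       (pairs_step h tr Qk U1 U3)).

Definition pairs (h tr : bool) (Pk Qk U1 U3 : nat) : cmd :=
  Then (Assign 21 (get Pk (Reg 20)))
  (Then (Assign 22 (Bin OpMul (Bin OpAdd (Bin OpDiv (Reg 20) (Reg 2)) (Const 1))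
                              (Reg 2)))
  (Then (If (Bin OpLt (Reg 0) (Reg 22)) (Assign 22 (Reg 0)) Skip)
    (For 23 (Bin OpAdd (Reg 20) (Const 1)) (Reg 22)
       (pairs_row h tr Pk Qk U1 U3)))).

(** On arrival at a position, tree 2 holds the weights of vertex 2 strictly to its left. The first
    call takes this position for vertex 3. The second takes it for vertex 1, passed by its value
    because the arrays are exchanged. *)
Definition corner_step (h : bool) (U1 U2 U3 : nat) : cmd :=
  Then (Assign 20 (Reg 30))
  (Then (pairs h false 0 1 U1 U3)
  (Then (if h then Then (Assign 20 (get 0 (Reg 30))) (pairs true true 1 0 6 8)
         else Skip)
  (Then (Assign 8 (get 0 (Reg 30)))
  (Then (Assign 7 (get U2 (Reg 30)))
     (upd 2))))).

Definition corner (h : bool) (U1 U2 U3 : nat) : cmd :=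
  Then (clear 2) (For 30 (Const 0) (Reg 0) (corner_step h U1 U2 U3)).

(** Storing at the index given by the permutation serves three purposes: it inverts the permutation,
    re-indexes weights by value, and fills an array with a constant. *)
Definition scatter (dst : nat) (e : expr) : cmd :=
  For 10 (Const 0) (Reg 0) (Store (addr dst (get 0 (Reg 10))) e).

(** Starting at 2 rather than 1 makes the result [2 ^ (trunc_log 2 n).+1] for n = 0 as well. *)
Definition size_loop : cmd :=
  Then (Assign 1 (Const 2))
    (While (Bin OpLt (Reg 1) (Bin OpAdd (Reg 0) (Const 1)))
       (Assign 1 (Bin OpMul (Const 2) (Reg 1)))).

(** Linear search is affordable: it takes about n^{1/3} rounds. *)
Definition root_loop : cmd :=
  Then (Assign 2 (Const 1))
    (While (Bin OpLt (Bin OpMul (Bin OpMul (Reg 2) (Reg 2)) (Reg 2)) (Reg 0))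
       (Assign 2 (Bin OpAdd (Reg 2) (Const 1)))).

(* Doubling [x] into [2x + 1] stops at the largest word, which stands for -1. *)
Definition minus_one_loop : cmd :=
  Then (Assign 3 (Const 1))
    (While (Bin OpLt (Reg 3) (Bin OpAdd (Bin OpMul (Const 2) (Reg 3)) (Const 1)))
       (Assign 3 (Bin OpAdd (Bin OpMul (Const 2) (Reg 3)) (Const 1)))).

Fact croot_subproof n : exists b, (0 < b) && (n <= b ^ 3).
Proof.
exists n.+1; rewrite /= (leq_trans (leqnSn n)) //.
by rewrite -{1}(expn1 n.+1) leq_pexp2l.
Qed.

(** The rounded-up cube root, forced to be positive so that strips have a width even for n = 0. *)
Definition croot n := ex_minn (croot_subproof n).

Lemma croot_gt0 n : 0 < croot n.
Proof. by rewrite /croot; case: ex_minnP => b /andP[]. Qed.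

Lemma croot_ge n : n <= croot n ^ 3.
Proof. by rewrite /croot; case: ex_minnP => b /andP[]. Qed.

Lemma croot_lt n k : 0 < k < croot n -> k ^ 3 < n.
Proof.
rewrite /croot; case: ex_minnP => b _ bmin /andP[k0 kb].
by rewrite ltnNge; apply: contraL kb => kn; rewrite -leqNgt bmin // k0.
Qed.

Fixpoint seq_cmd (T : Type) (f : T -> cmd) (l : seq T) : cmd :=
  if l is x :: l' then Then (f x) (seq_cmd f l') else Skip.

Definition setup_cmd (K : nat) (edges : seq (nat * nat)) : cmd :=
  Then size_loop (Then root_loop (Then minus_one_loop
  (Then (scatter 1 (Reg 10))
  (Then (seq_cmd (fun k => scatter k (Const 1)) (iota 9 (K - 9)))
     (seq_cmd (fun e => dominate e.1 e.2) edges))))).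

(** Arrays 6 to 8 hold the weights indexed by value. Transposition reverses the decreasing chain 1,
    2, 3, so vertex 3 takes the place of vertex 1 in the second run of [strips]. The final addition
    of 0 reduces the total modulo [2 ^ w], which makes the output a canonical residue without a
    bound on register 4. *)
Definition count_cmd (h : bool) (U1 U2 U3 : nat) : cmd :=
  Then (scatter 6 (get U3 (Reg 10)))
  (Then (scatter 7 (get U2 (Reg 10)))
  (Then (scatter 8 (get U1 (Reg 10)))
  (Then (Assign 4 (Const 0))
  (Then (Assign 9 (Reg 3))
  (Then (strips h 0 U1 U2 U3)
  (Then (Assign 9 (Const 0))
  (Then (strips h 1 6 7 8)
  (Then (corner h U1 U2 U3)
     (Assign 0 (Bin OpAdd (Reg 4) (Const 0))))))))))).

(** * Correctness of the program *)

Ltac sub_seq :=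
  let x := fresh "x" in let h := fresh "h" in
  intros x; rewrite ?inE; intros h;
  repeat (case/orP: h => h); rewrite ?h ?orbT //.

Ltac notin :=
  rewrite ?inE ?negb_or; repeat (apply/andP; split); by [|rewrite eq_sym].

Section Machine.
Variables (w s K L N : nat).
Hypothesis w_gt0 : 0 < w.
Hypothesis NE : N = 2 ^ L.
Hypothesis KNs : K * N <= s.
Hypothesis KNw : 8 * (K + 2) * N < 2 ^ w.

Local Notation W := 'Z_(2 ^ w).
Local Notation triple := (triple w s).
Local Notation eval := (eval w s).

Implicit Types (st : state).

Definition ar st k i := mem_of st (k * N + i).

(** The array of an address is read off its quotient by [N], so disjointness of arrays is a
    comparison of array numbers. *)
Definition frame (rs ks : seq nat) st st' :=
  (forall r, r \notin rs -> reg_of st' r = reg_of st r) /\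
  (forall a, a %/ N \notin ks -> mem_of st' a = mem_of st a).

Lemma N_gt0 : 0 < N. Proof. by rewrite NE expn_gt0. Qed.

Lemma frame_trans rs ks st1 st2 st3 :
  frame rs ks st1 st2 -> frame rs ks st2 st3 -> frame rs ks st1 st3.
Proof.
by move=> [r1 a1] [r2 a2]; split=> x h; [rewrite r2 ?r1 | rewrite a2 ?a1].
Qed.

Lemma frame_sub rs ks rs' ks' st1 st2 :
  frame rs ks st1 st2 -> {subset rs <= rs'} -> {subset ks <= ks'} ->
  frame rs' ks' st1 st2.
Proof.
move=> [r1 a1] rr kk; split=> x h; [apply: r1 | apply: a1].
  by apply: contra h => /rr.
by apply: contra h => /kk.
Qed.

Lemma frame_reg rs ks st st' r :
  frame rs ks st st' -> r \notin rs -> reg_of st' r = reg_of st r.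
Proof. by move=> [fr _] /fr. Qed.

Lemma frame_ar rs ks st st' k i :
  frame rs ks st st' -> k \notin ks -> i < N -> ar st' k i = ar st k i.
Proof.
move=> [_ a1] h iN; apply: a1.
by rewrite divnMDl ?N_gt0 // divn_small // addn0.
Qed.

Lemma frame_set_reg rs ks r v st : r \in rs -> frame rs ks st (set_reg st r v).
Proof. by move=> h; split=> // x /=; case: eqP => // ->; rewrite h. Qed.

Lemma frame_set_mem rs ks a v st : a %/ N \in ks -> frame rs ks st (set_mem st a v).
Proof. by move=> h; split=> // x /=; case: eqP => // ->; rewrite h. Qed.

Lemma ltn_ar k i : k < K -> i < N -> k * N + i < K * N.
Proof. by move=> kK iN; nia. Qed.

Lemma ltn_ar2 k i : k.+1 < K -> i < 2 * N -> k * N + i < K * N.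
Proof. by move=> kK iN; nia. Qed.

Lemma eval_addr st k e i :
  reg_of st 1 = N -> eval st e = Some i -> k * N + i < K * N ->
  eval st (addr k e) = Some (k * N + i).
Proof.
move=> r1 ev lt; have := N_gt0 => Ng.
apply: eval_add ev _; last by nia.
by apply: eval_mul; [apply: eval_const; nia | rewrite /= r1 | nia].
Qed.

Lemma eval_get st k e i :
  reg_of st 1 = N -> eval st e = Some i -> k * N + i < K * N ->
  eval st (get k e) = Some (ar st k i).
Proof.
move=> r1 ev lt; have := eval_addr r1 ev lt; rewrite /get.
by move: (addr k e) => e' /= ->; rewrite (leq_trans lt KNs).
Qed.

Lemma ar_set_mem st k i k' i' v : i < N -> i' < N ->
  ar (set_mem st (k * N + i) v) k' i' =
  if (k' == k) && (i' == i) then v else ar st k' i'.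
Proof.
move=> iN iN' /=; rewrite /ar /=.
suff -> : (k' * N + i' == k * N + i) = (k' == k) && (i' == i) by [].
apply/eqP/andP => [E|[/eqP -> /eqP ->] //].
have /eqP k'k : k' = k.
  have := congr1 (divn^~ N) E.
  by rewrite !divnMDl ?N_gt0 // !divn_small // !addn0.
by split=> //; move: E; rewrite (eqP k'k) => /addnI ->.
Qed.

Lemma node_div k q : q < 2 * N -> (k * N + q) %/ N \in [:: k; k.+1]%N.
Proof.
move=> qN; have Ng := N_gt0; rewrite divnMDl // !inE.
case: (ltnP q N) => h; first by rewrite divn_small // addn0 eqxx.
rewrite (_ : q = 1 * N + (q - N)); last by lia.
by rewrite divnMDl // divn_small ?addn0 ?addn1 ?eqxx ?orbT //; lia.
Qed.

(** * Segment trees: update, prefix query and reset *)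

Local Open Scope ring_scope.

(** Inner nodes obey a local relation instead of being described as interval sums: an update
    violates it at one node at a time, and a query uses it one level at a time. *)
Definition tree st k (f : nat -> W) :=
  (forall q, (0 < q < N)%N ->
     (ar st k q)%:R = (ar st k (2 * q))%:R + (ar st k (2 * q).+1)%:R :> W) /\
  (forall x, (x < N)%N -> (ar st k (N + x))%:R = f x).

Lemma tree_frame rs ks st st' k f : frame rs ks st st' ->
  k \notin ks -> k.+1 \notin ks -> tree st k f -> tree st' k f.
Proof.
move=> [_ fr] k1 k2 [tI tL].
have E q : (q < 2 * N)%N -> ar st' k q = ar st k q.
  move=> qN; apply: fr; have := node_div k qN.
  by rewrite !inE => /orP[] /eqP ->.
split=> q qN.
  rewrite [ar st' k q]E; last by lia.
  by rewrite tI // !E //; lia.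
by rewrite E ?tL //; lia.
Qed.

Lemma tree_ext st k f g : (forall x, (x < N)%N -> f x = g x) ->
  tree st k f -> tree st k g.
Proof. by move=> fg [tI tL]; split=> // x xN; rewrite -fg // tL. Qed.

(** Throughout the loop the current node [p] is the only one that lacks [v]. Incrementing it moves
    the defect to its parent [p %/ 2], and the defect leaves the tree when the node becomes 0. *)
Lemma updP st k f key v Q : (k.+1 < K)%N -> reg_of st 1 = N ->
  reg_of st 8 = key -> (key < N)%N -> (reg_of st 7)%:R = v -> tree st k f ->
  (forall st', frame [:: 5]%N [:: k; k.+1]%N st st' ->
     tree st' k (fun x => f x + (x == key)%:R * v) -> Q st') ->
  triple st (upd k) (20 * (L + 3)) Q.
Proof.
move=> kK r1 r8 keyN r7 [tI tL] fin; have Ng := N_gt0.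
have Lw : (N < 2 ^ L.+1)%N by rewrite expnS -NE; lia.
apply: triple_le.
  apply: (@triple_seq_assign _ _ _ _ _ (N + key)%N).
    by apply: eval_add; rewrite /= ?r1 ?r8 //; nia.
  pose J e st' := exists p, [/\ reg_of st' 5 = p, (p < 2 ^ e)%N /\ (p < 2 * N)%N,
    frame [:: 5]%N [:: k; k.+1]%N st st',
    forall q, (0 < q < N)%N -> (ar st' k q)%:R + (q == p)%:R * v =
      (ar st' k (2 * q))%:R + (ar st' k (2 * q).+1)%:R :> W &
    forall x, (x < N)%N ->
      (ar st' k (N + x))%:R + ((N + x)%N == p)%:R * v = f x + (x == key)%:R * v].
  apply: (@triple_while _ _ J _ _ _ 18 L.+1).
    exists (N + key)%N; split=> //=.
    - by rewrite expnS -NE; lia.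
    - exact: frame_set_reg.
    - move=> q qN; rewrite -tI // (_ : (q == N + key)%N = false) ?mul0r ?addr0 //.
      by apply/eqP; lia.
    - by move=> x xN; rewrite eqn_add2l -tL.
  move=> e st1 [p [r5 [pe pN] fr nI nL]].
  exists p; first by rewrite /= r5.
  split=> [p0|pN0].
    apply: fin => //; split=> [q qN|x xN].
      by rewrite -nI // (_ : (q == p) = false) ?mul0r ?addr0 //; apply/eqP; lia.
    by rewrite -nL // (_ : (_ == p) = false) ?mul0r ?addr0 //; apply/eqP; lia.
  case: e pe => [|e] pe; first by rewrite expn0 in pe; lia.
  exists e => //.
  have r1' : reg_of st1 1 = N by rewrite (frame_reg fr).
  have pA := ltn_ar2 kK pN.
  have [x ex xv] : evalR s st1 (Bin OpAdd (get k (Reg 5)) (Reg 7)) ((ar st1 k p)%:R + v).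
    apply: evalR_add => //; last by apply: evalR_reg; rewrite (frame_reg fr).
    by apply: evalR_eval; rewrite (eval_get (i := p)) //= r5.
  apply: triple_le.
    apply: (@triple_seq_store _ _ _ _ _ (k * N + p)%N x) => //.
    - by apply: eval_addr; rewrite //= r5.
    - exact: leq_trans pA KNs.
    apply: (@triple_assign _ _ _ _ _ (p %/ 2)).
      by apply: eval_div; [rewrite /= r5 | apply: eval_const; nia].
    have arE q : ar (set_reg (set_mem st1 (k * N + p) x) 5 (p %/ 2)) k q =
        if q == p then x else ar st1 k q.
      by rewrite /ar /= eqn_add2l.
    exists (p %/ 2)%N; split=> //.
    - split; first by rewrite ltn_divLR // -expnSr.
      by apply: leq_ltn_trans pN; apply: leq_div.
    - apply: (frame_trans fr); apply: (@frame_trans _ _ _ (set_mem st1 (k * N + p) x)).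
        exact/frame_set_mem/node_div.
      exact: frame_set_reg.
    - move=> q qN; rewrite !arE; have := nI q qN.
      case: (eqVneq q p) => [->|qp].
        have -> : (p == p %/ 2)%N = false by apply/eqP; lia.
        have -> : (2 * p == p)%N = false by apply/eqP; lia.
        have -> : ((2 * p).+1 == p)%N = false by apply/eqP; lia.
        by rewrite mul0r addr0 mul1r xv.
      rewrite mul0r addr0 => ->.
      case: (eqVneq (2 * q)%N p) => [pE|np].
        have -> : ((2 * q).+1 == p)%N = false by apply/eqP; lia.
        have -> : (q == p %/ 2)%N = true by apply/eqP; lia.
        by rewrite xv pE /=; ring.
      case: (eqVneq (2 * q).+1%N p) => [pE|np'].
        have -> : (q == p %/ 2)%N = true by apply/eqP; lia.
        by rewrite xv pE /=; ring.
      have -> : (q == p %/ 2)%N = false by apply/eqP; lia.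
      by rewrite mul0r addr0.
    - move=> y yN; rewrite arE -nL // (_ : (N + y == p %/ 2)%N = false).
        by case: eqP => [->|_]; rewrite ?xv /=; ring.
      by apply/eqP; have := leq_trunc_div p 2; lia.
  by rewrite /=; lia.
rewrite /=; nia.
Qed.

(** The current node is the [j]-th one of level [e]. The result so far plus the nodes of this level
    left of it is always the prefix sum. If [j] is odd, its left sibling goes into the result; the
    other nodes pair up into their parents one level higher. *)
Lemma qryP st k f key Q : (k.+1 < K)%N -> reg_of st 1 = N ->
  reg_of st 8 = key -> (key < N)%N -> tree st k f ->
  (forall st', frame [:: 5; 6]%N [::]%N st st' ->
     (reg_of st' 6)%:R = \sum_(0 <= x < key) f x -> Q st') ->
  triple st (qry k) (30 * (L + 3)) Q.
Proof.
move=> kK r1 r8 keyN tr fin; have Ng := N_gt0.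
apply: triple_le.
  apply: (@triple_seq_assign _ _ _ _ _ (N + key)%N).
    by apply: eval_add; rewrite /= ?r1 ?r8 //; nia.
  apply: (@triple_seq_assign _ _ _ _ _ 0%N); first by apply: eval_const; nia.
  pose J e st' := exists j, [/\ reg_of st' 5 = (2 ^ e + j)%N, (e <= L)%N, (j < 2 ^ e)%N,
    frame [:: 5; 6]%N [::]%N st st' &
    (reg_of st' 6)%:R + \sum_(0 <= x < j) (ar st k (2 ^ e + x))%:R =
    \sum_(0 <= x < key) f x].
  apply: (@triple_while _ _ J _ _ _ 21 L).
    exists key; split=> //=; rewrite -?NE //.
      by apply: (@frame_trans _ _ _ (set_reg st 5 (N + key))); apply: frame_set_reg.
    by rewrite add0r; apply: eq_big_nat => x xk; rewrite tr.2 //; lia.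
  move=> e st1 [j [r5 eL je fr sE]].
  have r1' : reg_of st1 1 = N by rewrite (frame_reg fr).
  have eN : (2 ^ e <= N)%N by rewrite NE leq_exp2l.
  exists (1 < 2 ^ e + j)%N.
    by apply: eval_lt => //; [apply: eval_const; nia | rewrite /= r5].
  split=> [p0|pN0].
    have e0 : e = 0%N by case: e {r5 eL sE eN} je p0 => // e; rewrite expnS; have := expn_gt0 2 e; lia.
    apply: fin => //; rewrite -sE.
    have -> : j = 0%N by rewrite e0 expn0 in je; lia.
    by rewrite big_geq // addr0.
  case: e r5 eL je sE eN pN0 => [|e] r5 eL je sE eN pN0.
    by rewrite expn0 in je pN0; lia.
  exists e => //.
  have E2 : (2 ^ e.+1 = 2 * 2 ^ e)%N by rewrite expnS.
  have half : ((2 ^ e.+1 + j) %/ 2 = 2 ^ e + j %/ 2)%N by rewrite E2 mulnC divnMDl.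
  have trE x : (x < 2 ^ e)%N -> (ar st k (2 ^ e + x))%:R =
     (ar st k (2 ^ e.+1 + 2 * x))%:R + (ar st k (2 ^ e.+1 + (2 * x).+1))%:R :> 'Z_(2 ^ w).
    move=> xe; rewrite tr.1; last by have := expn_gt0 2 e; lia.
    by rewrite E2; congr ((ar _ _ _)%:R + (ar _ _ _)%:R); lia.
  have dbl m : (m <= 2 ^ e)%N -> \sum_(0 <= x < 2 * m) (ar st k (2 ^ e.+1 + x))%:R =
     \sum_(0 <= x < m) (ar st k (2 ^ e + x))%:R :> 'Z_(2 ^ w).
    elim: m => [|m IHm] me; first by rewrite !big_geq.
    rewrite mulnS !addSn add0n 2?big_nat_recr //= IHm; last by lia.
    by rewrite big_nat_recr //= -addrA trE.
  apply: triple_le.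
    apply: (@triple_then _ _ _ _ _ _ _ (fun st2 => frame [:: 6]%N [::]%N st1 st2 /\
      (reg_of st2 6)%:R = (reg_of st1 6)%:R + (odd j)%:R * (ar st k (2 ^ e.+1 + j.-1))%:R :> 'Z_(2 ^ w))).
      apply: (@triple_if _ _ _ _ _ _ ((2 ^ e.+1 + j) %% 2)).
      - by apply: eval_mod; [rewrite /= r5|apply: eval_const; nia].
      - rewrite modn2 oddD E2 oddM /=; case: (boolP (odd j)) => // jo _.
        have jg : (0 < j)%N by case: (j) jo.
        apply: triple_assignR.
          apply: evalR_add => //; first exact: evalR_reg.
          apply: evalR_eval; apply: (eval_get (i := (2 ^ e.+1 + j.-1)%N)) => //.
            have -> : (2 ^ e.+1 + j.-1 = 2 ^ e.+1 + j - 1)%N by lia.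
            by apply: eval_sub; [rewrite /= r5 | apply: eval_const; nia].
          by apply: ltn_ar2 => //; lia.
        move=> x xv; split; first exact: frame_set_reg.
        by rewrite /= xv mul1r /ar -E2 fr.2.
      - rewrite modn2 oddD E2 oddM /=; case: (boolP (odd j)) => // jo _.
        by apply: triple_skip; split=> //; rewrite mul0r addr0.
    move=> st2 [fr2 r6].
    apply: (@triple_assign _ _ _ _ _ (2 ^ e + j %/ 2)).
      rewrite (@eval_div _ _ _ _ _ (2 ^ e.+1 + j) 2) ?half //=.
        by rewrite (frame_reg fr2) // r5.
      by rewrite modn_small //; nia.
    exists (j %/ 2)%N; split=> //=.
    - exact: ltnW.
    - by lia.
    - apply: (frame_trans fr); apply: (@frame_trans _ _ _ st2).
        by apply: (frame_sub fr2) => // x; rewrite !inE => /eqP ->; rewrite eqxx orbT.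
      exact: frame_set_reg.
    - rewrite r6 -sE -addrA; congr (_ + _); rewrite -dbl; last by lia.
      case: (boolP (odd j)) => jo.
        have jE : j = (2 * (j %/ 2)).+1 by lia.
        rewrite mul1r {3}jE big_nat_recr //= addrC; congr (_ + (ar _ _ (_ + _))%:R).
        by lia.
      by rewrite mul0r add0r; congr bigop; congr index_iota; lia.
  by rewrite /=; lia.
rewrite /=; nia.
Qed.

Lemma clearP st k Q : (k.+1 < K)%N -> reg_of st 1 = N ->
  (forall st', frame [:: 5]%N [:: k; k.+1]%N st st' ->
     tree st' k (fun=> 0) -> Q st') ->
  triple st (clear k) (60 * N) Q.
Proof.
move=> kK r1 fin; have Ng := N_gt0.
apply: triple_le.
  apply: (@triple_for _ _ _ (fun i st' => frame [:: 5]%N [:: k; k.+1]%N st st' /\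
     forall x, (x < i)%N -> ar st' k x = 0%N) _ _ _ _ _ 0%N (2 * N)%N 7).
  - by [].
  - by apply: eval_const; nia.
  - by [].
  - by nia.
  - by split=> //; apply: frame_set_reg.
  - move=> i st' [fr _] _; apply: eval_mul; [apply: eval_const; nia| |nia].
    by rewrite /= (frame_reg fr) // r1.
  - move=> i st' /andP[_ iN] r5 [fr z].
    have r1' : reg_of st' 1 = N by rewrite (frame_reg fr).
    have iA := ltn_ar2 kK iN.
    apply: (@triple_store _ _ _ _ _ (k * N + i)%N 0%N).
    + by apply: eval_addr; rewrite //= r5.
    + by apply: eval_const; nia.
    + exact: leq_trans iA KNs.
    split=> //; split.
      apply: (frame_trans fr); apply: (@frame_trans _ _ _ (set_mem st' (k * N + i) 0)).
        exact/frame_set_mem/node_div.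
      exact: frame_set_reg.
    move=> x xi; rewrite /ar /= eqn_add2l; case: eqP => // xE.
    by apply: z; lia.
  - move=> st' _ [fr z]; apply: fin => //; split=> q qN; rewrite !z ?addr0 //; lia.
rewrite /=; nia.
Qed.

(** * Dominance sums by a sweep *)

Definition cont (key : nat -> nat) (u : nat -> W) (m x : nat) : W :=
  \sum_(0 <= j < m) (x == key j)%:R * u j.

(** This turns a prefix sum over keys, as returned by [qry], into a sum over the points inserted so
    far. *)
Lemma sum_cont key u m k :
  \sum_(0 <= x < k) cont key u m x = \sum_(0 <= j < m) (key j < k)%N%:R * u j.
Proof.
rewrite exchange_big_nat /=; apply: eq_bigr => j _.
rewrite -mulr_suml; congr (_ * _).
elim: k => [|k IH]; first by rewrite big_geq.
rewrite big_nat_recr //= IH ltnS [in RHS]leq_eqVlt eq_sym.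
by case: (ltngtP (key j) k) => //=; rewrite ?addr0 ?add0r.
Qed.

Lemma cont_recr key u m x :
  cont key u m.+1 x = cont key u m x + (x == key m)%:R * u m.
Proof. by rewrite /cont big_nat_recr. Qed.

Lemma ar_set_reg st r v : ar (set_reg st r v) = ar st.
Proof. by []. Qed.

Lemma eval_get_reg st k r i : reg_of st 1 = N -> reg_of st r = i ->
  (k < K)%N -> (i < N)%N -> eval st (get k (Reg r)) = Some (ar st k i).
Proof.
by move=> r1 ri kK iN; apply: eval_get => //=; [rewrite ri | apply: ltn_ar].
Qed.

Lemma eval_addr_reg st k r i : reg_of st 1 = N -> reg_of st r = i ->
  (k < K)%N -> (i < N)%N -> eval st (addr k (Reg r)) = Some (k * N + i)%N.
Proof.
by move=> r1 ri kK iN; apply: eval_addr => //=; [rewrite ri | apply: ltn_ar].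
Qed.

Lemma dominateP st src dst n P (u d : nat -> W) Q :
  (n <= N)%N -> (3 < K)%N -> (src < K)%N -> (dst < K)%N ->
  src != dst -> src \notin [:: 2; 3]%N -> dst \notin [:: 0; 2; 3]%N ->
  reg_of st 0 = n -> reg_of st 1 = N ->
  (forall i, (i < n)%N -> ar st 0 i = P i) -> (forall i, (i < n)%N -> (P i < N)%N) ->
  (forall i, (i < n)%N -> (ar st src i)%:R = u i) ->
  (forall i, (i < n)%N -> (ar st dst i)%:R = d i) ->
  (forall st', frame [:: 5; 6; 7; 8; 10]%N [:: 2; 3; dst]%N st st' ->
     (forall i, (i < n)%N ->
        (ar st' dst i)%:R = d i * \sum_(0 <= j < i) (P j < P i)%N%:R * u j) -> Q st') ->
  triple st (dominate src dst) (200 * N * (L + 3)) Q.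
Proof.
move=> nN K3 srcK dstK sd src23 dst023 r0 r1 aP PN asrc adst fin; have Ng := N_gt0.
have [d0 d2 d3] : [/\ dst != 0, dst != 2 & dst != 3]%N.
  by move: dst023; rewrite !inE !negb_or => /and3P[].
have [s2 s3] : (src != 2 /\ src != 3)%N.
  by move: src23; rewrite !inE !negb_or => /andP[].
apply: triple_le.
  apply: triple_then.
    by apply: (clearP (Q := fun st1 => frame [:: 5]%N [:: 2; 3]%N st st1 /\
         tree st1 2 (fun=> 0 : W))) => //.
  move=> st1 [fr1 tr1].
  (* Products are formed in place, so the invariant also records that the entries from [i] on still
     have their old values. *)
  pose I i st' := [/\ frame [:: 5; 6; 7; 8; 10]%N [:: 2; 3; dst]%N st st',
    tree st' 2 (cont P u i),
    forall j, (j < i)%N -> (ar st' dst j)%:R = d j * \sum_(0 <= x < j) (P x < P j)%N%:R * u x &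
    forall j, (i <= j < n)%N -> (ar st' dst j)%:R = d j].
  apply: (@triple_for _ _ w_gt0 I _ _ _ _ _ 0%N n (50 * (L + 3) + 60)).
  - by rewrite /= mod0n.
  - by [].
  - by nia.
  - split=> //.
    + apply: (@frame_trans _ _ _ st1); last exact: frame_set_reg.
      by apply: (frame_sub fr1); sub_seq.
    + case: tr1 => tI tL; split=> // x xN.
      by rewrite /cont big_geq // -(tL x).
    + move=> j jn; rewrite ar_set_reg (frame_ar fr1) ?adst //; last by lia.
      notin.
  - by move=> i st' [fr _ _ _] _; rewrite /= (frame_reg fr) // r0.
  - move=> i st2 /andP[_ iN] r10 [fr tr dn todo].
    have r1' : reg_of st2 1 = N by rewrite (frame_reg fr).
    have i_N : (i < N)%N by lia.
    apply: triple_le.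
      apply: (@triple_seq_assign _ _ _ _ _ (P i)).
        rewrite (eval_get_reg (i := i)) //; last by lia.
        by rewrite (frame_ar fr) ?aP //; notin.
      apply: triple_then.
        apply: (qryP (f := cont P u i) (key := P i) (Q := fun st3 =>
           frame [:: 5; 6]%N [::]%N (set_reg st2 8 (P i)) st3 /\
           (reg_of st3 6)%:R = \sum_(0 <= j < i) (P j < P i)%N%:R * u j)) => //.
          by apply: PN.
        by move=> st3 fr3 ->; rewrite sum_cont.
      move=> st3 [fr3 r6].
      have r1'' : reg_of st3 1 = N by rewrite (frame_reg fr3).
      have r10'' : reg_of st3 10 = i by rewrite (frame_reg fr3).
      have fr3' : frame [:: 5; 6; 8]%N [::]%N st2 st3.
        apply: (@frame_trans _ _ _ (set_reg st2 8 (P i))).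
          exact: frame_set_reg.
        by apply: (frame_sub fr3); sub_seq.
      have [v ev vE] : evalR s st3 (Bin OpMul (get dst (Reg 10)) (Reg 6))
          (d i * \sum_(0 <= j < i) (P j < P i)%N%:R * u j).
        apply: evalR_mul => //; last exact: evalR_reg.
        rewrite -(todo i); last by lia.
        apply: evalR_eval; rewrite (eval_get_reg (i := i)) //.
        by rewrite (frame_ar fr3).
      apply: (@triple_seq_store _ _ _ _ _ (dst * N + i)%N v) => //.
      - exact: eval_addr_reg.
      - by apply: leq_trans KNs; apply: ltn_ar.
      set st4 := set_mem _ _ _.
      have fr4 : frame [:: 5; 6; 8]%N [:: dst]%N st3 st4.
        apply: frame_set_mem; rewrite divnMDl //.
        by rewrite divn_small // addn0 inE.
      have fr24 : frame [:: 5; 6; 8]%N [:: dst]%N st2 st4.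
        by apply: frame_trans fr4; apply: (frame_sub fr3').
      have ar4 j : (j < N)%N -> ar st4 dst j = if j == i then v else ar st2 dst j.
        move=> jN; rewrite /st4 ar_set_mem // eqxx /=; case: eqP => // _.
        by rewrite (frame_ar fr3').
      have r1_4 : reg_of st4 1 = N by [].
      apply: (@triple_seq_assign _ _ _ _ _ (ar st2 src i)).
        rewrite (eval_get_reg (i := i)) //.
        by rewrite (frame_ar fr24) //; notin.
      apply: (updP (f := cont P u i) (key := P i) (v := u i)).
      + by lia.
      + by [].
      + by rewrite /= (frame_reg fr3).
      + by apply: PN.
      + by rewrite /= (frame_ar fr) ?asrc //; notin.
      + apply: (tree_frame fr24); notin.
      move=> st5 fr5 tr5.
      have fr25 : frame [:: 5; 6; 7; 8]%N [:: 2; 3; dst]%N st2 st5.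
        apply: (@frame_trans _ _ _ st4).
          by apply: (frame_sub fr24); sub_seq.
        apply: (@frame_trans _ _ _ (set_reg st4 7 (ar st2 src i))).
          exact: frame_set_reg.
        by apply: (frame_sub fr5); sub_seq.
      have ar5 j : (j < N)%N -> ar st5 dst j = if j == i then v else ar st2 dst j.
        move=> jN; rewrite (frame_ar fr5) ?ar_set_reg ?ar4 //.
        notin.
      split; first by rewrite (frame_reg fr25).
      split.
      + apply: (@frame_trans _ _ _ st5); last exact: frame_set_reg.
        by apply: (frame_trans fr); apply: (frame_sub fr25); sub_seq.
      + by apply: tree_ext tr5 => x _; rewrite cont_recr.
      + move=> j; rewrite ltnS leq_eqVlt ar_set_reg => /orP[/eqP->|ji].
          by rewrite ar5 // eqxx.
        rewrite ar5; last by lia.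
        by rewrite (_ : (j == i) = false) ?dn //; apply/eqP; lia.
      + move=> j ij; rewrite ar_set_reg ar5; last by lia.
        rewrite (_ : (j == i) = false) ?todo //; first by lia.
        by apply/eqP; lia.
    by rewrite /=; lia.
  - by move=> st' r10 [fr tr dn _]; apply: fin.
by rewrite /=; nia.
Qed.

(** * Sweeps, one for each strip *)

Section Sweep.
Variables (h : bool) (b : nat) (P : nat -> nat) (u1 u2 u3 : nat -> W).

(** [xq], [yq] and [zq] weight the decreasing chains that stop at [i] as vertex 1, 2 and 3
    respectively and whose vertex 1 lies in a value strip before [q]. If vertex 2 is absent, [yq]
    passes the weight of vertex 1 through. *)
Definition xq (q i : nat) : W := (P i %/ b < q)%N%:R * u1 i.

Definition yq (q i : nat) : W :=
  if h then u2 i * \sum_(0 <= j < i) (P i < P j)%N%:R * xq q j else xq q i.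

Definition zq (q i : nat) : W :=
  u3 i * \sum_(0 <= j < i) (P i < P j)%N%:R * yq q j.

Definition Tq (q t : nat) : W := \sum_(0 <= k < t) zq q k.

(* With [zz = 0] this is the sum over the l in the value strip q, and [zz = -1]
   removes the k that lie in an earlier position strip than l. *)
Definition strip_sum (zz : W) (n q : nat) : W :=
  \sum_(0 <= l < n) (P l %/ b == q)%N%:R * (Tq q l + zz * Tq q (b * (l %/ b))).

End Sweep.

Lemma sweep_midP st (h : bool) U2 key i v (x f : nat -> W) Q : (5 < K)%N -> (U2 < K)%N ->
  U2 \notin [:: 2; 3]%N -> reg_of st 1 = N -> reg_of st 10 = i -> (i < N)%N ->
  reg_of st 8 = key i -> (key i < N)%N -> (reg_of st 19)%:R = x i ->
  (h -> tree st 2 (cont key x i)) -> (h -> (ar st U2 i)%:R = v) ->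
  (forall st', frame [:: 5; 6; 7; 17]%N [:: 2; 3]%N st st' ->
    (h -> tree st' 2 (cont key x i.+1)) ->
    (reg_of st' 17)%:R =
      (if h then v * \sum_(0 <= j < i) (key j < key i)%N%:R * x j else x i) ->
    Q st') ->
  triple st (sweep_mid h U2) (50 * (L + 3) + 20) Q.
Proof.
move=> K5 UK U23 r1 r10 iN r8 kN r19 tr aU fin; rewrite /sweep_mid.
case: h tr aU fin => tr aU fin; last first.
  apply: triple_le.
    apply: triple_assignR; first exact: evalR_reg r19.
    by move=> y yE; apply: fin => //; apply: frame_set_reg.
  by rewrite /=; lia.
apply: triple_le.
  apply: triple_then.
    apply: (qryP (f := cont key x i) (key := key i) (Q := fun st1 =>
      frame [:: 5; 6]%N [::]%N st st1 /\
      (reg_of st1 6)%:R = \sum_(0 <= j < i) (key j < key i)%N%:R * x j)) => //.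
      by lia.
      exact: tr.
    by move=> st1 fr1 ->; rewrite sum_cont.
  move=> st1 [fr1 r6].
  apply: triple_seq_assignR.
    apply: evalR_mul => //; last exact: evalR_reg r6.
    apply: evalR_eval; apply: eval_get_reg (UK) iN; by rewrite (frame_reg fr1).
  move=> y yE.
  apply: (@triple_seq_assign _ _ _ _ _ (reg_of st 19)).
    by rewrite /= (frame_reg fr1).
  apply: (updP (f := cont key x i) (key := key i) (v := x i)) => //.
  - by lia.
  - by rewrite /= (frame_reg fr1).
  - by rewrite /= (frame_reg fr1).
  - by apply: (tree_frame fr1) => //; apply: tr.
  move=> st2 fr2 tr2; apply: fin.
  - apply: (@frame_trans _ _ _ st1); first by apply: (frame_sub fr1); sub_seq.
    apply: (@frame_trans _ _ _ (set_reg st1 17 y)); first exact: frame_set_reg.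
    apply: (@frame_trans _ _ _ (set_reg (set_reg st1 17 y) 7 (reg_of st 19))).
      exact: frame_set_reg.
    by apply: (frame_sub fr2); sub_seq.
  - by move=> _; apply: tree_ext tr2 => z _; rewrite cont_recr.
  - rewrite (frame_reg fr2) //= yE; congr (_ * _).
    by rewrite (frame_ar fr1) // aU.
by rewrite /=; lia.
Qed.

Lemma sweep_stepP st (h : bool) Pk U1 U2 U3 n b P q (u1 u2 u3 : nat -> W) zz i a0 Q :
  let key j := (N - 1 - P j)%N in
  let x := xq b P u1 q in let y := yq h b P u1 u2 q in
  let T := Tq h b P u1 u2 u3 q in
  (n <= N)%N -> (0 < b)%N -> (5 < K)%N ->
  (Pk < K)%N -> (U1 < K)%N -> (U2 < K)%N -> (U3 < K)%N ->
  Pk \notin [:: 2; 3; 4; 5]%N -> U1 \notin [:: 2; 3; 4; 5]%N ->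
  U2 \notin [:: 2; 3; 4; 5]%N -> U3 \notin [:: 2; 3; 4; 5]%N ->
  reg_of st 1 = N -> reg_of st 2 = b -> (reg_of st 9)%:R = zz ->
  reg_of st 11 = q -> reg_of st 10 = i -> (i < n)%N ->
  (forall j, (j < n)%N -> (P j < N)%N) ->
  ar st Pk i = P i -> (ar st U1 i)%:R = u1 i -> (h -> (ar st U2 i)%:R = u2 i) ->
  (ar st U3 i)%:R = u3 i ->
  (h -> tree st 2 (cont key x i)) -> tree st 4 (cont key y i) ->
  (reg_of st 13)%:R = T i -> (reg_of st 14)%:R = T (b * (i.-1 %/ b))%N ->
  (reg_of st 4)%:R = a0 ->
  (forall st', frame [:: 4; 5; 6; 7; 8; 13; 14; 15; 17; 18; 19]%N [:: 2; 3; 4; 5]%N st st' ->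
     (h -> tree st' 2 (cont key x i.+1)) -> tree st' 4 (cont key y i.+1) ->
     (reg_of st' 13)%:R = T i.+1 -> (reg_of st' 14)%:R = T (b * (i %/ b))%N ->
     (reg_of st' 4)%:R = a0 + (P i %/ b == q)%N%:R * (T i + zz * T (b * (i %/ b))%N) ->
     Q st') ->
  triple st (sweep_step h Pk U1 U2 U3) (100 * (L + 3) + 200) Q.
Proof.
move=> key x y T nN b0 K5 PK U1K U2K U3K nP nU1 nU2 nU3 r1 r2 r9 r11 r10 i_n PN.
move=> aP aU1 aU2 aU3 tr2 tr4 r13 r14 r4 fin; have Ng := N_gt0.
have iN : (i < N)%N by lia.
have PiN := PN i i_n.
have keyN : (key i < N)%N by rewrite /key; lia.
have keyE j : (j < i)%N -> (key j < key i)%N = (P i < P j)%N.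
  by move=> ji; have := PN j (ltn_trans ji i_n); rewrite /key; lia.
have keyS (f : nat -> W) : \sum_(0 <= j < i) (key j < key i)%N%:R * f j =
    \sum_(0 <= j < i) (P i < P j)%N%:R * f j.
  by apply: eq_big_nat => j ji; rewrite keyE.
apply: triple_le.
  apply: (@triple_seq_assign _ _ _ _ _ (P i)).
    by rewrite (eval_get_reg (i := i)) ?aP.
  apply: (@triple_seq_assign _ _ _ _ _ (key i)).
    by rewrite /= r1 modn_small //; nia.
  set st1 := set_reg _ 8 _.
  have fr1 : frame [:: 4; 5; 6; 7; 8; 13; 14; 15; 17; 18; 19]%N [:: 2; 3; 4; 5]%N st st1.
    by apply: (@frame_trans _ _ _ (set_reg st 15 (P i))); apply: frame_set_reg.
  apply: triple_seq_assignR.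
    apply: evalR_mul => //; apply: evalR_eval.
      apply: (@eval_lt _ _ w_gt0 _ _ _ (P i %/ b) q); last by rewrite /= r11.
      by apply: (@eval_div _ _ _ _ _ (P i) b); rewrite /= ?r2.
    exact: (@eval_get_reg st1 U1 10 i).
  move=> x0; rewrite [X in _ * X]aU1 -/(xq b P u1 q i) => x0E.
  set st2 := set_reg _ 19 _.
  have fr2 : frame [:: 4; 5; 6; 7; 8; 13; 14; 15; 17; 18; 19]%N [:: 2; 3; 4; 5]%N st st2.
    by apply: (frame_trans fr1); apply: frame_set_reg.
  apply: triple_then.
    apply: (@sweep_midP st2 h U2 key i (u2 i) x (fun=> 0) (fun st3 =>
      [/\ frame [:: 5; 6; 7; 17]%N [:: 2; 3]%N st2 st3,
          (h -> tree st3 2 (cont key x i.+1)) &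
          (reg_of st3 17)%:R = y i])) => //.
    - by move: nU2; rewrite !inE !negb_or => /and4P[-> ->].
    - move=> st3 fr3 t3 r17; split=> //; rewrite r17 /y /yq.
      by case: (h) => //; rewrite keyS.
  move=> st3 [fr3 tr3 r17].
  have fr3' : frame [:: 4; 5; 6; 7; 8; 13; 14; 15; 17; 18; 19]%N [:: 2; 3; 4; 5]%N st st3.
    by apply: (frame_trans fr2); apply: (frame_sub fr3); sub_seq.
  apply: triple_then.
    apply: (qryP (k := 4) (f := cont key y i) (key := key i) (Q := fun st4 =>
      frame [:: 5; 6]%N [::]%N st3 st4 /\
      (reg_of st4 6)%:R = \sum_(0 <= j < i) (P i < P j)%N%:R * y j)) => //.
    - by rewrite (frame_reg fr3').
    - by rewrite (frame_reg fr3).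
    - by apply: (tree_frame fr3) => //.
    - by move=> st4 fr4 ->; rewrite sum_cont keyS.
  move=> st4 [fr4 r6].
  have fr4' : frame [:: 4; 5; 6; 7; 8; 13; 14; 15; 17; 18; 19]%N [:: 2; 3; 4; 5]%N st st4.
    by apply: (frame_trans fr3'); apply: (frame_sub fr4); sub_seq.
  apply: (@triple_seq_assignR _ _ _ _ _ (zq h b P u1 u2 u3 q i)).
    apply: evalR_mul => //; last exact: evalR_reg r6.
    rewrite -aU3 -(frame_ar fr4') //.
    by apply: evalR_eval; apply: eval_get_reg => //; rewrite (frame_reg fr4').
  move=> z0 z0E.
  set st5 := set_reg _ 18 _.
  have fr5 : frame [:: 4; 5; 6; 7; 8; 13; 14; 15; 17; 18; 19]%N [:: 2; 3; 4; 5]%N st st5.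
    by apply: (frame_trans fr4'); apply: frame_set_reg.
  have r13' : (reg_of st4 13)%:R = T i.
    by rewrite (frame_reg fr4) // (frame_reg fr3).
  (* Register 14 still refers to the strip of [i.-1]. It is refreshed exactly when [b] divides [i],
     that is, when [i] opens a new strip. *)
  apply: triple_then.
    apply: (@triple_if _ _ _ _ _ _ (i %% b) _ _ (fun st6 =>
      frame [:: 14]%N [::]%N st5 st6 /\ (reg_of st6 14)%:R = T (b * (i %/ b))%N)).
    - by apply: (@eval_mod _ _ _ _ _ i b); rewrite /= (frame_reg fr4') ?r10 ?r2.
    - move=> im; apply: triple_skip; split=> //.
      rewrite /= (frame_reg fr4) // (frame_reg fr3) //= r14; congr (T (b * _)%N).
      case: (i) im => // i'; rewrite -lt0n => im /=.
      by rewrite divnS // /dvdn eqn0Ngt im.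
    - move=> im; apply: triple_assignR; first exact: evalR_reg r13'.
      move=> t tE; split; first exact: frame_set_reg.
      by rewrite /= tE; congr T; rewrite {1}(divn_eq i b) im addn0 mulnC.
  move=> st6 [fr6 r14'].
  have fr6' : frame [:: 4; 5; 6; 7; 8; 13; 14; 15; 17; 18; 19]%N [:: 2; 3; 4; 5]%N st st6.
    by apply: (frame_trans fr5); apply: (frame_sub fr6); sub_seq.
  have r15 : reg_of st6 15 = P i.
    by rewrite (frame_reg fr6) //= (frame_reg fr4) // (frame_reg fr3).
  have r4' : (reg_of st6 4)%:R = a0.
    by rewrite (frame_reg fr6) //= (frame_reg fr4) // (frame_reg fr3).
  have r13_6 : (reg_of st6 13)%:R = T i by rewrite (frame_reg fr6).
  apply: triple_then.
    apply: (@triple_if _ _ _ _ _ _ (P i %/ b == q)%N _ _ (fun st7 =>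
      frame [:: 4]%N [::]%N st6 st7 /\
      (reg_of st7 4)%:R = a0 + (P i %/ b == q)%N%:R * (T i + zz * T (b * (i %/ b))%N))).
    - apply: (@eval_eq _ _ w_gt0 _ _ _ (P i %/ b) q); last by rewrite /= (frame_reg fr6') ?r11.
      by apply: (@eval_div _ _ _ _ _ (P i) b); rewrite /= ?r15 // (frame_reg fr6') ?r2.
    - move=> c; have -> : (P i %/ b == q)%N = true by move: c; case: (_ == q).
      apply: triple_assignR.
        apply: evalR_add => //; first exact: evalR_reg r4'.
        apply: evalR_add => //; first exact: evalR_reg r13_6.
        apply: evalR_mul => //; last exact: evalR_reg r14'.
        by apply: evalR_reg; rewrite (frame_reg fr6').
      move=> t tE; split; first exact: frame_set_reg.
      by rewrite /= tE mul1r r9.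
    - move=> c; have -> : (P i %/ b == q)%N = false by move: c; case: (_ == q).
      by apply: triple_skip; rewrite mul0r addr0.
  move=> st7 [fr7 r4_7].
  have fr7' : frame [:: 4; 5; 6; 7; 8; 13; 14; 15; 17; 18; 19]%N [:: 2; 3; 4; 5]%N st st7.
    by apply: (frame_trans fr6'); apply: (frame_sub fr7); sub_seq.
  apply: (@triple_seq_assignR _ _ _ _ _ (T i.+1)).
    rewrite /T /Tq big_nat_recr //=; apply: evalR_add => //; apply: evalR_reg.
      by rewrite (frame_reg fr7).
    by rewrite (frame_reg fr7) // (frame_reg fr6).
  move=> t tE.
  have r17' : (reg_of st7 17)%:R = y i.
    by rewrite (frame_reg fr7) // (frame_reg fr6) //= (frame_reg fr4).
  apply: triple_seq_assign; first by rewrite /=; reflexivity.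
  set st8 := set_reg _ 7 _.
  have fr8 : frame [:: 4; 5; 6; 7; 8; 13; 14; 15; 17; 18; 19]%N [:: 2; 3; 4; 5]%N st st8.
    apply: (frame_trans fr7'); apply: (@frame_trans _ _ _ (set_reg st7 13 t));
    exact: frame_set_reg.
  have fr38 : frame [:: 4; 5; 6; 7; 13; 14; 18]%N [::]%N st3 st8.
    apply: (@frame_trans _ _ _ st4); first by apply: (frame_sub fr4); sub_seq.
    apply: (@frame_trans _ _ _ st5); first exact: frame_set_reg.
    apply: (@frame_trans _ _ _ st6); first by apply: (frame_sub fr6); sub_seq.
    apply: (@frame_trans _ _ _ st7); first by apply: (frame_sub fr7); sub_seq.
    by apply: (@frame_trans _ _ _ (set_reg st7 13 t)); apply: frame_set_reg.
  apply: (updP (k := 4) (f := cont key y i) (key := key i) (v := y i)) => //.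
  - by rewrite (frame_reg fr8).
  - by rewrite (frame_reg fr38) // (frame_reg fr3).
  - by apply: (tree_frame fr38) => //; apply: (tree_frame fr3).
  move=> st9 fr9 tr9; apply: fin.
  - by apply: (frame_trans fr8); apply: (frame_sub fr9); sub_seq.
  - by move=> hh; apply: (tree_frame fr9) => //; apply: (tree_frame fr38) => //; apply: tr3.
  - by apply: tree_ext tr9 => z _; rewrite cont_recr.
  - by rewrite (frame_reg fr9).
  - by rewrite (frame_reg fr9) //= (frame_reg fr7).
  - by rewrite (frame_reg fr9).
by rewrite /=; lia.
Qed.

Lemma tree_cont0 st k key (u : nat -> W) :
  tree st k (fun=> 0 : W) -> tree st k (cont key u 0).
Proof. by apply: tree_ext => x _; rewrite /cont big_geq. Qed.

Lemma sweepP st (h : bool) Pk U1 U2 U3 n b P q (u1 u2 u3 : nat -> W) zz a0 Q :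
  (n <= N)%N -> (0 < b)%N -> (5 < K)%N ->
  (Pk < K)%N -> (U1 < K)%N -> (U2 < K)%N -> (U3 < K)%N ->
  Pk \notin [:: 2; 3; 4; 5]%N -> U1 \notin [:: 2; 3; 4; 5]%N ->
  U2 \notin [:: 2; 3; 4; 5]%N -> U3 \notin [:: 2; 3; 4; 5]%N ->
  reg_of st 0 = n -> reg_of st 1 = N -> reg_of st 2 = b ->
  (reg_of st 9)%:R = zz -> reg_of st 11 = q ->
  (forall j, (j < n)%N -> (P j < N)%N) ->
  (forall j, (j < n)%N -> ar st Pk j = P j) ->
  (forall j, (j < n)%N -> (ar st U1 j)%:R = u1 j) ->
  (h -> forall j, (j < n)%N -> (ar st U2 j)%:R = u2 j) ->
  (forall j, (j < n)%N -> (ar st U3 j)%:R = u3 j) ->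
  (reg_of st 4)%:R = a0 ->
  (forall st', frame [:: 4; 5; 6; 7; 8; 10; 13; 14; 15; 17; 18; 19]%N
                     [:: 2; 3; 4; 5]%N st st' ->
     (reg_of st' 4)%:R = a0 + strip_sum h b P u1 u2 u3 zz n q -> Q st') ->
  triple st (sweep h Pk U1 U2 U3) (600 * N * (L + 3)) Q.
Proof.
move=> nN b0 K5 PK U1K U2K U3K nP nU1 nU2 nU3 r0 r1 r2 r9 r11 PN aP aU1 aU2 aU3 r4 fin.
have Ng := N_gt0.
apply: triple_le.
  apply: triple_then.
    apply: (clearP (k := 2) (Q := fun st1 => frame [:: 5]%N [:: 2; 3]%N st st1 /\
         tree st1 2 (fun=> 0 : W))) => //; lia.
  move=> st1 [fr1 tr1].
  apply: triple_then.
    apply: (clearP (k := 4) (Q := fun st2 => frame [:: 5]%N [:: 4; 5]%N st1 st2 /\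
         tree st2 4 (fun=> 0 : W))) => //.
    by rewrite (frame_reg fr1).
  move=> st2 [fr2 tr2].
  have fr2' : frame [:: 4; 5; 6; 7; 8; 10; 13; 14; 15; 17; 18; 19]%N
                    [:: 2; 3; 4; 5]%N st st2.
    apply: (@frame_trans _ _ _ st1); first by apply: (frame_sub fr1); sub_seq.
    by apply: (frame_sub fr2); sub_seq.
  apply: triple_seq_assign; first by apply: eval_const; nia.
  apply: triple_seq_assign; first by apply: eval_const; nia.
  set st3 := set_reg _ 14 _.
  have fr3 : frame [:: 4; 5; 6; 7; 8; 10; 13; 14; 15; 17; 18; 19]%N
                   [:: 2; 3; 4; 5]%N st st3.
    apply: (frame_trans fr2'); apply: (@frame_trans _ _ _ (set_reg st2 13 0));
    exact: frame_set_reg.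
  pose key j := (N - 1 - P j)%N.
  pose x := xq b P u1 q; pose y := yq h b P u1 u2 q.
  pose T := Tq h b P u1 u2 u3 q.
  pose I i st' := [/\ frame [:: 4; 5; 6; 7; 8; 10; 13; 14; 15; 17; 18; 19]%N
                       [:: 2; 3; 4; 5]%N st st',
     (h -> tree st' 2 (cont key x i)) /\ tree st' 4 (cont key y i),
     (reg_of st' 13)%:R = T i, (reg_of st' 14)%:R = T (b * (i.-1 %/ b))%N &
     (reg_of st' 4)%:R = a0 + strip_sum h b P u1 u2 u3 zz i q].
  apply: (@triple_for _ _ w_gt0 I _ _ _ _ _ 0%N n (100 * (L + 3) + 200)).
  - by rewrite /= mod0n.
  - by [].
  - by nia.
  - split.
    + by apply: (frame_trans fr3); apply: frame_set_reg.
    + split=> [hh|]; apply: tree_cont0.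
        by apply: (tree_frame fr2).
      exact: tr2.
    + by rewrite /T /Tq big_geq.
    (* At 0 the truncated predecessor is 0, and the empty total agrees with the initial value of
       register 14. *)
    + by rewrite /= div0n muln0 /T /Tq big_geq.
    + rewrite /= (frame_reg fr2) // (frame_reg fr1) // r4.
      by rewrite /strip_sum big_geq // addr0.
  - by move=> i st' [fr _ _ _ _] _; rewrite /= (frame_reg fr) // r0.
  - move=> i st4 /andP[_ i_n] r10 [fr [t2 t4] r13 r14 r4'].
    have iN : (i < N)%N by lia.
    apply: (@sweep_stepP st4 h Pk U1 U2 U3 n b P q u1 u2 u3 zz i
             (a0 + strip_sum h b P u1 u2 u3 zz i q)) => //;
      try by rewrite (frame_reg fr).
    + by rewrite (frame_ar fr) ?aP.
    + by rewrite (frame_ar fr) ?aU1.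
    + by move=> hh; rewrite (frame_ar fr) ?aU2.
    + by rewrite (frame_ar fr) ?aU3.
    move=> st5 fr5 t2' t4' r13' r14' r4''; split; first by rewrite (frame_reg fr5).
    split=> //.
    + apply: (@frame_trans _ _ _ st5); last exact: frame_set_reg.
      by apply: (frame_trans fr); apply: (frame_sub fr5); sub_seq.
    + by rewrite /= r4'' /strip_sum big_nat_recr //= addrA.
  - by move=> st4 _ [fr _ _ _ rE]; apply: fin.
rewrite /= subn0.
have : (n.+1 * (100 * (L + 3) + 208) <= (2 * N) * (170 * (L + 3)))%N.
  by apply: leq_mul; lia.
have : (N <= N * (L + 3))%N by rewrite leq_pmulr //; lia.
lia.
Qed.

Lemma stripsP st (h : bool) Pk U1 U2 U3 n b P (u1 u2 u3 : nat -> W) zz a0 Q :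
  (n <= N)%N -> (0 < b)%N -> (5 < K)%N ->
  (Pk < K)%N -> (U1 < K)%N -> (U2 < K)%N -> (U3 < K)%N ->
  Pk \notin [:: 2; 3; 4; 5]%N -> U1 \notin [:: 2; 3; 4; 5]%N ->
  U2 \notin [:: 2; 3; 4; 5]%N -> U3 \notin [:: 2; 3; 4; 5]%N ->
  reg_of st 0 = n -> reg_of st 1 = N -> reg_of st 2 = b ->
  (reg_of st 9)%:R = zz ->
  (forall j, (j < n)%N -> (P j < N)%N) ->
  (forall j, (j < n)%N -> ar st Pk j = P j) ->
  (forall j, (j < n)%N -> (ar st U1 j)%:R = u1 j) ->
  (h -> forall j, (j < n)%N -> (ar st U2 j)%:R = u2 j) ->
  (forall j, (j < n)%N -> (ar st U3 j)%:R = u3 j) ->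
  (reg_of st 4)%:R = a0 ->
  (forall st', frame [:: 4; 5; 6; 7; 8; 10; 11; 12; 13; 14; 15; 17; 18; 19]%N
                     [:: 2; 3; 4; 5]%N st st' ->
     (reg_of st' 4)%:R =
       a0 + \sum_(0 <= q < (n %/ b).+1) strip_sum h b P u1 u2 u3 zz n q -> Q st') ->
  triple st (strips h Pk U1 U2 U3) (700 * N * (L + 3) * (n %/ b + 2)) Q.
Proof.
move=> nN b0 K5 PK U1K U2K U3K nP nU1 nU2 nU3 r0 r1 r2 r9 PN aP aU1 aU2 aU3 r4 fin.
have Ng := N_gt0.
have nb : (n %/ b <= N)%N by apply: leq_trans (leq_div n b) nN.
apply: triple_le.
  apply: (@triple_seq_assign _ _ _ _ _ (n %/ b).+1).
    rewrite -[(n %/ b).+1]addn1; apply: eval_add; [|by apply: eval_const; nia|by nia].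
    by apply: eval_div; rewrite /= ?r0 ?r2.
  set st1 := set_reg _ 12 _.
  pose I i st' := frame [:: 4; 5; 6; 7; 8; 10; 11; 12; 13; 14; 15; 17; 18; 19]%N
       [:: 2; 3; 4; 5]%N st st' /\ reg_of st' 12 = (n %/ b).+1 /\
     (reg_of st' 4)%:R = a0 + \sum_(0 <= q < i) strip_sum h b P u1 u2 u3 zz n q.
  apply: (@triple_for _ _ w_gt0 I _ _ _ _ _ 0%N (n %/ b).+1 (600 * N * (L + 3))).
  - by rewrite /= mod0n.
  - by [].
  - by nia.
  - split; first by apply: (@frame_trans _ _ _ st1); apply: frame_set_reg.
    by split=> //=; rewrite big_geq // addr0.
  - by move=> i st' [_ [r12 _]] _; rewrite /= r12.
  - move=> q st2 /andP[_ qm] r11 [fr [r12 rE]].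
    apply: (@sweepP st2 h Pk U1 U2 U3 n b P q u1 u2 u3 zz
      (a0 + \sum_(0 <= q' < q) strip_sum h b P u1 u2 u3 zz n q')) => //;
      try by rewrite (frame_reg fr).
    + by move=> j jn; rewrite (frame_ar fr) ?aP //; lia.
    + by move=> j jn; rewrite (frame_ar fr) ?aU1 //; lia.
    + by move=> hh j jn; rewrite (frame_ar fr) ?aU2 //; lia.
    + by move=> j jn; rewrite (frame_ar fr) ?aU3 //; lia.
    move=> st3 fr3 r4'; split; first by rewrite (frame_reg fr3).
    split; last first.
      by rewrite /= (frame_reg fr3) //; split=> //; rewrite r4' big_nat_recr //= addrA.
    apply: (@frame_trans _ _ _ st3); last exact: frame_set_reg.
    by apply: (frame_trans fr); apply: (frame_sub fr3); sub_seq.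
  - by move=> st2 _ [fr [_ rE]]; apply: fin.
rewrite /= subn0.
have : (10 <= 10 * N * (L + 3))%N by nia.
move: (N * (L + 3))%N (mulnA) => X; nia.
Qed.

(** * Enumeration of the triples inside common strips *)

Section Pairs.
Variables (h tr : bool) (n b : nat) (P Q : nat -> nat) (u1 u3 f : nat -> W).

(** Without [tr] the sum runs from the value of vertex 3 up to that of vertex 1. With [tr] the two
    endpoints come in the opposite order, which supplies the minus sign for the points left of
    vertex 1. *)
Definition pairs_ker (al ka : nat) : W :=
  if h then \sum_(0 <= x < (if tr then Q ka else ka)) f x
            - \sum_(0 <= x < (if tr then al else P al)) f x
  else 1.

Definition pairs_term (al ka : nat) : W :=
  ((P al < ka) && (Q ka < al))%N%:R * (u1 (Q ka) * u3 al * pairs_ker al ka).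

Definition pairs_row_sum (al la : nat) : W :=
  \sum_(P la %/ b * b <= ka < P la) pairs_term al ka.

(** The minimum with [n] is needed for the last strip, which may be incomplete. *)
Definition pairs_sum (al : nat) : W :=
  \sum_(al.+1 <= la < minn n ((al %/ b).+1 * b)) pairs_row_sum al la.

Variables (Pk Qk U1 U3 : nat).
Hypotheses (nN : (n <= N)%N) (b0 : (0 < b)%N) (bw : (4 * b * N < 2 ^ w)%N)
  (K5 : (5 < K)%N).
Hypotheses (PkK : (Pk < K)%N) (QkK : (Qk < K)%N) (U1K : (U1 < K)%N) (U3K : (U3 < K)%N).
Hypotheses (Pn : forall j, (j < n)%N -> (P j < n)%N)
  (Qn : forall j, (j < n)%N -> (Q j < n)%N).

Definition pairs_ok st := [/\ reg_of st 0 = n, reg_of st 1 = N, reg_of st 2 = b,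
  (reg_of st 3)%:R = -1 :> W & tree st 2 f] /\
  [/\ forall j, (j < n)%N -> ar st Pk j = P j,
      forall j, (j < n)%N -> ar st Qk j = Q j,
      forall j, (j < n)%N -> (ar st U1 j)%:R = u1 j &
      forall j, (j < n)%N -> (ar st U3 j)%:R = u3 j].

Definition pairs_regs := [:: 4; 5; 6; 8; 21; 22; 23; 24; 25; 26; 27]%N.

Lemma pairs_ok_frame st st' : frame pairs_regs [::]%N st st' -> pairs_ok st -> pairs_ok st'.
Proof.
move=> fr [[r0 r1 r2 r3 tf] [aP aQ a1 a3]].
split; split; try by rewrite (frame_reg fr).
- exact: (tree_frame fr).
- by move=> j jn; rewrite (frame_ar fr) ?aP //; lia.
- by move=> j jn; rewrite (frame_ar fr) ?aQ //; lia.
- by move=> j jn; rewrite (frame_ar fr) ?a1 //; lia.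
- by move=> j jn; rewrite (frame_ar fr) ?a3 //; lia.
Qed.

Lemma half_addP st al ka a0 (R : state -> Prop) : pairs_ok st ->
  (al < n)%N -> (ka < n)%N ->
  reg_of st 20 = al -> reg_of st 21 = P al -> reg_of st 25 = ka ->
  reg_of st 26 = Q ka -> (reg_of st 4)%:R = a0 ->
  (forall st', frame [:: 4; 5; 6; 8; 27]%N [::]%N st st' ->
     (reg_of st' 4)%:R = a0 + u1 (Q ka) * u3 al * pairs_ker al ka -> R st') ->
  triple st (pairs_add h tr U1 U3) (60 * (L + 3) + 50) R.
Proof.
move=> [[r0 r1 r2 r3 tf] [aP aQ a1 a3]] al_n ka_n r20 r21 r25 r26 r4 fin.
have Ng := N_gt0; have Pan := Pn al_n; have Qkn := Qn ka_n.
have ev1 st1 : frame pairs_regs [::]%N st st1 -> reg_of st1 26 = Q ka ->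
    evalR s st1 (get U1 (Reg 26)) (u1 (Q ka)).
  move=> fr r; rewrite -a1 // -(frame_ar fr) //; last by lia.
  by apply: evalR_eval; apply: eval_get_reg => //; rewrite ?(frame_reg fr) //; lia.
have ev3 st1 : frame pairs_regs [::]%N st st1 ->
    evalR s st1 (get U3 (Reg 20)) (u3 al).
  move=> fr; rewrite -a3 // -(frame_ar fr) //; last by lia.
  by apply: evalR_eval; apply: eval_get_reg => //; rewrite ?(frame_reg fr) //; lia.
rewrite /pairs_add; move: fin; rewrite /pairs_ker; case: (h) => fin; last first.
  apply: triple_le.
    apply: triple_assignR.
      apply: evalR_add => //; first exact: evalR_reg r4.
      by apply: evalR_mul => //; [apply: ev1 | apply: ev3].
    by move=> x xE; apply: fin; [apply: frame_set_reg | rewrite /= xE mulr1].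
  by rewrite /=; lia.
pose e1 := if tr then Q ka else ka; pose e2 := if tr then al else P al.
have e1N : (e1 < N)%N by rewrite /e1; case: (tr); lia.
have e2N : (e2 < N)%N by rewrite /e2; case: (tr); lia.
apply: triple_le.
  apply: (@triple_seq_assign _ _ _ _ _ e1).
    by rewrite /= /e1; case: (tr); rewrite ?r26 ?r25.
  apply: triple_then.
    apply: (qryP (f := f) (key := e1) (Q := fun st1 =>
      frame [:: 5; 6]%N [::]%N (set_reg st 8 e1) st1 /\
      (reg_of st1 6)%:R = \sum_(0 <= x < e1) f x)) => //.
    by lia.
  move=> st1 [fr1 r6].
  apply: (triple_seq_assign (v := reg_of st1 6)) => //.
  set st2 := set_reg _ 27 _.
  have fr2 : frame [:: 4; 5; 6; 8; 27]%N [::]%N st st2.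
    apply: (@frame_trans _ _ _ (set_reg st 8 e1)); first exact: frame_set_reg.
    apply: (@frame_trans _ _ _ st1); last exact: frame_set_reg.
    by apply: (frame_sub fr1); sub_seq.
  apply: (@triple_seq_assign _ _ _ _ _ e2).
    by rewrite /e2; case: (tr); rewrite /= (frame_reg fr1) //= ?r20 ?r21.
  apply: triple_then.
    apply: (qryP (f := f) (key := e2) (Q := fun st3 =>
      frame [:: 5; 6]%N [::]%N (set_reg st2 8 e2) st3 /\
      (reg_of st3 6)%:R = \sum_(0 <= x < e2) f x)) => //.
    - by lia.
    - by rewrite /= (frame_reg fr1).
    - exact: (tree_frame fr1).
  move=> st3 [fr3 r6'].
  have fr3' : frame [:: 4; 5; 6; 8; 27]%N [::]%N st st3.
    apply: (frame_trans fr2); apply: (@frame_trans _ _ _ (set_reg st2 8 e2)).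
      exact: frame_set_reg.
    by apply: (frame_sub fr3); sub_seq.
  have fr3'' : frame pairs_regs [::]%N st st3 by apply: (frame_sub fr3'); sub_seq.
  apply: (@triple_assignR _ _ _ _ _
     (a0 + u1 (Q ka) * u3 al * (\sum_(0 <= x < e1) f x + -1 * \sum_(0 <= x < e2) f x))).
    apply: evalR_add => //.
      by apply: evalR_reg; rewrite (frame_reg fr3) //= (frame_reg fr1).
    apply: evalR_mul => //.
      apply: evalR_mul => //; last exact: ev3.
      by apply: ev1 => //; rewrite (frame_reg fr3').
    apply: evalR_add => //; first by apply: evalR_reg; rewrite (frame_reg fr3).
    apply: evalR_mul => //; last exact: evalR_reg.
    by apply: evalR_reg; rewrite (frame_reg fr3').
  move=> x xE; apply: fin.
    by apply: (frame_trans fr3'); apply: frame_set_reg.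
  by rewrite /= xE mulN1r.
by rewrite /=; lia.
Qed.

Lemma half_stepP st al ka a0 (R : state -> Prop) : pairs_ok st ->
  (al < n)%N -> (ka < n)%N ->
  reg_of st 20 = al -> reg_of st 21 = P al -> reg_of st 25 = ka ->
  (reg_of st 4)%:R = a0 ->
  (forall st', frame [:: 4; 5; 6; 8; 26; 27]%N [::]%N st st' ->
     (reg_of st' 4)%:R = a0 + pairs_term al ka -> R st') ->
  triple st (pairs_step h tr Qk U1 U3) (60 * (L + 3) + 80) R.
Proof.
move=> ok al_n ka_n r20 r21 r25 r4 fin.
have Ng := N_gt0; have Qkn := Qn ka_n.
have [[r0 r1 r2 r3 tf] [aP aQ a1 a3]] := ok.
have fr0 : frame [:: 4; 5; 6; 8; 26; 27]%N [::]%N st (set_reg st 26 (Q ka)).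
  exact: frame_set_reg.
apply: triple_le.
  apply: (@triple_seq_assign _ _ _ _ _ (Q ka)).
    by rewrite (eval_get_reg (i := ka)) ?aQ //; lia.
  apply: (@triple_if _ _ _ _ _ _ ((P al < ka) * (Q ka < al))%N).
  - apply: eval_mul; last by case: (P al < ka)%N; case: (Q ka < al)%N; nia.
      by apply: eval_lt; rewrite /= ?r21 ?r25.
    by apply: eval_lt; rewrite /= ?r20.
  - move=> c; have c1 : (P al < ka)%N && (Q ka < al)%N.
      by move: c; case: (P al < ka)%N => //; case: (Q ka < al)%N.
    apply: (@half_addP _ al ka a0) => //.
    move=> st' fr' r4'; apply: fin; last by rewrite r4' /pairs_term c1 mul1r.
    by apply: (frame_trans fr0); apply: (frame_sub fr'); sub_seq.
  - move=> c; have c1 : (P al < ka)%N && (Q ka < al)%N = false.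
      by move: c; case: (P al < ka)%N => //; case: (Q ka < al)%N.
    by apply: triple_skip; apply: fin => //; rewrite /pairs_term c1 mul0r addr0.
by rewrite /=; lia.
Qed.

Lemma half_rowP st al la a0 (R : state -> Prop) : pairs_ok st ->
  (al < n)%N -> (la < n)%N ->
  reg_of st 20 = al -> reg_of st 21 = P al -> reg_of st 23 = la ->
  (reg_of st 4)%:R = a0 ->
  (forall st', frame [:: 4; 5; 6; 8; 24; 25; 26; 27]%N [::]%N st st' ->
     (reg_of st' 4)%:R = a0 + pairs_row_sum al la -> R st') ->
  triple st (pairs_row h tr Pk Qk U1 U3) (100 * (L + 3) * (b + 1)) R.
Proof.
move=> ok al_n la_n r20 r21 r23 r4 fin.
have Ng := N_gt0; have Pln := Pn la_n.
have [[r0 r1 r2 r3 tf] [aP aQ a1 a3]] := ok.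
have db : (P la %/ b * b <= P la)%N by apply: leq_trunc_div.
have wN : (N < 2 ^ w)%N by nia.
apply: triple_le.
  apply: (@triple_seq_assign _ _ _ _ _ (P la)).
    by rewrite (eval_get_reg (i := la)) ?aP //; lia.
  set st1 := set_reg _ 24 _.
  pose I i st' := frame [:: 4; 5; 6; 8; 24; 25; 26; 27]%N [::]%N st st' /\
    (reg_of st' 24 = P la /\
     (reg_of st' 4)%:R = a0 + \sum_(P la %/ b * b <= ka < i) pairs_term al ka).
  apply: (@triple_for _ _ w_gt0 I _ _ _ _ _ (P la %/ b * b)%N (P la) (60 * (L + 3) + 80)).
  - apply: eval_mul; last by lia.
      by apply: eval_div; rewrite /= ?r2.
    by rewrite /= r2.
  - by [].
  - by lia.
  - split; first by apply: (@frame_trans _ _ _ st1); apply: frame_set_reg.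
    by split=> //=; rewrite big_geq // addr0.
  - by move=> i st' [_ [r24 _]] _; rewrite /= r24.
  - move=> ka st2 /andP[ka_l ka_u] r25 [fr [r24 rE]].
    have fr' : frame pairs_regs [::]%N st st2 by apply: (frame_sub fr); sub_seq.
    apply: (@half_stepP _ al ka (a0 + \sum_(P la %/ b * b <= ka' < ka) pairs_term al ka')) => //;
      try by rewrite (frame_reg fr).
      exact: pairs_ok_frame fr' ok.
      by lia.
    move=> st3 fr3 r4'; split; first by rewrite (frame_reg fr3).
    split.
      apply: (@frame_trans _ _ _ st3); last exact: frame_set_reg.
      by apply: (frame_trans fr); apply: (frame_sub fr3); sub_seq.
    split; first by rewrite /= (frame_reg fr3).
    by rewrite /= r4' big_nat_recr //= addrA.
  - by move=> st2 _ [fr [_ rE]]; apply: fin.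
(* A row visits only values of a single strip, hence fewer than [b] of them. *)
have : (P la - P la %/ b * b < b)%N by rewrite {1}(divn_eq (P la) b) addKn ltn_mod.
move: (P la - P la %/ b * b)%N => X Xb; rewrite /=.
have : (X.+1 * (60 * (L + 3) + 88) <= b * (60 * (L + 3) + 88))%N by rewrite leq_mul2r Xb orbT.
nia.
Qed.

Lemma pairsP st al a0 (R : state -> Prop) : pairs_ok st ->
  (al < n)%N -> reg_of st 20 = al -> (reg_of st 4)%:R = a0 ->
  (forall st', frame pairs_regs [::]%N st st' ->
     (reg_of st' 4)%:R = a0 + pairs_sum al -> R st') ->
  triple st (pairs h tr Pk Qk U1 U3) (200 * (L + 3) * (b + 1) * (b + 1)) R.
Proof.
move=> ok al_n r20 r4 fin.
have Ng := N_gt0; have Pan := Pn al_n.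
have [[r0 r1 r2 r3 tf] [aP aQ a1 a3]] := ok.
pose top := ((al %/ b).+1 * b)%N.
have al_top : (al < top)%N by rewrite /top {1}(divn_eq al b) mulSnr ltn_add2l ltn_mod.
have topb : (top - al <= b)%N.
  by rewrite /top mulSnr {2}(divn_eq al b); lia.
have topw : (top < 2 ^ w)%N.
  apply: leq_ltn_trans bw; rewrite /top; have := leq_div al b; nia.
have wN : (N < 2 ^ w)%N by nia.
apply: triple_le.
  apply: (@triple_seq_assign _ _ _ _ _ (P al)).
    by rewrite (eval_get_reg (i := al)) ?aP //; lia.
  apply: (@triple_seq_assign _ _ _ _ _ top).
    apply: eval_mul => //; last by rewrite /= r2.
    rewrite -[(al %/ b).+1]addn1; apply: eval_add.
    - by apply: eval_div; rewrite /= ?r20 ?r2.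
    - by apply: eval_const; lia.
    - by have := leq_div al b; lia.
  set st1 := set_reg _ 22 _.
  have fr1 : frame pairs_regs [::]%N st st1.
    by apply: (@frame_trans _ _ _ (set_reg st 21 (P al))); apply: frame_set_reg.
  apply: triple_then.
    apply: (@triple_if _ _ _ _ _ _ (n < top)%N _ _ (fun st2 =>
      frame [:: 22]%N [::]%N st1 st2 /\ reg_of st2 22 = minn n top)).
    - by apply: eval_lt; rewrite /= ?r0.
    - move=> c; apply: (triple_assign (v := n)); first by rewrite /= r0.
      split; first exact: frame_set_reg.
      by rewrite /=; move: c; case: ltnP => //; lia.
    - move=> c; apply: triple_skip; split=> //=.
      by move: c; case: ltnP => //; lia.
  move=> st2 [fr2 r22].
  have fr2' : frame pairs_regs [::]%N st st2.
    by apply: (frame_trans fr1); apply: (frame_sub fr2); sub_seq.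
  pose I i st' := [/\ frame pairs_regs [::]%N st st', reg_of st' 22 = minn n top,
     reg_of st' 21 = P al &
     (reg_of st' 4)%:R = a0 + \sum_(al.+1 <= la < i) pairs_row_sum al la].
  apply: (@triple_for _ _ w_gt0 I _ _ _ _ _ al.+1 (minn n top) (100 * (L + 3) * (b + 1))).
  - rewrite -[al.+1]addn1; apply: eval_add; last by lia.
      by rewrite /= (frame_reg fr2') // r20.
    by apply: eval_const; lia.
  - by rewrite leq_min al_n.
  - by apply: leq_ltn_trans wN; apply: leq_trans (geq_minl _ _) nN.
  - split=> //=.
    + by apply: (frame_trans fr2'); apply: frame_set_reg.
    + by rewrite (frame_reg fr2).
    + by rewrite (frame_reg fr2) //= big_geq // addr0.
  - by move=> i st' [_ r _ _] _; rewrite /= r.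
  - move=> la st3; rewrite leq_min => /andP[la_l /andP[la_n _]] r23 [fr r22' r21 rE].
    apply: (@half_rowP _ al la (a0 + \sum_(al.+1 <= la' < la) pairs_row_sum al la')) => //;
      try by rewrite (frame_reg fr).
      exact: pairs_ok_frame fr ok.
    move=> st4 fr4 r4'; split; first by rewrite (frame_reg fr4).
    split; try by rewrite /= (frame_reg fr4).
      apply: (@frame_trans _ _ _ st4); last exact: frame_set_reg.
      by apply: (frame_trans fr); apply: (frame_sub fr4); sub_seq.
    by rewrite /= r4' big_nat_recr //= addrA.
  - by move=> st3 _ [fr _ _ rE]; apply: fin.
have : (minn n top - al.+1 < b)%N by lia.
move: (minn n top - al.+1)%N => X Xb; rewrite /=.
have -> : (200 * (L + 3) * (b + 1) * (b + 1) =
  2 * (b * (100 * (L + 3) * (b + 1))) + 2 * (100 * (L + 3) * (b + 1)))%N by ring.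
have : (300 <= 100 * (L + 3) * (b + 1))%N by nia.
move: (100 * (L + 3) * (b + 1))%N => Z Zg.
have : (X.+1 * (1 + Z + 7) <= b * (Z + 8))%N by rewrite leq_mul //; lia.
have : (b * 300 <= b * Z)%N by rewrite leq_mul2l Zg orbT.
rewrite mulnDr; lia.
Qed.

End Pairs.

Section Corner.
Variables (h : bool) (n b : nat) (P Q : nat -> nat) (u1 u2 u3 u1' u3' : nat -> W).
Variables (U1 U2 U3 : nat).
Hypotheses (nN : (n <= N)%N) (b0 : (0 < b)%N) (bw : (4 * b * N < 2 ^ w)%N) (K8 : (8 < K)%N).
Hypotheses (U1K : (U1 < K)%N) (U2K : (U2 < K)%N) (U3K : (U3 < K)%N).
Hypotheses (nU1 : U1 \notin [:: 2; 3]%N) (nU2 : U2 \notin [:: 2; 3]%N)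
  (nU3 : U3 \notin [:: 2; 3]%N).
Hypotheses (Pn : forall j, (j < n)%N -> (P j < n)%N)
  (Qn : forall j, (j < n)%N -> (Q j < n)%N).

Definition corner_term (a : nat) : W :=
  pairs_sum h false n b P Q u1 u3 (cont P u2 a) a +
  h%:R * pairs_sum true true n b Q P u1' u3' (cont P u2 a) (P a).

Definition corner_regs := [:: 4; 5; 6; 7; 8; 20; 21; 22; 23; 24; 25; 26; 27; 30]%N.

Lemma cornerP st a0 (R : state -> Prop) :
  reg_of st 0 = n -> reg_of st 1 = N -> reg_of st 2 = b -> (reg_of st 3)%:R = -1 :> W ->
  (forall j, (j < n)%N -> ar st 0 j = P j) ->
  (forall j, (j < n)%N -> ar st 1 j = Q j) ->
  (forall j, (j < n)%N -> (ar st U1 j)%:R = u1 j) ->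
  (forall j, (j < n)%N -> (ar st U2 j)%:R = u2 j) ->
  (forall j, (j < n)%N -> (ar st U3 j)%:R = u3 j) ->
  (forall j, (j < n)%N -> (ar st 6 j)%:R = u1' j) ->
  (forall j, (j < n)%N -> (ar st 8 j)%:R = u3' j) ->
  (reg_of st 4)%:R = a0 ->
  (forall st', frame corner_regs [:: 2; 3]%N st st' ->
     (reg_of st' 4)%:R = a0 + \sum_(0 <= a < n) corner_term a -> R st') ->
  triple st (corner h U1 U2 U3) (1000 * N * (L + 3) * (b + 1) * (b + 1)) R.
Proof.
move=> r0 r1 r2 r3 aP aQ a1 a2 a3 a1' a3' r4 fin.
have Ng := N_gt0; have wN : (N < 2 ^ w)%N by nia.
apply: triple_le.
  apply: triple_then.
    apply: (clearP (k := 2) (Q := fun st1 => frame [:: 5]%N [:: 2; 3]%N st st1 /\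
         tree st1 2 (fun=> 0 : W))) => //; lia.
  move=> st1 [fr1 tr1].
  have fr1' : frame corner_regs [:: 2; 3]%N st st1 by apply: (frame_sub fr1); sub_seq.
  pose I i st' := [/\ frame corner_regs [:: 2; 3]%N st st', tree st' 2 (cont P u2 i) &
     (reg_of st' 4)%:R = a0 + \sum_(0 <= a < i) corner_term a].
  apply: (@triple_for _ _ w_gt0 I _ _ _ _ _ 0%N n
     (200 * (L + 3) * (b + 1) * (b + 1) + 200 * (L + 3) * (b + 1) * (b + 1)
        + 20 * (L + 3) + 40)).
  - by rewrite /= mod0n.
  - by [].
  - by lia.
  - split.
    + by apply: (frame_trans fr1'); apply: frame_set_reg.
    + exact: tree_cont0.
    + by rewrite /= (frame_reg fr1) // r4 big_geq // addr0.
  - by move=> i st' [fr _ _] _; rewrite /= (frame_reg fr) // r0.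
  - move=> a st2 /andP[_ a_n] r30 [fr2 tr2 r4'].
    have aN : (a < N)%N by lia.
    have Pan := Pn a_n.
    pose t1 := pairs_sum h false n b P Q u1 u3 (cont P u2 a) a.
    pose t2 := h%:R * pairs_sum true true n b Q P u1' u3' (cont P u2 a) (P a).
    have arE st3 k j : frame corner_regs [:: 2; 3]%N st st3 -> (j < n)%N ->
        k \notin [:: 2; 3]%N -> ar st3 k j = ar st k j.
      by move=> fr jn kn; rewrite (frame_ar fr) //; lia.
    have ok1 st3 : frame corner_regs [:: 2; 3]%N st st3 ->
        tree st3 2 (cont P u2 a) ->
        pairs_ok n b P Q u1 u3 (cont P u2 a) 0 1 U1 U3 st3.
      move=> fr tr; split; split=> //; try by rewrite (frame_reg fr).
      + by move=> j jn; rewrite arE ?aP.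
      + by move=> j jn; rewrite arE ?aQ.
      + by move=> j jn; rewrite arE ?a1.
      + by move=> j jn; rewrite arE ?a3.
    have ok2 st3 : frame corner_regs [:: 2; 3]%N st st3 ->
        tree st3 2 (cont P u2 a) ->
        pairs_ok n b Q P u1' u3' (cont P u2 a) 1 0 6 8 st3.
      move=> fr tr; split; split=> //; try by rewrite (frame_reg fr).
      + by move=> j jn; rewrite arE ?aQ.
      + by move=> j jn; rewrite arE ?aP.
      + by move=> j jn; rewrite arE ?a1'.
      + by move=> j jn; rewrite arE ?a3'.
    apply: triple_le.
      apply: (@triple_seq_assign _ _ _ _ _ a); first by rewrite /= r30.
      set st3 := set_reg _ 20 _.
      have fr3 : frame corner_regs [:: 2; 3]%N st st3.
        by apply: (frame_trans fr2); apply: frame_set_reg.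
      apply: triple_then.
        apply: (@pairsP h false n b P Q u1 u3 (cont P u2 a) 0 1 U1 U3 _ _ _ _ _ _ _ _ _ _
          st3 a (a0 + \sum_(0 <= a' < a) corner_term a') (fun st4 =>
            frame pairs_regs [::]%N st3 st4 /\
            (reg_of st4 4)%:R = a0 + \sum_(0 <= a' < a) corner_term a' + t1)) => //; try lia.
        exact: ok1.
      move=> st4 [fr4 r4_4].
      have fr4' : frame corner_regs [:: 2; 3]%N st st4.
        by apply: (frame_trans fr3); apply: (frame_sub fr4); sub_seq.
      have r30_4 : reg_of st4 30 = a by rewrite (frame_reg fr4).
      have tr4 : tree st4 2 (cont P u2 a) by apply: (tree_frame fr4).
      apply: triple_then.
        apply: (@triple_le _ _ _ _ (200 * (L + 3) * (b + 1) * (b + 1) + 20) _ (fun st5 =>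
            frame (20 :: pairs_regs)%N [::]%N st4 st5 /\
            (reg_of st5 4)%:R = a0 + \sum_(0 <= a' < a) corner_term a' + t1 + t2)).
          rewrite /t2; case: (h); last first.
            apply: triple_le; first by apply: triple_skip; rewrite mul0r addr0.
            by lia.
          apply: triple_le.
            apply: (@triple_seq_assign _ _ _ _ _ (P a)).
              rewrite (eval_get_reg _ r30_4) ?arE ?aP //; last by lia.
              by rewrite (frame_reg fr4').
            set st5 := set_reg _ 20 _.
            apply: (@pairsP true true n b Q P u1' u3' (cont P u2 a) 1 0 6 8 _ _ _ _ _ _ _ _ _ _
              st5 (P a) (a0 + \sum_(0 <= a' < a) corner_term a' + t1)) => //; try lia.
              apply: ok2 => //; by apply: (frame_trans fr4'); apply: frame_set_reg.
            move=> st6 fr6 r6; split; last by rewrite r6 mul1r.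
            apply: (@frame_trans _ _ _ st5); first exact: frame_set_reg.
            by apply: (frame_sub fr6); sub_seq.
          by rewrite /=; lia.
        exact: leqnn.
      move=> st5 [fr5 r4_5].
      have fr5' : frame corner_regs [:: 2; 3]%N st st5.
        by apply: (frame_trans fr4'); apply: (frame_sub fr5); sub_seq.
      have r30_5 : reg_of st5 30 = a.
        by rewrite (frame_reg fr5) // (frame_reg fr4).
      apply: (@triple_seq_assign _ _ _ _ _ (P a)).
        rewrite (eval_get_reg _ r30_5) ?arE ?aP //; last by lia.
        by rewrite (frame_reg fr5').
      apply: (@triple_seq_assign _ _ _ _ _ (ar st U2 a)).
        rewrite (eval_get_reg (i := a)) //; last by rewrite /= (frame_reg fr5').
        by rewrite ar_set_reg arE.
      apply: (updP (k := 2) (f := cont P u2 a) (key := P a) (v := u2 a)) => //=.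
      + by lia.
      + by rewrite (frame_reg fr5').
      + by lia.
      + by rewrite a2.
      + by apply: (tree_frame fr5).
      move=> st6 fr6 tr6.
      split; first by rewrite (frame_reg fr6).
      split.
      + apply: (@frame_trans _ _ _ st6); last exact: frame_set_reg.
        apply: (frame_trans fr5').
        apply: (@frame_trans _ _ _ (set_reg st5 8 (P a))); first exact: frame_set_reg.
        apply: (@frame_trans _ _ _ (set_reg (set_reg st5 8 (P a)) 7 (ar st U2 a))).
          exact: frame_set_reg.
        by apply: (frame_sub fr6); sub_seq.
      + by apply: tree_ext tr6 => x _; rewrite cont_recr.
      + by rewrite /= (frame_reg fr6) //= r4_5 big_nat_recr //= -!addrA.
    by rewrite /=; lia.
  - by move=> st2 _ [fr _ rE]; apply: fin.
rewrite /= subn0.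
(* [Y] bounds one call of [pairs]. Each position needs at most two calls, and [Y %/ 5] absorbs the
   tree update and the loop overhead. *)
set Y := (200 * (L + 3) * (b + 1) * (b + 1))%N.
have Y1 : (200 * (L + 3) <= Y)%N.
  by rewrite /Y -mulnA leq_pmulr //; nia.
have -> : (1000 * N * (L + 3) * (b + 1) * (b + 1) = N * (5 * Y))%N by rewrite /Y; ring.
have : (n.+1 * (1 + (Y + Y + 20 * (L + 3) + 40) + 7) <= (2 * N) * (2 * Y + (Y %/ 5)))%N.
  apply: leq_mul; lia.
have : (60 * N + 2 <= N * (Y %/ 2))%N by nia.
have : (N * (Y %/ 2 + 2 * (2 * Y + Y %/ 5)) <= N * (5 * Y))%N by rewrite leq_mul2l; lia.
rewrite mulnDr; lia.
Qed.

End Corner.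

(** * Initialization: scattering and the constants N, b and -1 *)

Lemma scatterP st dst e n P (g : nat -> nat) (R : state -> Prop) :
  (n <= N)%N -> (dst < K)%N -> (0 < dst)%N -> (cost e <= 10)%N ->
  reg_of st 0 = n -> reg_of st 1 = N ->
  (forall j, (j < n)%N -> ar st 0 j = P j) ->
  (forall j, (j < n)%N -> (P j < N)%N) ->
  (forall i j, (i < n)%N -> (j < n)%N -> P i = P j -> i = j) ->
  (forall st' i, frame [:: 10]%N [:: dst]%N st st' -> reg_of st' 10 = i -> (i < n)%N ->
     eval st' e = Some (g i)) ->
  (forall st', frame [:: 10]%N [:: dst]%N st st' ->
     (forall j, (j < n)%N -> ar st' dst (P j) = g j) -> R st') ->
  triple st (scatter dst e) (100 * N) R.
Proof.
move=> nN dK d0 ce r0 r1 aP PN Pinj ev fin.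
have K0 : (0 < K)%N by lia.
have Ng := N_gt0; have wN : (N < 2 ^ w)%N by nia.
apply: triple_le.
  pose I i st' := frame [:: 10]%N [:: dst]%N st st' /\
     forall j, (j < i)%N -> ar st' dst (P j) = g j.
  apply: (@triple_for _ _ w_gt0 I _ _ _ _ _ 0%N n 30).
  - by rewrite /= mod0n.
  - by [].
  - by lia.
  - by split=> //; apply: frame_set_reg.
  - by move=> i st' [fr _] _; rewrite /= (frame_reg fr) // r0.
  - move=> i st1 /andP[_ i_n] r10 [fr1 done1].
    have iN : (i < N)%N by lia.
    have PiN := PN i i_n.
    have lt : (dst * N + P i < K * N)%N by apply: ltn_ar.
    apply: triple_le.
      apply: (@triple_store _ _ _ _ _ (dst * N + P i)%N (g i)).
      - apply: eval_addr => //; first by rewrite (frame_reg fr1).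
        rewrite (eval_get_reg _ r10) //; last by rewrite (frame_reg fr1).
        by rewrite (frame_ar fr1) ?aP // inE eq_sym -lt0n.
      - exact: ev fr1 r10 i_n.
      - exact: leq_trans lt KNs.
      split=> //; split.
        apply: (frame_trans fr1); apply: (@frame_trans _ _ _ (set_mem st1 (dst * N + P i) (g i))).
          by apply: frame_set_mem; rewrite divnMDl // divn_small // addn0 inE.
        exact: frame_set_reg.
      move=> j; rewrite ltnS => ji; rewrite ar_set_reg ar_set_mem ?eqxx //=; last first.
        by apply: PN; lia.
      (* Injectivity of [P] is what prevents the new store from overwriting an earlier one. *)
      case: eqP => [/Pinj E|nE]; first by rewrite E //; lia.
      by apply: done1; rewrite ltn_neqAle ji andbT; apply/eqP => jE; rewrite jE in nE.
    by rewrite /=; lia.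
  - by move=> st1 _ [fr1 d1]; apply: fin.
by rewrite /=; lia.
Qed.

Lemma size_loopP st n (R : state -> Prop) : L = (trunc_log 2 n).+1 ->
  reg_of st 0 = n ->
  (forall st', frame [:: 1]%N [::]%N st st' -> reg_of st' 1 = N -> R st') ->
  triple st size_loop (20 * (L + 3)) R.
Proof.
move=> LE r0 fin; have Ng := N_gt0; have wN : (16 * N < 2 ^ w)%N by nia.
have nN : (n < N)%N by rewrite NE LE trunc_log_ltn.
apply: triple_le.
  apply: (@triple_seq_assign _ _ _ _ _ 2); first by apply: eval_const; lia.
  pose I k st' := [/\ frame [:: 1]%N [::]%N st st', (k < L)%N & reg_of st' 1 = (2 ^ (L - k))%N].
  apply: (@triple_while _ _ I _ _ _ 6 L.-1).
    split=> //=; [exact: frame_set_reg| |]; rewrite LE //= subSn ?leqnn //.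
    by rewrite subnn.
  move=> k st1 [fr kL r1].
  exists (2 ^ (L - k) < n + 1)%N.
    apply: eval_lt => //; first by rewrite /= r1.
    apply: eval_add; first by rewrite /= (frame_reg fr) // r0.
      by apply: eval_const; lia.
    by lia.
  split=> [c|c].
    (* With a smaller exponent the register would be at most [2 ^ trunc_log 2 n], hence at most [n]
       for positive [n], and the test would have succeeded. For n = 0 the exponent [L] is 1 and
       leaves no room. *)
    have k0 : k = 0%N.
      apply/eqP; rewrite -leqn0 leqNgt; apply/negP => k0.
      have : (2 ^ (L - k) <= 2 ^ (trunc_log 2 n))%N by rewrite leq_exp2l // LE; lia.
      case: (posnP n) => [n0|n0]; last by have := trunc_logP (ltnSn 1) n0; move: c; case: ltnP; lia.
      by move: kL; rewrite LE n0 trunc_log0; lia.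
    by apply: fin => //; rewrite r1 k0 subn0 NE.
  have k0 : (0 < k)%N.
    by case: (k) c => //; rewrite subn0 -NE; case: ltnP => //; lia.
  exists k.-1; first by rewrite prednK.
  apply: (@triple_le _ _ _ _ 4) => //.
  have E : (2 * 2 ^ (L - k) = 2 ^ (L - k.-1))%N by rewrite -expnS; congr expn; lia.
  apply: (triple_assign (v := (2 * 2 ^ (L - k))%N)).
    apply: eval_mul; [by apply: eval_const; lia|by rewrite /= r1|].
    rewrite E; apply: leq_ltn_trans (_ : N < 2 ^ w)%N; last by lia.
    by rewrite NE leq_exp2l // leq_subr.
  split; last by rewrite /= E.
    by apply: (frame_trans fr); apply: frame_set_reg.
  by lia.
by rewrite /=; lia.
Qed.

Lemma root_loopP st n (R : state -> Prop) :
  (2 * croot n ^ 3 + 2 < 2 ^ w)%N -> reg_of st 0 = n ->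
  (forall st', frame [:: 2]%N [::]%N st st' -> reg_of st' 2 = croot n -> R st') ->
  triple st root_loop (20 * (croot n + 2)) R.
Proof.
move=> bw r0 fin; have b0 := croot_gt0 n.
have bb : (croot n <= croot n ^ 3)%N by rewrite -{1}(expn1 (croot n)) leq_pexp2l.
have Ng := N_gt0; have wN : (16 * N < 2 ^ w)%N by nia.
apply: triple_le.
  apply: (@triple_seq_assign _ _ _ _ _ 1); first by apply: eval_const; lia.
  pose I k st' := [/\ frame [:: 2]%N [::]%N st st', (k < croot n)%N &
    reg_of st' 2 = (croot n - k)%N].
  apply: (@triple_while _ _ I _ _ _ 6 (croot n).-1).
    by split=> //=; [exact: frame_set_reg| |]; lia.
  move=> k st1 [fr kb r2].
  have le3 : ((croot n - k) ^ 3 <= croot n ^ 3)%N by rewrite leq_exp2r // leq_subr.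
  have le2 : ((croot n - k) ^ 2 <= (croot n - k) ^ 3)%N by rewrite leq_pexp2l //; lia.
  exists ((croot n - k) ^ 3 < n)%N.
    apply: eval_lt => //; last by rewrite /= (frame_reg fr) // r0.
    rewrite expnSr; apply: eval_mul; [|by rewrite /= r2|by rewrite -expnSr; lia].
    by rewrite -mulnn; apply: eval_mul; [by rewrite /= r2|by rewrite /= r2|rewrite mulnn; lia].
  split=> [c|c].
    have k0 : k = 0%N.
      apply/eqP; rewrite -leqn0 leqNgt; apply/negP => k0.
      have := @croot_lt n (croot n - k); move: c; case: ltnP => // _ _.
      by case: leqP => //; lia.
    by apply: fin => //; rewrite r2 k0 subn0.
  have k0 : (0 < k)%N.
    case: (k) c => //; rewrite subn0; have := croot_ge n; case: ltnP => //; lia.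
  exists k.-1; first by rewrite prednK.
  apply: (@triple_le _ _ _ _ 4) => //.
  apply: (triple_assign (v := (croot n - k + 1)%N)).
    by apply: eval_add; [by rewrite /= r2|by apply: eval_const; lia|lia].
  split; [|lia|by rewrite /=; lia].
  by apply: (frame_trans fr); apply: frame_set_reg.
by rewrite /=; lia.
Qed.

Lemma minus_one_loopP st (R : state -> Prop) :
  (forall st', frame [:: 3]%N [::]%N st st' -> (reg_of st' 3)%:R = -1 :> W -> R st') ->
  triple st minus_one_loop (20 * (w + 2)) R.
Proof.
move=> fin; have Ng := N_gt0; have wN : (16 * N < 2 ^ w)%N by nia.
have w1 : (1 < 2 ^ w)%N by lia.
apply: triple_le.
  apply: (@triple_seq_assign _ _ _ _ _ 1); first by apply: eval_const; lia.
  pose I k st' := [/\ frame [:: 3]%N [::]%N st st', (k < w)%N &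
    reg_of st' 3 = (2 ^ (w - k) - 1)%N].
  apply: (@triple_while _ _ I _ _ _ 7 w.-1).
    split=> //=; [exact: frame_set_reg| lia |].
    by have -> : (w - w.-1 = 1)%N by lia.
  move=> k st1 [fr kw r3].
  have g0 : (0 < 2 ^ (w - k))%N by rewrite expn_gt0.
  case: k kw r3 g0 => [|k] kw r3 g0.
    exists 0%N; last first.
      split=> // _; apply: fin => //; rewrite r3 subn0 natrB ?expn_gt0 //.
      by rewrite -[X in X - _](Zp_nat_mod w1) modnn sub0r.
    (* The word [2 ^ w - 1] is fixed by x -> 2x + 1 modulo [2 ^ w], so the strict test fails exactly
       here. *)
    rewrite /= r3 subn0 [(2 %% _)%N]modn_small; last by lia.
    have -> : (2 * (2 ^ w - 1) = (2 ^ w - 2) + 2 ^ w)%N by lia.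
    rewrite modnDr [((2 ^ w - 2) %% _)%N]modn_small ?[(1 %% _)%N]modn_small; try by lia.
    have -> : (2 ^ w - 2 + 1 = 2 ^ w - 1)%N by lia.
    by rewrite [((2 ^ w - 1) %% _)%N]modn_small; [rewrite ltnn mod0n | lia].
  have E : (2 * (2 ^ (w - k.+1) - 1) + 1 = 2 ^ (w - k) - 1)%N.
    have -> : (w - k = (w - k.+1).+1)%N by lia.
    by rewrite expnS; lia.
  have le : (2 ^ (w - k) <= 2 ^ w)%N by rewrite leq_exp2l // leq_subr.
  have ev : eval st1 (Bin OpAdd (Bin OpMul (Const 2) (Reg 3)) (Const 1)) =
     Some (2 * (2 ^ (w - k.+1) - 1) + 1)%N.
    apply: eval_add; [|by apply: eval_const; lia|by lia].
    by apply: eval_mul; [by apply: eval_const; lia|by rewrite /= r3|lia].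
  exists 1%N; last first.
    split=> // _; exists k => //.
    apply: (@triple_le _ _ _ _ 6) => //.
    apply: (triple_assign ev); split; [|lia|by rewrite /= E].
    by apply: (frame_trans fr); apply: frame_set_reg.
  rewrite (@eval_lt _ _ w_gt0 _ _ _ (2 ^ (w - k.+1) - 1) _ _ ev) /= ?r3 //.
  by congr Some; case: ltnP => //; lia.
by rewrite /=; lia.
Qed.

(** * Weights of the hanging trees *)

Section Weights.
Variables (n : nat) (P : nat -> nat).

(** The effect of [dominate] on the table of weights, for an edge from the child [e.1] to its parent
    [e.2]. *)
Definition wstep (Wt : nat -> nat -> W) (e : nat * nat) (k i : nat) : W :=
  if k == e.2 then Wt k i * \sum_(0 <= j < i) (P j < P i)%N%:R * Wt e.1 j
  else Wt k i.

Definition weights (edges : seq (nat * nat)) : nat -> nat -> W :=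
  foldl wstep (fun _ _ => 1) edges.

Definition edges_ok (edges : seq (nat * nat)) :=
  all (fun e => [&& e.1 != e.2, 8 < e.1 < K & 8 < e.2 < K]%N) edges.

Hypotheses (nN : (n <= N)%N) (K9 : (8 < K)%N).
Hypothesis Pn : forall j, (j < n)%N -> (P j < n)%N.

Lemma dominate_seqP st edges Wt (R : state -> Prop) : edges_ok edges ->
  reg_of st 0 = n -> reg_of st 1 = N ->
  (forall j, (j < n)%N -> ar st 0 j = P j) ->
  (forall k j, (8 < k < K)%N -> (j < n)%N -> (ar st k j)%:R = Wt k j) ->
  (forall st', frame [:: 5; 6; 7; 8; 10]%N (iota 2 (K - 2)) st st' ->
     (forall k j, (8 < k < K)%N -> (j < n)%N ->
        (ar st' k j)%:R = foldl wstep Wt edges k j) -> R st') ->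
  triple st (seq_cmd (fun e => dominate e.1 e.2) edges)
    (size edges * (200 * N * (L + 3)) + 1) R.
Proof.
elim: edges st Wt => [|[k1 k2] edges IH] st Wt /=.
  by move=> _ r0 r1 aP aW fin; rewrite mul0n; apply: triple_skip; apply: fin.
move=> /andP[/and3P[/= k12 /andP[k1l k1u] /andP[k2l k2u]] ok] r0 r1 aP aW fin.
apply: triple_le.
  apply: triple_then.
    apply: (@dominateP st k1 k2 n P (Wt k1) (Wt k2) (fun st1 =>
      frame [:: 5; 6; 7; 8; 10]%N [:: 2; 3; k2]%N st st1 /\
      (forall i, (i < n)%N -> (ar st1 k2 i)%:R = wstep Wt (k1, k2) k2 i))) => //; try lia.
    - by rewrite !inE; lia.
    - by rewrite !inE; lia.
    - by move=> j jn; have := Pn jn; lia.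
    - by move=> i iN; rewrite aW ?k1l.
    - by move=> i iN; rewrite aW ?k2l.
    - by move=> st1 fr1 d; split=> // i iN; rewrite d // /wstep eqxx.
  move=> st1 [fr1 d1].
  have fr1' : frame [:: 5; 6; 7; 8; 10]%N (iota 2 (K - 2)) st st1.
    apply: (frame_sub fr1) => // x; rewrite !inE mem_iota.
    by case/or3P => /eqP ->; lia.
  apply: (IH st1 (wstep Wt (k1, k2)) ok); rewrite ?(frame_reg fr1) //.
  - by move=> j jn; rewrite (frame_ar fr1) ?aP //; [rewrite !inE|]; lia.
  - move=> k j kK jn; case: (eqVneq k k2) => [->|kk]; first exact: d1.
    rewrite /wstep /= (negPf kk) -aW // (frame_ar fr1) //; last by lia.
    by rewrite !inE (negPf kk); lia.
  - move=> st2 fr2 d2; apply: fin => //.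
    exact: frame_trans fr1' fr2.
by rewrite /=; lia.
Qed.

(** [scatter] writes at the indices [P j] only; the inverse [Q] shows that these are all indices
    below [n]. *)
Lemma onesP st (Q : nat -> nat) ks (R : state -> Prop) :
  (forall j, (j < n)%N -> (Q j < n)%N) ->
  (forall j, (j < n)%N -> P (Q j) = j) -> (forall j, (j < n)%N -> Q (P j) = j) ->
  all (fun k => 8 < k < K)%N ks ->
  reg_of st 0 = n -> reg_of st 1 = N ->
  (forall j, (j < n)%N -> ar st 0 j = P j) ->
  (forall st', frame [:: 10]%N ks st st' ->
     (forall k j, k \in ks -> (j < n)%N -> ar st' k j = 1%N) -> R st') ->
  triple st (seq_cmd (fun k => scatter k (Const 1)) ks) (size ks * (100 * N) + 1) R.
Proof.
move=> Qn PQ QP; elim: ks st => [|k ks IH] st /=.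
  by move=> _ r0 r1 aP fin; rewrite mul0n; apply: triple_skip; apply: fin.
have Ng := N_gt0; move=> /andP[/andP[kl ku] kks] r0 r1 aP fin.
apply: triple_le.
  apply: triple_then.
    apply: (@scatterP st k (Const 1) n P (fun=> 1%N) (fun st1 =>
      frame [:: 10]%N [:: k]%N st st1 /\
      (forall j, (j < n)%N -> ar st1 k j = 1%N))) => //; try lia.
    - by move=> j jn; have := Pn jn; lia.
    - by move=> i j iN jn E; rewrite -(QP i) // E QP.
    - by move=> st' i _ _ _; apply: eval_const; nia.
    - by move=> st1 fr1 d; split=> // j jn; rewrite -(PQ j) // d // Qn.
  move=> st1 [fr1 d1].
  apply: (IH st1 kks); rewrite ?(frame_reg fr1) //.
  - by move=> j jn; rewrite (frame_ar fr1) ?aP //; [rewrite !inE|]; lia.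
  - move=> st2 fr2 d2; apply: fin.
      apply: (@frame_trans _ _ _ st1).
        by apply: (frame_sub fr1) => // x; rewrite !inE => ->.
      by apply: (frame_sub fr2) => // x; rewrite !inE => ->; rewrite orbT.
    move=> k' j; rewrite inE; case: (boolP (k' \in ks)) => k'ks; first by move=> _; apply: d2.
    rewrite orbF => /eqP E jn; rewrite E in k'ks *.
    by rewrite (frame_ar fr2) ?d1 //; lia.
by rewrite /=; lia.
Qed.

End Weights.

(** * The complete program *)

Section Main.
Variables (n : nat) (P Q : nat -> nat).
Hypotheses (LE : L = (trunc_log 2 n).+1) (K9 : (8 < K)%N).
Hypothesis bw : (4 * (croot n ^ 3 + croot n * N) + 2 < 2 ^ w)%N.
Hypotheses (Pn : forall j, (j < n)%N -> (P j < n)%N)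
  (Qn : forall j, (j < n)%N -> (Q j < n)%N)
  (PQ : forall j, (j < n)%N -> P (Q j) = j)
  (QP : forall j, (j < n)%N -> Q (P j) = j).

Let nN : (n < N)%N. Proof. by rewrite NE LE trunc_log_ltn. Qed.

Let PN j : (j < n)%N -> (P j < N)%N.
Proof. by move=> jn; have := Pn jn; have := nN; lia. Qed.

Let QN j : (j < n)%N -> (Q j < N)%N.
Proof. by move=> jn; have := Qn jn; have := nN; lia. Qed.

Let Pinj i j : (i < n)%N -> (j < n)%N -> P i = P j -> i = j.
Proof. by move=> i_n jn E; rewrite -(QP i_n) E QP. Qed.

Lemma setup_cmdP st edges (R : state -> Prop) : edges_ok edges ->
  reg_of st 0 = n -> (forall j, (j < n)%N -> mem_of st j = P j) ->
  (forall st', reg_of st' 0 = n -> reg_of st' 1 = N -> reg_of st' 2 = croot n ->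
     (reg_of st' 3)%:R = -1 :> W ->
     (forall j, (j < n)%N -> ar st' 0 j = P j) ->
     (forall j, (j < n)%N -> ar st' 1 j = Q j) ->
     (forall k j, (8 < k < K)%N -> (j < n)%N ->
        (ar st' k j)%:R = weights P edges k j :> W) -> R st') ->
  triple st (setup_cmd K edges) (20 * (L + 3) + 20 * (croot n + 2) + 20 * (w + 2) +
    (K + size edges + 2) * (200 * N * (L + 3))) R.
Proof.
move=> ok r0 aP fin; have Ng := N_gt0; have nN' := nN.
have wN : (16 * N < 2 ^ w)%N by nia.
apply: triple_le.
  apply: triple_then.
    by apply: (@size_loopP st n (fun st1 => frame [:: 1]%N [::]%N st st1 /\ reg_of st1 1 = N)).
  move=> st1 [fr1 r1].
  apply: triple_then.
    apply: (@root_loopP st1 n (fun st2 => frame [:: 2]%N [::]%N st1 st2 /\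
      reg_of st2 2 = croot n)) => //; first by nia.
    by rewrite (frame_reg fr1).
  move=> st2 [fr2 r2].
  apply: triple_then.
    by apply: (@minus_one_loopP st2 (fun st3 => frame [:: 3]%N [::]%N st2 st3 /\
      (reg_of st3 3)%:R = -1 :> W)).
  move=> st3 [fr3 r3].
  have fr13 : frame [:: 1; 2; 3]%N [::]%N st st3.
    apply: (@frame_trans _ _ _ st1); first by apply: (frame_sub fr1); sub_seq.
    apply: (@frame_trans _ _ _ st2); first by apply: (frame_sub fr2); sub_seq.
    by apply: (frame_sub fr3); sub_seq.
  have r0_3 : reg_of st3 0 = n by rewrite (frame_reg fr13).
  have r1_3 : reg_of st3 1 = N by rewrite (frame_reg fr3) // (frame_reg fr2).
  have r2_3 : reg_of st3 2 = croot n by rewrite (frame_reg fr3).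
  have aP3 j : (j < n)%N -> ar st3 0 j = P j.
    by move=> jn; rewrite /ar mul0n add0n fr13.2 // aP.
  apply: triple_then.
    apply: (@scatterP st3 1 (Reg 10) n P id (fun st4 => frame [:: 10]%N [:: 1]%N st3 st4 /\
      forall j, (j < n)%N -> ar st4 1 j = Q j)) => //; try lia.
    - by move=> st' i _ r10 i_n; rewrite /= r10.
    - by move=> st4 fr4 d; split=> // j jn; rewrite -{1}(PQ jn) d ?Qn.
  move=> st4 [fr4 aQ4].
  have aP4 j : (j < n)%N -> ar st4 0 j = P j.
    by move=> jn; rewrite (frame_ar fr4) ?aP3 //; lia.
  apply: triple_then.
    apply: (@onesP n P _ _ _ st4 Q (iota 9 (K - 9)) (fun st5 =>
      frame [:: 10]%N (iota 9 (K - 9)) st4 st5 /\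
      forall k j, (8 < k < K)%N -> (j < n)%N -> ar st5 k j = 1%N)) => //; try lia.
    - by apply/allP => k; rewrite mem_iota; lia.
    - by rewrite (frame_reg fr4).
    - by rewrite (frame_reg fr4).
    - move=> st5 fr5 d; split=> // k j kK; apply: d.
      by rewrite mem_iota; lia.
  move=> st5 [fr5 one5].
  have aP5 j : (j < n)%N -> ar st5 0 j = P j.
    by move=> jn; rewrite (frame_ar fr5) ?aP4 ?mem_iota //; lia.
  have aQ5 j : (j < n)%N -> ar st5 1 j = Q j.
    by move=> jn; rewrite (frame_ar fr5) ?aQ4 ?mem_iota //; lia.
  have r45 r : r != 10%N -> reg_of st5 r = reg_of st3 r.
    by move=> h; rewrite (frame_reg fr5) ?(frame_reg fr4) // inE.
  apply: (@dominate_seqP n P _ _ _ st5 edges (fun _ _ => 1)) => //; try lia.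
  - by rewrite r45.
  - by rewrite r45.
  - by move=> k j kK jn; rewrite one5.
  move=> st6 fr6 d6; apply: fin => //; try by rewrite (frame_reg fr6) // r45.
  - by move=> j jn; rewrite (frame_ar fr6) ?aP5 ?mem_iota //; lia.
  - by move=> j jn; rewrite (frame_ar fr6) ?aQ5 ?mem_iota //; lia.
rewrite /= size_iota.
have : (100 * N <= 200 * N * (L + 3))%N by nia.
have : (2 <= 200 * N * (L + 3))%N by nia.
move: (200 * N * (L + 3))%N (100 * N)%N => X Y X2 YX.
have : ((K - 9) * Y <= K * X)%N by apply: leq_mul; lia.
rewrite !mulnDl; lia.
Qed.

Section Total.
Variables (h : bool) (u1 u2 u3 : nat -> W).

(** Let A say that vertex 1 is in a lower value strip than vertex 4, and B that vertex 3 is in an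
    earlier position strip than vertex 4. The three sums cover A without B, then B, then neither. *)
Definition weighted_count : W :=
  \sum_(0 <= q < (n %/ croot n).+1) strip_sum h (croot n) P u1 u2 u3 (-1) n q +
  \sum_(0 <= q < (n %/ croot n).+1)
     strip_sum h (croot n) Q (u3 \o Q) (u2 \o Q) (u1 \o Q) 0 n q +
  \sum_(0 <= a < n)
     corner_term h n (croot n) P Q u1 u2 u3 (u3 \o Q) (u1 \o Q) a.

Lemma count_cmdP st U1 U2 U3 (R : state -> Prop) :
  (8 < U1 < K)%N -> (8 < U2 < K)%N -> (8 < U3 < K)%N ->
  reg_of st 0 = n -> reg_of st 1 = N -> reg_of st 2 = croot n ->
  (reg_of st 3)%:R = -1 :> W ->
  (forall j, (j < n)%N -> ar st 0 j = P j) ->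
  (forall j, (j < n)%N -> ar st 1 j = Q j) ->
  (forall j, (j < n)%N -> (ar st U1 j)%:R = u1 j) ->
  (forall j, (j < n)%N -> (ar st U2 j)%:R = u2 j) ->
  (forall j, (j < n)%N -> (ar st U3 j)%:R = u3 j) ->
  (forall st', (reg_of st' 0 < 2 ^ w)%N -> (reg_of st' 0)%:R = weighted_count -> R st') ->
  triple st (count_cmd h U1 U2 U3)
    (1400 * N * (L + 3) * (n %/ croot n + 2) +
     1000 * N * (L + 3) * (croot n + 1) * (croot n + 1) + 400 * N) R.
Proof.
move=> /andP[U1l U1u] /andP[U2l U2u] /andP[U3l U3u] r0 r1 r2 r3 aP aQ a1 a2 a3 fin.
have Ng := N_gt0; have nN' := nN; have nlN := ltnW nN.
have b0 := croot_gt0 n.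
have scat st1 dst src (R' : state -> Prop) : frame [:: 10]%N [:: 6; 7; 8]%N st st1 ->
    (5 < dst < 9)%N -> (8 < src < K)%N ->
    (forall st', frame [:: 10]%N [:: dst]%N st1 st' ->
       (forall j, (j < n)%N -> ar st' dst j = ar st src (Q j)) -> R' st') ->
    triple st1 (scatter dst (get src (Reg 10))) (100 * N) R'.
  move=> fr dd ss fin'.
  apply: (@scatterP _ _ _ n P (fun j => ar st src j)) => //; try lia;
    try by rewrite (frame_reg fr).
  - by move=> j jn; rewrite (frame_ar fr) ?aP //; lia.
  - move=> st' i fr' r10 i_n; rewrite (eval_get_reg _ r10); try lia.
      rewrite (frame_ar fr') ?(frame_ar fr) // ?inE; lia.
    by rewrite (frame_reg fr') // (frame_reg fr).
  - move=> st' fr' d; apply: fin' => // j jn.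
    by rewrite -{1}(PQ jn) d ?Qn.
apply: triple_le.
  apply: triple_then.
    by apply: (scat st 6%N U3 (fun st1 => frame [:: 10]%N [:: 6]%N st st1 /\
      forall j, (j < n)%N -> ar st1 6 j = ar st U3 (Q j))) => //; lia.
  move=> st1 [fr1 d6].
  have fr1' : frame [:: 10]%N [:: 6; 7; 8]%N st st1 by apply: (frame_sub fr1); sub_seq.
  apply: triple_then.
    by apply: (scat st1 7%N U2 (fun st2 => frame [:: 10]%N [:: 7]%N st1 st2 /\
      forall j, (j < n)%N -> ar st2 7 j = ar st U2 (Q j))) => //; lia.
  move=> st2 [fr2 d7].
  have fr2' : frame [:: 10]%N [:: 6; 7; 8]%N st st2.
    by apply: (frame_trans fr1'); apply: (frame_sub fr2); sub_seq.
  apply: triple_then.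
    by apply: (scat st2 8%N U1 (fun st3 => frame [:: 10]%N [:: 8]%N st2 st3 /\
      forall j, (j < n)%N -> ar st3 8 j = ar st U1 (Q j))) => //; lia.
  move=> st3 [fr3 d8].
  have fr3' : frame [:: 10]%N [:: 6; 7; 8]%N st st3.
    by apply: (frame_trans fr2'); apply: (frame_sub fr3); sub_seq.
  apply: (@triple_seq_assign _ _ _ _ _ 0%N); first by rewrite /= mod0n.
  apply: (triple_seq_assign (v := reg_of st3 3)) => //.
  set st4 := set_reg _ 9 _.
  have fr34 : frame [:: 4; 9]%N [::]%N st3 st4.
    by apply: (@frame_trans _ _ _ (set_reg st3 4 0)); apply: frame_set_reg.
  have fr4 : frame [:: 4; 9; 10]%N [:: 6; 7; 8]%N st st4.
    apply: (@frame_trans _ _ _ st3); first by apply: (frame_sub fr3'); sub_seq.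
    by apply: (frame_sub fr34); sub_seq.
  pose rs := [:: 4; 5; 6; 7; 8; 9; 10; 11; 12; 13; 14; 15; 17; 18; 19]%N.
  have arU st' k j : frame rs [:: 2; 3; 4; 5]%N st4 st' ->
      (8 < k < K)%N -> (j < n)%N -> ar st' k j = ar st k j.
    move=> fr kK jn; rewrite (frame_ar fr) ?(frame_ar fr4) ?inE //; lia.
  have arP st' : frame rs [:: 2; 3; 4; 5]%N st4 st' ->
      forall j, (j < n)%N -> ar st' 0 j = P j.
    by move=> fr j jn; rewrite (frame_ar fr) ?(frame_ar fr4) ?aP //; lia.
  have arQ st' : frame rs [:: 2; 3; 4; 5]%N st4 st' ->
      forall j, (j < n)%N -> ar st' 1 j = Q j.
    by move=> fr j jn; rewrite (frame_ar fr) ?(frame_ar fr4) ?aQ //; lia.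
  have ar6 st' : frame rs [:: 2; 3; 4; 5]%N st4 st' ->
      forall j, (j < n)%N -> (ar st' 6 j)%:R = (u3 \o Q) j.
    move=> fr j jn; rewrite (frame_ar fr) ?(frame_ar fr34) //; try lia.
    by rewrite (frame_ar fr3) ?(frame_ar fr2) ?d6 ?a3 ?Qn //; lia.
  have ar7 st' : frame rs [:: 2; 3; 4; 5]%N st4 st' ->
      forall j, (j < n)%N -> (ar st' 7 j)%:R = (u2 \o Q) j.
    move=> fr j jn; rewrite (frame_ar fr) ?(frame_ar fr34) //; try lia.
    by rewrite (frame_ar fr3) ?d7 ?a2 ?Qn //; lia.
  have ar8 st' : frame rs [:: 2; 3; 4; 5]%N st4 st' ->
      forall j, (j < n)%N -> (ar st' 8 j)%:R = (u1 \o Q) j.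
    move=> fr j jn; rewrite (frame_ar fr) ?(frame_ar fr34) //; try lia.
    by rewrite d8 ?a1 ?Qn.
  have rg st' r : frame rs [:: 2; 3; 4; 5]%N st4 st' -> (r < 4)%N ->
      reg_of st' r = reg_of st r.
    by move=> fr; do 4?[case: r => [|r] //; first by rewrite (frame_reg fr) // (frame_reg fr4)].
  apply: triple_then.
    apply: (@stripsP st4 h 0 U1 U2 U3 n (croot n) P u1 u2 u3 (-1) 0 (fun st5 =>
      frame rs [:: 2; 3; 4; 5]%N st4 st5 /\
      (reg_of st5 4)%:R = \sum_(0 <= q < (n %/ croot n).+1)
         strip_sum h (croot n) P u1 u2 u3 (-1) n q)) => //; try lia;
      try (by rewrite !inE; lia); try (by rewrite rg).
    - by rewrite /= (frame_reg fr3').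
    - exact: arP.
    - by move=> j jn; rewrite arU ?a1 ?U1l.
    - by move=> _ j jn; rewrite arU ?a2 ?U2l.
    - by move=> j jn; rewrite arU ?a3 ?U3l.
    - move=> st5 fr5 ->; rewrite add0r; split=> //.
      by apply: (frame_sub fr5); sub_seq.
  move=> st5 [fr5 r4].
  apply: (@triple_seq_assign _ _ _ _ _ 0%N); first by rewrite /= mod0n.
  have fr6 : frame rs [:: 2; 3; 4; 5]%N st4 (set_reg st5 9 0).
    by apply: (frame_trans fr5); apply: frame_set_reg.
  have r9 : reg_of (set_reg st5 9 0) 9 = 0%N by [].
  have r4_6 : reg_of (set_reg st5 9 0) 4 = reg_of st5 4 by [].
  move: (set_reg st5 9 0) fr6 r9 r4_6 => st6 fr6 r9 r4_6.
  apply: triple_then.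
    apply: (@stripsP st6 h 1 6 7 8 n (croot n) Q (u3 \o Q) (u2 \o Q) (u1 \o Q) 0
      (reg_of st5 4)%:R (fun st7 =>
      frame rs [:: 2; 3; 4; 5]%N st6 st7 /\
      (reg_of st7 4)%:R = (reg_of st5 4)%:R + \sum_(0 <= q < (n %/ croot n).+1)
         strip_sum h (croot n) Q (u3 \o Q) (u2 \o Q) (u1 \o Q) 0 n q)) => //; try lia;
      try (by rewrite rg).
    - by rewrite r9.
    - exact: arQ.
    - exact: ar6.
    - by move=> _; apply: ar7.
    - exact: ar8.
    - by rewrite r4_6.
    - move=> st7 fr7 ->; split=> //.
      by apply: (frame_sub fr7); sub_seq.
  move=> st7 [fr7 r4_7].
  have fr7' : frame rs [:: 2; 3; 4; 5]%N st4 st7 by apply: frame_trans fr6 fr7.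
  apply: triple_then.
    apply: (@cornerP h n (croot n) P Q u1 u2 u3 (u3 \o Q) (u1 \o Q) U1 U2 U3
      _ _ _ _ _ _ _ _ _ _ _ _ st7 (reg_of st7 4)%:R (fun st8 =>
      (reg_of st8 4)%:R = (reg_of st7 4)%:R + \sum_(0 <= a < n)
         corner_term h n (croot n) P Q u1 u2 u3 (u3 \o Q) (u1 \o Q) a)) => //; try lia;
      try (by rewrite !inE; lia); try (by rewrite rg).
    - exact: arP.
    - exact: arQ.
    - by move=> j jn; rewrite arU ?a1 ?U1l.
    - by move=> j jn; rewrite arU ?a2 ?U2l.
    - by move=> j jn; rewrite arU ?a3 ?U3l.
    - exact: ar6.
    - exact: ar8.
  move=> st8 r4_8.
  apply: (triple_assign (v := ((reg_of st8 4 + 0 %% 2 ^ w) %% 2 ^ w)%N)) => //.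
  apply: fin; first by rewrite /= ltn_mod expn_gt0.
  rewrite /= Zp_nat_mod ?mod0n ?addn0; last by nia.
  by rewrite r4_8 r4_7 r4.
have X1 : (600 <= 1000 * N * (L + 3) * (croot n + 1) * (croot n + 1))%N by nia.
have -> : (1400 * N * (L + 3) * (n %/ croot n + 2) =
  700 * N * (L + 3) * (n %/ croot n + 2) + 700 * N * (L + 3) * (n %/ croot n + 2))%N by ring.
rewrite /=; lia.
Qed.

End Total.
End Main.

End Machine.

(** * The inclusion-exclusion identity *)

Local Open Scope ring_scope.

Section Identity.
Variables (w : nat).
Local Notation W := 'Z_(2 ^ w).
Local Notation weighted_count := (@weighted_count w).
Variables (n : nat) (P Q : nat -> nat).
Hypotheses (Pn : forall j, (j < n)%N -> (P j < n)%N)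
  (Qn : forall j, (j < n)%N -> (Q j < n)%N)
  (PQ : forall j, (j < n)%N -> P (Q j) = j)
  (QP : forall j, (j < n)%N -> Q (P j) = j).

(** Rewriting every range as a full sum with 0/1 coefficients reduces identities between sums to
    pointwise identities between indicators. *)
Lemma sum_range (F : nat -> W) lo hi : (hi <= n)%N ->
  \sum_(lo <= x < hi) F x = \sum_(0 <= x < n) (lo <= x < hi)%N%:R * F x.
Proof.
move=> hn; rewrite (big_nat_widen lo hi n) // (big_nat_widenl lo 0) //= big_mkcond /=.
by apply: eq_bigr => x _; rewrite andbC; case: ifP; rewrite ?mul1r ?mul0r.
Qed.

Lemma sum_perm (F : nat -> W) : \sum_(0 <= j < n) F j = \sum_(0 <= j < n) F (P j).
Proof.
rewrite -[RHS](big_map P xpredT F); apply: perm_big.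
apply: uniq_perm; rewrite ?iota_uniq //.
  rewrite map_inj_in_uniq ?iota_uniq // => x y; rewrite !mem_index_iota => xn yn E.
  by rewrite -(QP xn) E QP.
move=> x; rewrite mem_index_iota; apply/idP/mapP => [xn|[y]].
  by exists (Q x); rewrite ?PQ // mem_index_iota Qn.
by rewrite mem_index_iota => yn ->; rewrite Pn.
Qed.

Lemma eq_sum (F G : nat -> W) : (forall j, (j < n)%N -> F j = G j) ->
  \sum_(0 <= j < n) F j = \sum_(0 <= j < n) G j.
Proof. by move=> FG; apply: eq_big_nat => j /andP[_ /FG]. Qed.

End Identity.

(** * The sweeps in closed form *)

Section Kernel.
Variables (w : nat).
Local Notation W := 'Z_(2 ^ w).
Variables (h : bool) (n b : nat) (b0 : (0 < b)%N).

(* Vertices 1, 2, 3 are at the positions [i < j < k]. *)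
Definition kernel (P : nat -> nat) (u2 : nat -> W) (i k : nat) : W :=
  if h then \sum_(0 <= j < n) [&& i < j < k & P k < P j < P i]%N%:R * u2 j else 1.

Definition inv_weight P (u1 u2 u3 : nat -> W) (i k : nat) : W :=
  [&& i < k & P k < P i]%N%:R * (u1 i * u3 k * kernel P u2 i k).

(** The sweep sums over vertex 2 outside and vertex 1 inside. After exchanging these sums, what
    remains inside for fixed [i] and [k] is the kernel, because i < j < k and P k < P j < P i
    already force the inversion. *)
Lemma zqE P u1 u2 u3 q k : (k < n)%N ->
  zq h b P u1 u2 u3 q k =
  \sum_(0 <= i < n) (P i %/ b < q)%N%:R * inv_weight P u1 u2 u3 i k.
Proof.
move=> kn; rewrite /zq /inv_weight /kernel /yq; case: (h); last first.
  rewrite (sum_range _ _ (ltnW kn)) mulr_sumr; apply: eq_sum => i i_n.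
  by rewrite /xq; case: (i < k)%N; rewrite /= ?mulr1 -?mulnb ?natrM; ring.
under eq_big_nat => j /andP[_ jk].
  rewrite (sum_range _ _ (ltnW (ltn_trans jk kn))) mulr_sumr mulr_sumr.
over.
rewrite (sum_range _ _ (ltnW kn)) /=.
under eq_bigr do rewrite mulr_sumr.
rewrite exchange_big /= mulr_sumr; apply: eq_bigr => i _.
rewrite !mulr_sumr; apply: eq_bigr => j _; rewrite /xq /=.
case: (ltnP i j) => ij /=; last by rewrite !(mul0r, mulr0).
case: (ltnP j k) => jk /=; last by rewrite !(mul0r, mulr0).
rewrite (ltn_trans ij jk) /=.
case: (ltnP (P k) (P j)) => kj /=; last by rewrite !(mul0r, mulr0).
case: (ltnP (P j) (P i)) => ji /=; last by rewrite !(mul0r, mulr0).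
by rewrite (ltn_trans kj ji) /=; ring.
Qed.

Lemma strips_sumE P u1 u2 u3 zz : (forall j, (j < n)%N -> (P j < n)%N) ->
  \sum_(0 <= q < (n %/ b).+1) strip_sum h b P u1 u2 u3 zz n q =
  \sum_(0 <= l < n) \sum_(0 <= k < n) \sum_(0 <= i < n)
    ((k < l)%N%:R + zz * (k %/ b < l %/ b)%N%:R) * (P i %/ b < P l %/ b)%N%:R *
    inv_weight P u1 u2 u3 i k.
Proof.
move=> Pn; rewrite exchange_big_nat /=; apply: eq_sum => l ln.
have lb : (P l %/ b < (n %/ b).+1)%N by rewrite ltnS leq_div2r // ltnW // Pn.
(* Each [l] contributes to its own value strip only. *)
rewrite (bigD1_seq (P l %/ b)%N) ?iota_uniq ?mem_index_iota //= eqxx mul1r.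
rewrite [X in _ + X]big1_seq ?addr0; last first.
  by move=> q /andP[qP _]; rewrite eq_sym (negPf qP) mul0r.
have bl : (b * (l %/ b) <= n)%N.
  by rewrite mulnC (leq_trans (leq_trunc_div l b)) // ltnW.
rewrite /Tq (sum_range _ _ (ltnW ln)) (sum_range _ _ bl) mulr_sumr -big_split /=.
apply: eq_sum => k kn; rewrite zqE // !mulr_sumr -big_split /=.
apply: eq_bigr => i _.
(* Lying before the first position of the strip of [l] means lying in an earlier strip. *)
have -> : (k < b * (l %/ b))%N = (k %/ b < l %/ b)%N by rewrite ltn_divLR // mulnC.
by ring.
Qed.

End Kernel.

(** Indicators become arbitrary ring elements, so that [ring] faces a plain polynomial identity. *)
Ltac gen_bools := repeat match goal with
  |- context [Algebra.natmul (GRing.one ?R) (nat_of_bool ?c)] =>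
     generalize (Algebra.natmul (GRing.one R) (nat_of_bool c)); intro end.

(** * Partition of the triples by strips *)

Section Total.
Variables (w : nat).
Local Notation W := 'Z_(2 ^ w).
Local Notation weighted_count := (@weighted_count w).
Variables (h : bool) (n : nat) (P Q : nat -> nat).
Hypotheses (Pn : forall j, (j < n)%N -> (P j < n)%N)
  (Qn : forall j, (j < n)%N -> (Q j < n)%N)
  (PQ : forall j, (j < n)%N -> P (Q j) = j)
  (QP : forall j, (j < n)%N -> Q (P j) = j).
Variables (u1 u2 u3 : nat -> W).
Let b := croot n.

Let Pinj i j : (i < n)%N -> (j < n)%N -> P i = P j -> i = j.
Proof. by move=> i_n jn E; rewrite -(QP i_n) E QP. Qed.

Let b0 : (0 < b)%N. Proof. exact: croot_gt0. Qed.

Local Notation sum_P := (sum_perm Pn Qn PQ QP).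

(** The inverse permutation reflects the points in the diagonal. The rectangle stays the same, but
    its corner of smaller value, vertex 3, now comes first. *)
Lemma kernel_transp i k : (i < n)%N -> (k < n)%N ->
  kernel h n Q (u2 \o Q) (P k) (P i) = kernel h n P u2 i k.
Proof.
move=> i_n kn; rewrite /kernel; case: (h) => //.
rewrite sum_P; apply: eq_sum => j jn /=.
by rewrite !QP // andbC.
Qed.

Lemma inv_weight_transp i k : (i < n)%N -> (k < n)%N ->
  inv_weight h n Q (u3 \o Q) (u2 \o Q) (u1 \o Q) (P k) (P i) =
  inv_weight h n P u1 u2 u3 i k.
Proof.
move=> i_n kn; rewrite /inv_weight kernel_transp //= !QP // andbC.
by congr (_ * (_ * _)); rewrite mulrC.
Qed.

Lemma strips_transpE :
  \sum_(0 <= q < (n %/ b).+1) strip_sum h b Q (u3 \o Q) (u2 \o Q) (u1 \o Q) 0 n q =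
  \sum_(0 <= l < n) \sum_(0 <= k < n) \sum_(0 <= i < n)
    (P i < P l)%N%:R * (k %/ b < l %/ b)%N%:R * inv_weight h n P u1 u2 u3 i k.
Proof.
rewrite strips_sumE // sum_P; apply: eq_sum => l ln.
rewrite sum_P exchange_big_nat /= sum_P; apply: eq_sum => k kn; apply: eq_sum => i i_n.
by rewrite inv_weight_transp // !QP // mul0r addr0.
Qed.

Lemma block_range x y : (x %/ b * b <= y < x)%N = (y %/ b == x %/ b)%N && (y < x)%N.
Proof.
apply/andP/andP => -[h1 h2]; split=> //.
  rewrite eqn_leq leq_div2r ?(ltnW h2) //= leq_divRL //.
by rewrite -leq_divRL // (eqP h1).
Qed.

Lemma block_range_up x y : (y < n)%N ->
  (x < y < minn n ((x %/ b).+1 * b))%N = (x < y)%N && (y %/ b == x %/ b)%N.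
Proof.
move=> yn; rewrite leq_min yn /= -ltn_divLR // ltnS.
by case: ltnP => //= xy; rewrite eqn_leq (leq_div2r b (ltnW xy)) andbT.
Qed.

(** With D a v the weight of vertex 2 at positions below a and values below v, the kernel is D k (P
    i) - D k (P k) - D i (P i) + D i (P k). The first two terms are available when the insertion
    reaches [k], the last two when it reaches [i]; [E1] and [E2] identify the two passes
    accordingly. *)
Lemma corner_termE :
  \sum_(0 <= a < n) corner_term h n b P Q u1 u2 u3 (u3 \o Q) (u1 \o Q) a =
  \sum_(0 <= l < n) \sum_(0 <= k < n) \sum_(0 <= i < n)
    ((k < l) && (P i < P l))%N%:R * ((k %/ b == l %/ b) && (P i %/ b == P l %/ b))%N%:R *
    inv_weight h n P u1 u2 u3 i k.
Proof.
pose D (a v : nat) : W := \sum_(0 <= j < n) ((j < a) && (P j < v))%N%:R * u2 j.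
have DE a v : (a < n)%N -> \sum_(0 <= x < v) cont P u2 a x = D a v.
  move=> an; rewrite sum_cont (sum_range _ _ (ltnW an)); apply: eq_bigr => j _ /=.
  by rewrite mulrA -natrM mulnb.
pose c l k i : W := ((k < l) && (P i < P l))%N%:R *
  ((k %/ b == l %/ b) && (P i %/ b == P l %/ b))%N%:R * 
  ((i < k) && (P k < P i))%N%:R * (u1 i * u3 k).
have E1 : \sum_(0 <= a < n) pairs_sum h false n b P Q u1 u3 (cont P u2 a) a =
  \sum_(0 <= l < n) \sum_(0 <= k < n) \sum_(0 <= i < n)
     c l k i * (if h then D k (P i) - D k (P k) else 1).
  rewrite [RHS]exchange_big_nat /=; apply: eq_sum => k kn.
  rewrite /pairs_sum (sum_range _ _ (geq_minl _ _)); apply: eq_sum => l ln.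
  rewrite block_range_up // /pairs_row_sum (sum_range _ _ (ltnW (Pn ln))).
  rewrite mulr_sumr sum_P; apply: eq_sum => i i_n.
  rewrite block_range /pairs_term /pairs_ker QP // !DE // /c andbC.
  rewrite [(k %/ b == _)%N]eq_sym [X in _ = X]mulrC [in RHS]mulrC.
  rewrite -!mulnb !natrM; gen_bools; move: (if h then _ else _) => X; ring.
have E2 : \sum_(0 <= a < n) pairs_sum true true n b Q P (u3 \o Q) (u1 \o Q)
              (cont P u2 a) (P a) =
  \sum_(0 <= l < n) \sum_(0 <= k < n) \sum_(0 <= i < n) c l k i * (D i (P k) - D i (P i)).
  under [RHS]eq_bigr do rewrite exchange_big_nat /=.
  rewrite [RHS]exchange_big_nat /=; apply: eq_sum => i i_n.
  rewrite /pairs_sum (sum_range _ _ (geq_minl _ _)) sum_P; apply: eq_sum => l ln.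
  rewrite block_range_up ?Pn // /pairs_row_sum (sum_range (n := n)); last first.
    by rewrite QP // ltnW.
  rewrite mulr_sumr; apply: eq_sum => k kn.
  rewrite !QP // block_range /pairs_term /pairs_ker /= !QP // !DE // /c.
  rewrite [(P i %/ b == _)%N]eq_sym.
  by rewrite -!mulnb !natrM; ring.
rewrite /corner_term big_split /= E1 -mulr_sumr E2.
rewrite mulr_sumr -big_split /=; apply: eq_sum => l ln.
rewrite mulr_sumr -big_split /=; apply: eq_sum => k kn.
rewrite mulr_sumr -big_split /=; apply: eq_sum => i i_n.
rewrite /inv_weight /c; case: (boolP ((i < k) && (P k < P i))%N) => [/andP[ik ki]|_]; last first.
  by rewrite !(mul0r, mulr0, addr0).
(* The four corners describe the half-open rectangle i <= j < k, P k <= P j < P i. By injectivity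
   its closed sides could only contain [i] and [k] themselves, and both are excluded by the strict
   sides. *)
have -> : kernel h n P u2 i k =
    (if h then D k (P i) - D k (P k) else 1) + h%:R * (D i (P k) - D i (P i)).
  rewrite /kernel; case: (h); last by rewrite mul0r addr0.
  rewrite mul1r /D -!sumrB -big_split /=; apply: eq_sum => j jn.
  rewrite -!mulrBl -mulrDl; congr (_ * _).
  have : (j == i) ==> (P j == P i) by apply/implyP => /eqP ->.
  have : (P j == P k) ==> (j == k) by apply/implyP => /eqP /Pinj ->.
  case: (ltngtP j i) => ij; case: (ltngtP j k) => jk //=; try lia;
    case: (ltngtP (P j) (P i)) => pij //=; case: (ltngtP (P j) (P k)) => pjk //= _ _;
    try lia; rewrite ?(subrr, subr0, sub0r, addr0, add0r, addNr) //.
gen_bools; move: (if h then _ else _) (D i (P k) - _) => X Y; ring.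
Qed.

(** Different strips decide the comparison of the points in them. Hence [k < l] splits into an
    earlier strip or the same strip, values behave likewise, and in each case the three coefficients
    add up to the desired indicator. *)
Lemma weighted_countE :
  weighted_count n P Q h u1 u2 u3 =
  \sum_(0 <= l < n) \sum_(0 <= k < n) \sum_(0 <= i < n)
    ((k < l) && (P i < P l))%N%:R * inv_weight h n P u1 u2 u3 i k.
Proof.
rewrite /weighted_count -/b strips_sumE // strips_transpE corner_termE -!big_split /=.
apply: eq_sum => l ln; rewrite -!big_split /=; apply: eq_sum => k kn.
rewrite -!big_split /=; apply: eq_sum => i i_n; rewrite -!mulrDl; congr (_ * _).
have div_lt x y : (x %/ b < y %/ b)%N -> (x < y)%N.
  by apply: contraLR; rewrite -!leqNgt; apply: leq_div2r.
have := div_lt k l; have := div_lt l k; have := div_lt (P i) (P l); have := div_lt (P l) (P i).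
case: (ltngtP (k %/ b) (l %/ b)) => _ /=; case: (ltngtP (P i %/ b) (P l %/ b)) => _ /=;
  case: (ltngtP k l) => _ //=; case: (ltngtP (P i) (P l)) => _ //= h1 h2 h3 h4;
  try (by move: (h1 isT)); try (by move: (h2 isT)); try (by move: (h3 isT));
  try (by move: (h4 isT)); by ring.
Qed.

End Total.

Local Close Scope ring_scope.

(** * Morphisms as weighted counts on the core *)

Section TreeCounting.
Variables (w : nat) (h : bool) (D : finType) (p : D -> core h + D).
Hypothesis hp : rooted_trees p.
Variables (n : nat) (s : 'S_n).

Local Notation V := (core h + D)%type.
Local Notation W := 'Z_(2 ^ w).

Fact core1_subproof : 1 \in core_seq h. Proof. by case: h. Qed.
Fact core3_subproof : 3 \in core_seq h. Proof. by case: h. Qed.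
Fact core4_subproof : 4 \in core_seq h. Proof. by case: h. Qed.
(** Vertex 1 stands in for an absent vertex 2, so that [vertex2] always names an allocated array. *)
Fact core2_subproof : (if h then 2 else 1) \in core_seq h. Proof. by case: h. Qed.

Definition vertex1 : V := inl (SeqSub core1_subproof).
Definition vertex2 : V := inl (SeqSub core2_subproof).
Definition vertex3 : V := inl (SeqSub core3_subproof).
Definition vertex4 : V := inl (SeqSub core4_subproof).

Definition below (x y : 'I_n) : bool := (x < y) && (s x < s y).

Definition core_ok (f : V -> 'I_n) : bool :=
  [forall c : core h, forall d : core h,
    (((val c, val d) \in coreW h) ==> (f (inl c) < f (inl d))) &&
    (((val c, val d) \in coreS h) ==> (s (f (inl c)) < s (f (inl d))))].

(** Both orders of the target are transitive, so preserving the generating relations is enough. *)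
Lemma MorE (f : {ffun V -> 'I_n}) :
  (f \in Mor (tree_dposet hp) (iota_perm s)) =
  core_ok f && [forall x, below (f (inr x)) (f (p x))].
Proof.
rewrite inE; apply/idP/andP => [/forallP H|[/forallP Hc /forallP Ht]].
  have H1 u v : (genW p u v -> f u < f v) /\ (genS p u v -> s (f u) < s (f v)).
    have /forallP /(_ v) /andP[/implyP H1 /implyP H2] := H u.
    by split=> e; [apply: H1 | apply: H2]; apply/tclosureP; apply: t_step.
  split; apply/forallP => x; last first.
    apply/andP; split; first by apply: (H1 _ _).1 => /=.
    by apply: (H1 _ _).2 => /=.
  apply/forallP => y; apply/andP; split; apply/implyP => e.
    exact: (H1 (inl x) (inl y)).1.
  exact: (H1 (inl x) (inl y)).2.
have step u v : (genW p u v -> f u < f v) /\ (genS p u v -> s (f u) < s (f v)).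
  case: u v => [c|x] [d|y] /=; split=> // e.
  - by have /forallP /(_ d) /andP[/implyP + _] := Hc c; apply.
  - by have /forallP /(_ d) /andP[_ /implyP +] := Hc c; apply.
  - by rewrite -(eqP e); have /andP[] := Ht x.
  - by rewrite -(eqP e); have /andP[] := Ht x.
  - by rewrite -(eqP e); have /andP[] := Ht x.
  - by rewrite -(eqP e); have /andP[] := Ht x.
apply/forallP => u; apply/forallP => v; apply/andP; split; apply/implyP => /tclosureP.
  elim=> {u v} [u v /(step _ _).1 //|u v z _ uv _ vz].
  exact: ltn_trans uv vz.
elim=> {u v} [u v /(step _ _).2 //|u v z _ uv _ vz].
exact: ltn_trans uv vz.
Qed.

Local Open Scope ring_scope.

(** Sums out the coordinate [x] without changing the domain: functions on the remaining vertices are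
    represented by the functions that take the same value at [x] as at [c]. An induction over the
    trees can then stay in one function type. *)
Lemma sum_fiber (x c : V) (H : {ffun V -> 'I_n} -> W) : x != c ->
  \sum_f H f = \sum_(f : {ffun V -> 'I_n} | f x == f c)
    \sum_j H [ffun v => if v == x then j else f v].
Proof.
move=> xc.
rewrite (partition_big (fun f : {ffun V -> 'I_n} => [ffun v => if v == x then f c else f v])
  (fun f => f x == f c)) /=; last first.
  by move=> f _; rewrite !ffunE eqxx [c == x]eq_sym (negPf xc).
apply: eq_bigr => f /eqP fxc.
rewrite (reindex_onto (fun j => [ffun v => if v == x then j else f v]) (fun g => g x)) /=.
  apply: eq_bigl => j; rewrite [X in _ && (X == j)]ffunE !eqxx andbT.
  apply/eqP/ffunP => v.
  by rewrite !ffunE [c == x]eq_sym (negPf xc); case: eqP => // ->; rewrite fxc.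
move=> g /eqP /ffunP gE; apply/ffunP => v; rewrite ffunE; case: eqP => [->//|vx].
by have := gE v; rewrite ffunE; case: eqP.
Qed.

Variables (id : V -> nat).
Hypothesis id_inj : injective id.

Let P := nth 0%N [seq val (s j) | j <- enum 'I_n].

Lemma nth_perm (i : 'I_n) : P i = s i.
Proof.
by rewrite /P (nth_map i) ?size_enum_ord // nth_ord_enum.
Qed.

Lemma below_sum (u : nat -> W) (i : 'I_n) :
  \sum_(0 <= j < i) (P j < P i)%N%:R * u j = \sum_(j < n) (below j i)%:R * u j.
Proof.
rewrite (sum_range (n := n)) ?big_mkord; last exact: ltnW.
by apply: eq_bigr => j _; rewrite !nth_perm mulrA -natrM mulnb.
Qed.

(* [l] lists the tree vertices that are still to be summed out; the others are
   pinned to the image of vertex 4. *)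
Definition factor (l : seq D) (Wt : nat -> nat -> W) (f : V -> 'I_n) (v : V) : W :=
  match v with
  | inl c => Wt (id v) (f v)
  | inr x => if x \in l then (below (f v) (f (p x)))%:R * Wt (id v) (f v)
             else (f v == f vertex4)%:R
  end.

Definition tree_sum (l : seq D) (Wt : nat -> nat -> W) : W :=
  \sum_(f : {ffun V -> 'I_n}) (core_ok f)%:R * \prod_v factor l Wt f v.

(** When no listed vertex has [x] as parent, the image of [x] occurs in the factor of [x] only.
    Summing over it yields a dominance sum at the image of [p x], which is absorbed into the weight
    of [p x]; that weight is still present, as [p x] is listed or in the core. *)
Lemma tree_sum_step x l Wt : x \notin l ->
  (forall y, y \in l -> p y != inr x) -> (forall y, p x = inr y -> y \in l) ->
  tree_sum (x :: l) Wt = tree_sum l (wstep P Wt (id (inr x), id (p x))).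
Proof.
move=> xl chl par.
have px : p x != inr x.
  by apply/eqP => E; move: (par _ E); rewrite (negPf xl).
have x4 : inr x != vertex4 by [].
have p4 : vertex4 != inr x by [].
rewrite /tree_sum (sum_fiber _ x4) [RHS](bigID (fun f : {ffun V -> 'I_n} => f (inr x) == f vertex4)) /=.
rewrite [X in _ + X]big1 ?addr0; last first.
  (* On the right, functions that do not pin [x] to vertex 4 have a vanishing factor at [x]. *)
  move=> f fx; rewrite (bigD1 (inr x)) //= (negPf xl) (negPf fx).
  by rewrite mul0r mulr0.
apply: eq_bigr => f fx.
pose S := \sum_(j < n) (below j (f (p x)))%:R * Wt (id (inr x)) j.
have -> : \prod_v factor l (wstep P Wt (id (inr x), id (p x))) f v =
    S * \prod_(v | v != inr x) factor l Wt f v.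
  rewrite (bigD1 (inr x)) //= (negPf xl) fx mul1r.
  rewrite (bigD1 (p x)) //= [in RHS](bigD1 (p x)) //= mulrA; congr (_ * _); last first.
    apply: eq_bigr => v /andP[vx vp].
    have wE i : wstep P Wt (id (inr x), id (p x)) (id v) i = Wt (id v) i.
      by rewrite /wstep /= (inj_eq id_inj) (negPf vp).
    by case: v vx vp wE => [c|y] vx vp wE /=; rewrite wE.
  have wE (i : 'I_n) : wstep P Wt (id (inr x), id (p x)) (id (p x)) i =
      Wt (id (p x)) i * \sum_(j < n) (below j i)%:R * Wt (id (inr x)) j.
    by rewrite /wstep /= eqxx below_sum.
  rewrite /S; move: par wE; case: (p x) => [c|y] par wE /=; first by rewrite wE mulrC.
  by rewrite par // wE [RHS]mulrC mulrA.
rewrite mulrCA mulr_suml; apply: eq_bigr => j _.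
pose g : {ffun V -> 'I_n} := [ffun v => if v == inr x then j else f v]; rewrite -/g.
have gx : g (inr x) = j by rewrite /g ffunE eqxx.
have gN v : v != inr x -> g v = f v by rewrite /g ffunE => /negPf ->.
have -> : core_ok g = core_ok f.
  by apply: eq_forallb => c; apply: eq_forallb => d; rewrite !gN.
rewrite (bigD1 (inr x)) //= inE eqxx gx gN //= mulrCA; congr (_ * (_ * _)).
apply: eq_bigr => v vx; case: v vx => [c|y] vx /=; first by rewrite gN.
have yx : y != x by apply: contra vx => /eqP ->.
rewrite inE (negPf yx) /=; case: ifP => yl; rewrite !gN //.
exact: chl.
Qed.

Lemma tree_sum_all l : l =i D ->
  (#|Mor (tree_dposet hp) (iota_perm s)|%:R : W) = tree_sum l (fun _ _ => 1).
Proof.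
move=> lD; rewrite -sum1_card natr_sum big_mkcond; apply: eq_bigr => f _.
rewrite MorE; case: core_ok; rewrite /= ?mul1r ?mul0r //.
case: forallP => [ok|nok].
  rewrite big1 // => -[c|x] _ //=.
  by rewrite lD ok mulr1.
have [x nx] : exists x, ~~ below (f (inr x)) (f (p x)).
  by apply/existsP; rewrite -negb_forall; apply/forallP.
by rewrite (bigD1 (inr x)) //= lD (negPf nx) !mul0r.
Qed.

(** Ranks grow towards the root, so in a list sorted by rank each vertex comes after its children
    and the leaf step applies to the head. *)
Lemma tree_sum_nil Wt (rk : V -> nat) l :
  (forall x, (rk (inr x) < rk (p x))%N) -> uniq l ->
  pairwise (fun x y => rk (inr x) <= rk (inr y))%N l ->
  (forall x y, x \in l -> p x = inr y -> y \in l) ->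
  tree_sum l Wt =
  tree_sum [::] (foldl (wstep P) Wt [seq (id (inr x), id (p x)) | x <- l]).
Proof.
move=> rkP; elim: l Wt => [|x l IH] Wt //=; case/andP=> xl ul /andP[/allP xr pw] cl.
have nch y : y \in l -> p y != inr x.
  by move=> yl; apply/eqP => E; have := rkP y; rewrite E ltnNge xr.
rewrite tree_sum_step //; last first.
  move=> y E; have := cl x y (mem_head _ _) E; rewrite inE => /orP[/eqP yx|//].
  by have := rkP x; rewrite E yx ltnn.
apply: IH => // y z yl E; have := cl y z; rewrite !inE yl orbT => /(_ isT E).
by case/orP => // /eqP zx; have := nch _ yl; rewrite E zx eqxx.
Qed.

(** Tree vertices are sent to [l] as well: this is where summed-out vertices are pinned. *)
Definition core_map (i j k l : 'I_n) (v : V) : 'I_n :=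
  if v is inl c then
    match val c with 1 => i | 2 => j | 3 => k | _ => l end%N
  else l.

(** The other conditions on vertex 4 follow by transitivity: among the core vertices below it,
    vertex 3 has the largest position and vertex 1 the largest value. *)
Lemma core_okE i j k l : core_ok (core_map i j k l) =
  [&& (k < l)%N, (s i < s l)%N, (i < k)%N, (s k < s i)%N &
      h ==> [&& (i < j)%N, (j < k)%N, (s k < s j)%N & (s j < s i)%N]].
Proof.
pose phi m := match m with 1 => i | 2 => j | 3 => k | _ => l end%N.
have -> : core_ok (core_map i j k l) =
   all (fun e => phi e.1 < phi e.2)%N (coreW h) &&
   all (fun e => s (phi e.1) < s (phi e.2))%N (coreS h).
  have sub : all (fun e => (e.1 \in core_seq h) && (e.2 \in core_seq h)) (coreW h ++ coreS h).
    by case: (h).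
  apply/forallP/andP => [H|[/allP Hw /allP Hs] c].
    split; apply/allP => -[x y] e.
      have /andP[xh yh] : (x \in core_seq h) && (y \in core_seq h).
        by apply: (allP sub (x, y)); rewrite mem_cat e.
      by have /forallP /(_ (SeqSub yh)) /andP[/implyP /(_ e)] := H (SeqSub xh).
    have /andP[xh yh] : (x \in core_seq h) && (y \in core_seq h).
      by apply: (allP sub (x, y)); rewrite mem_cat e orbT.
    by have /forallP /(_ (SeqSub yh)) /andP[_ /implyP /(_ e)] := H (SeqSub xh).
  apply/forallP => d; apply/andP; split; apply/implyP => e.
    exact: Hw e.
  exact: Hs e.
case: (h) => /=; rewrite !andbT; apply/idP/idP.
- by do ?[case/andP]; do ?[move=> /andP[]]; intros; do ?[apply/andP; split]; lia.
- by do ?[case/andP]; intros; do ?[apply/andP; split]; lia.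
- by do ?[case/andP]; intros; do ?[apply/andP; split]; lia.
- by do ?[case/andP]; intros; do ?[apply/andP; split]; lia.
Qed.

Lemma prod_core (F : nat -> W) :
  \prod_(c : core h) F (val c) = F 1%N * (if h then F 2%N else 1) * F 3%N * F 4%N.
Proof.
have -> : \prod_(c : core h) F (val c) = \prod_(x <- core_seq h) F x.
  rewrite -(big_map val xpredT F); apply: perm_big; apply: uniq_perm.
  - by rewrite (map_inj_uniq val_inj) index_enum_uniq.
  - by case: (h).
  - move=> x; apply/mapP/idP => [[c _ ->]|xh]; first exact: valP.
    by exists (SeqSub xh) => //; rewrite mem_index_enum.
by case: (h); rewrite !(big_cons, big_nil) ?mulr1 !mulrA.
Qed.

Lemma coreP (c : core h) :
  [\/ val c = 1%N /\ inl c = vertex1, val c = 2%N /\ inl c = vertex2,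
      val c = 3%N /\ inl c = vertex3 | val c = 4%N /\ inl c = vertex4].
Proof.
have hc : val c \in core_seq h by exact: valP.
have sub : {subset core_seq h <= [:: 1; 2; 3; 4]%N}.
  by rewrite /core_seq; case: (h) => x; rewrite !inE; do ?case/orP; move=> ->; rewrite ?orbT.
have h2 : (2%N \in core_seq h) = h by case: (h).
have := sub _ hc; rewrite !inE => /or4P[] /eqP e;
  [apply: Or41|apply: Or42|apply: Or43|apply: Or44]; split=> //;
  congr inl; apply: val_inj; rewrite /= e //.
by move: hc; rewrite e h2 => ->.
Qed.

Lemma core_mapK (f : {ffun V -> 'I_n}) :
  (forall x, f (inr x) = f vertex4) ->
  finfun (core_map (f vertex1) (f vertex2) (f vertex3) (f vertex4)) = f.
Proof.
move=> fD; apply/ffunP => -[c|x]; rewrite ffunE //=.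
by case: (coreP c) => -[-> ->].
Qed.

(** Functions with all tree vertices pinned correspond to the images of the core vertices. The
    weight of vertex 4 stays 1 in the application because this vertex is never a parent. *)
Lemma tree_sum_core Wt (Wt4 : forall i, Wt (id vertex4) i = 1) :
  tree_sum [::] Wt =
  \sum_(0 <= l < n) \sum_(0 <= k < n) \sum_(0 <= i < n)
    ((k < l) && (P i < P l))%N%:R *
    inv_weight h n P (Wt (id vertex1)) (Wt (id vertex2)) (Wt (id vertex3)) i k.
Proof.
pose dead (f : {ffun V -> 'I_n}) := [forall x, f (inr x) == f vertex4].
pose H (f : V -> 'I_n) : W := (core_ok f)%:R * \prod_(c : core h) Wt (id (inl c)) (f (inl c)).
transitivity (\sum_(f | dead f) H f).
  rewrite big_mkcond; apply: eq_bigr => f _; rewrite big_sumType /= mulrA -/(H f).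
  rewrite /dead; case: forallP => [fD|nD].
    by rewrite big1 ?mulr1 // => x _; rewrite fD.
  have [x nx] : exists x, f (inr x) != f vertex4.
    by apply/existsP; rewrite -negb_forall; apply/forallP.
  by rewrite (bigD1 x) //= (negPf nx) mul0r mulr0.
pose F (t : 'I_n * 'I_n * 'I_n * 'I_n) : {ffun V -> 'I_n} :=
  finfun (core_map t.1.2 t.2 t.1.1.2 t.1.1.1).
rewrite (reindex_onto F (fun f => (f vertex4, f vertex3, f vertex1, f vertex2))); last first.
  by move=> f /forallP fD; apply: core_mapK => x; apply/eqP.
(* If vertex 2 is absent, [vertex2] is vertex 1, and the fourth coordinate must repeat the third. *)
have FE t : dead (F t) && ((F t vertex4, F t vertex3, F t vertex1, F t vertex2) == t)
    = h || (t.2 == t.1.2).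
  have -> : dead (F t) by apply/forallP => x; rewrite !ffunE.
  case: t => [[[l k] i] j]; rewrite !ffunE /= !xpair_eqE !eqxx /=.
  by case: (h); rewrite ?eqxx // eq_sym.
rewrite (eq_bigl _ _ FE) big_mkcond /=.
transitivity (\sum_(l < n) \sum_(k < n) \sum_(i < n) \sum_(j < n)
   if h || (j == i) then H (core_map i j k l) else 0).
  rewrite !pair_bigA /=; apply: eq_bigr => -[[[l k] i] j] _ /=; case: ifP => // _.
  rewrite /H; congr (_ * _).
    congr (_%:R); congr nat_of_bool.
    by apply: eq_forallb => c; apply: eq_forallb => d; rewrite !ffunE.
  by apply: eq_bigr => c _; rewrite ffunE.
rewrite big_mkord; apply: eq_bigr => l _; rewrite big_mkord; apply: eq_bigr => k _.
rewrite big_mkord; apply: eq_bigr => i _.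
pose wid m : nat -> W := Wt (if m is 1 then id vertex1 else if m is 2 then id vertex2
  else if m is 3 then id vertex3 else id vertex4)%N.
have HE j : h || (j == i) -> H (core_map i j k l) =
  [&& (k < l)%N, (s i < s l)%N, (i < k)%N, (s k < s i)%N &
      h ==> [&& (i < j)%N, (j < k)%N, (s k < s j)%N & (s j < s i)%N]]%:R *
  (Wt (id vertex1) i * (if h then Wt (id vertex2) j else 1) * Wt (id vertex3) k).
  move=> hj; rewrite /H core_okE; congr (_ * _).
  have -> : \prod_(c : core h) Wt (id (inl c)) (core_map i j k l (inl c)) =
     \prod_(c : core h) wid (val c) (match val c with 1 => i | 2 => j | 3 => k | _ => l end)%N.
    apply: eq_bigr => c _; congr (Wt _ _).
      by case: (coreP c) => -[-> ->].
    by rewrite /core_map; case: (coreP c) => -[-> _].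
  rewrite (prod_core (fun m => wid m (match m with 1 => i | 2 => j | 3 => k | _ => l end)%N)).
  by rewrite /wid /= Wt4 mulr1.
rewrite /inv_weight /kernel !nth_perm.
have bE c1 c2 c3 c4 c5 : [&& c1, c2, c3, c4 & c5]%:R =
   (c1 && c2)%:R * (c3 && c4)%:R * c5%:R :> W.
  by case: c1 c2 c3 c4 c5 => [] [] [] [] []; rewrite /= ?(mul0r, mulr0, mul1r).
case hE : h HE => HE /=; last first.
  rewrite -big_mkcond (big_pred1 i) //= HE ?eqxx ?orbT //.
  by rewrite bE /= !mulr1 !mulrA.
rewrite big_mkord [in RHS]mulrA [in RHS]mulrA mulr_sumr.
apply: eq_bigr => j _; rewrite HE // bE /= !nth_perm.
have -> : [&& i < j < k & s k < s j < s i]%N = [&& (i < j)%N, (j < k)%N, (s k < s j)%N & (s j < s i)%N].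
  by rewrite -!andbA.
by gen_bools; ring.
Qed.

End TreeCounting.

(** * The algorithm and its running time *)

Section Assembly.
Variables (h : bool) (D : finType) (p : D -> core h + D).
Hypothesis hp : rooted_trees p.

Local Notation V := (core h + D)%type.
Local Notation K := (9 + #|{: V}|).

Definition array_of (v : V) : nat := 9 + enum_rank v.

Lemma array_of_inj : injective array_of.
Proof. by move=> u v /addnI /val_inj /enum_rank_inj. Qed.

Lemma array_of_bounds v : 8 < array_of v < K.
Proof. by rewrite /array_of ltn_add2l ltn_ord andbT leq_addr. Qed.

Definition tree_edges (l : seq D) : seq (nat * nat) :=
  [seq (array_of (inr x), array_of (p x)) | x <- l].

(** The two arrays of an edge differ: a vertex that is its own parent would never reach the core. *)
Lemma tree_edges_ok l : edges_ok K (tree_edges l).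
Proof.
apply/allP => _ /mapP[x _ ->]; rewrite !array_of_bounds !andbT /=.
rewrite (inj_eq array_of_inj); apply/eqP => E.
have [k [c [_]]] := hp.2 x.
have -> : iter k (follow p) (inr x) = inr x by elim: k => //= k ->; rewrite /= -E.
by [].
Qed.

Definition tree_prog (l : seq D) : cmd :=
  Then (setup_cmd K (tree_edges l))
    (count_cmd h (array_of (vertex1 h D)) (array_of (vertex2 h D))
       (array_of (vertex3 h D))).

Lemma tree_order : exists2 l : seq D, l =i D &
  uniq l /\ exists2 rk : V -> nat, (forall x, rk (inr x) < rk (p x)) &
    pairwise (fun x y => rk (inr x) <= rk (inr y)) l.
Proof.
(* With an empty core relation the rank only has to increase along the parent map. *)
have [//|rk rkP] := @gen_rank h D p hp [::] id.
pose r x y := rk (inr x) <= rk (inr y).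
exists (sort r (enum D)); first by move=> x; rewrite mem_sort mem_enum.
split; first by rewrite sort_uniq enum_uniq.
exists rk; first by move=> x; apply: rkP => /=.
rewrite -sorted_pairwise; last by move=> x y z; apply: leq_trans.
by apply: sort_sorted => x y; apply: leq_total.
Qed.

Lemma weights_other w P (edges : seq (nat * nat)) k i :
  (forall e, e \in edges -> e.2 != k) -> weights w P edges k i = 1%R.
Proof.
move=> ek; rewrite /weights.
have foldl1 Wt : Wt k i = 1%R -> foldl (@wstep w P) Wt edges k i = 1%R.
  elim: edges ek Wt => [//|e l IH] ek Wt WE /=.
  apply: IH => [e' e'l|]; first by apply: ek; rewrite inE e'l orbT.
  by rewrite /wstep eq_sym (negPf (ek e (mem_head _ _))).
exact: foldl1.
Qed.

Local Open Scope ring_scope.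

Lemma weighted_countP w n (s : 'S_n) l (rk : V -> nat) :
  l =i D -> uniq l -> (forall x, (rk (inr x) < rk (p x))%N) ->
  pairwise (fun x y => rk (inr x) <= rk (inr y))%N l ->
  let P := nth 0%N [seq val (s j) | j <- enum 'I_n] in
  let Q := nth 0%N [seq val (s^-1%g j) | j <- enum 'I_n] in
  let u v := weights w P (tree_edges l) (array_of v) in
  weighted_count n P Q h (u (vertex1 h D)) (u (vertex2 h D)) (u (vertex3 h D)) =
  #|Mor (tree_dposet hp) (iota_perm s)|%:R.
Proof.
move=> lD ul rkP pw P Q u.
have PE (t : 'S_n) j (jn : (j < n)%N) :
    nth 0%N [seq val (t j) | j <- enum 'I_n] j = t (Ordinal jn).
  by rewrite -(nth_perm t (Ordinal jn)).
rewrite (tree_sum_all w hp s array_of lD).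
rewrite (tree_sum_nil s array_of_inj _ rkP ul pw); last first.
  by move=> x y _ _; rewrite lD.
rewrite tree_sum_core; last first.
  move=> i; apply: weights_other => _ /mapP[x _ ->] /=.
  rewrite (inj_eq array_of_inj); apply/eqP => E.
  by apply: (hp.1 x _ E).
apply: weighted_countE => j jn; rewrite /P /Q (PE _ _ jn) ?ltn_ord //.
  by rewrite (nth_perm s) permKV.
by rewrite (nth_perm s^-1%g) permK.
Qed.

Local Close Scope ring_scope.

(** This keeps the count below [2 ^ w], so that a residue suffices. *)
Lemma card_Mor_le n (s : 'S_n) :
  #|Mor (tree_dposet hp) (iota_perm s)| <= n ^ #|{: V}|.
Proof. by rewrite (leq_trans (max_card _)) // card_ffun card_ord. Qed.

Lemma croot_le n : croot n <= n.+1.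
Proof.
rewrite leqNgt; apply/negP => lt.
have := @croot_lt n n.+1; rewrite lt /= => /(_ isT).
rewrite ltnNge (leq_trans (leqnSn n)) //.
by rewrite -{1}(expn1 n.+1) leq_pexp2l.
Qed.

Lemma croot_pred_le n : 0 < n -> (croot n).-1 ^ 3 <= n.
Proof.
move=> n0; have := @croot_lt n (croot n).-1; have := croot_gt0 n.
by case: (croot n) => // -[|b] _; [rewrite exp0n | move=> /(_ (ltnSn _)) /ltnW].
Qed.

(** The balance behind the exponent: the number of strips is of the order of the number of pairs
    enumerated per point. *)
Lemma div_croot n : n %/ croot n <= croot n ^ 2.
Proof.
by rewrite -ltnS ltn_divLR ?croot_gt0 // (leq_ltn_trans (croot_ge n)) // mulSnr
  -expnSr -ltn_subLR ?leqnn // subnn croot_gt0.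
Qed.

Lemma tree_computable : exists C : nat,
  computable_within (fun n (s : 'S_n) => #|Mor (tree_dposet hp) (iota_perm s)|)
    (fun n => C * (n.+1 * ((croot n).+1 ^ 2 * (trunc_log 2 n).+1)))
    (fun n => C * n.+1).
Proof.
have [l lD [ul [rk rkP pw]]] := tree_order.
(* Now [2 ^ w = N ^ (K + 11)]. This exceeds the address bound, estimated by [N ^ (K + 7)], the bound
   [N ^ 7] for products with the strip width, and the number of maps, at most [N ^ #|{: V}|]. *)
pose c := K + 10.
(* The summands pay for the terms of the time bound, each compared with one common monomial; [K * 2]
   also pays for the space of [K] arrays, as [N <= 2 * n.+1]. *)
exists (100 * c + 20 * (c + 4) + (K + size (tree_edges l) + 2) * 1600 + 40 * 1000 + K * 2).
set C := (X in computable_within _ (fun n => X * _)).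
exists c, (tree_prog l) => n s.
set L := (trunc_log 2 n).+1; pose N := 2 ^ L.
have wE : word_length c n = c.+1 * L by [].
set w := word_length c n; set sp := C * n.+1.
have N2 : 2 <= N by rewrite /N /L expnS; have := expn_gt0 2 (trunc_log 2 n); lia.
have nN : n < N by rewrite trunc_log_ltn.
have Nn : N <= 2 * n.+1.
  rewrite /N /L expnS leq_mul2l /=; case: (posnP n) => [->|n0]; first by rewrite trunc_log0.
  exact: leq_trans (trunc_logP _ _) _.
have MN : 2 ^ w = N ^ c.+1 by rewrite /w wE mulnC expnM.
have expN k : 2 ^ k <= N ^ k by case: k => // k; rewrite leq_exp2r.
have ltk k : k < N ^ k by apply: leq_trans (expN k); apply: ltn_expl.
have w_gt0 : 0 < w by rewrite /w wE muln_gt0.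
have KNs : K * N <= sp by rewrite /sp /C; nia.
have N4 : 16 <= N ^ 4 by apply: leq_trans (expN 4).
have KNw : 8 * (K + 2) * N < 2 ^ w.
  rewrite MN; apply: (@leq_ltn_trans (N ^ 4 * N ^ (K + 2) * N)).
    by rewrite leq_mul2r leq_mul ?orbT //; [lia | apply: ltnW].
  by rewrite -expnD -expnSr ltn_exp2l // /c; lia.
have bN : croot n <= N by apply: leq_trans (croot_le n) _.
have bw : 4 * (croot n ^ 3 + croot n * N) + 2 < 2 ^ w.
  have b3 : croot n ^ 3 <= N ^ 3 by rewrite leq_exp2r.
  have b2 : croot n * N <= N ^ 3 by rewrite !expnS expn0; nia.
  rewrite MN; apply: (@leq_ltn_trans (N ^ 4 * N ^ 3)).
    have : 8 <= N ^ 3 by apply: leq_trans (expN 3).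
    by move: (N ^ 3) (N ^ 4) N4 b3 b2 => X Y; nia.
  by rewrite -expnD ltn_exp2l // /c; lia.
have cardw : #|Mor (tree_dposet hp) (iota_perm s)| < 2 ^ w.
  rewrite MN; apply: leq_ltn_trans (card_Mor_le s) _.
  apply: (@leq_ltn_trans (N ^ #|{: V}|)); last by rewrite ltn_exp2l // /c; lia.
  by case: #|_| => // m; rewrite leq_exp2r // ltnW.
pose P := nth 0 [seq val (s j) | j <- enum 'I_n].
pose Q := nth 0 [seq val (s^-1%g j) | j <- enum 'I_n].
have PE (t : 'S_n) j (jn : j < n) :
    nth 0 [seq val (t j) | j <- enum 'I_n] j = t (Ordinal jn).
  by rewrite -(nth_perm t (Ordinal jn)).
have Pn j : j < n -> P j < n by move=> jn; rewrite /P (PE _ _ jn).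
have Qn j : j < n -> Q j < n by move=> jn; rewrite /Q (PE _ _ jn).
have PQ j : j < n -> P (Q j) = j.
  by move=> jn; rewrite /P /Q (PE _ _ jn) (nth_perm s) permKV.
have QP j : j < n -> Q (P j) = j.
  by move=> jn; rewrite /P /Q (PE _ _ jn) (nth_perm s^-1%g) permK.
pose u v := weights w P (tree_edges l) (array_of v).
have tr : triple w sp (input_state s) (tree_prog l)
   (20 * (L + 3) + 20 * (croot n + 2) + 20 * (w + 2) +
    (K + size (tree_edges l) + 2) * (200 * N * (L + 3)) +
    (1400 * N * (L + 3) * (n %/ croot n + 2) +
     1000 * N * (L + 3) * (croot n + 1) * (croot n + 1) + 400 * N))
   (fun st => reg_of st 0 = #|Mor (tree_dposet hp) (iota_perm s)|).
  apply: triple_then.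
    apply: (@setup_cmdP w sp K L N w_gt0 erefl KNs KNw n P Q erefl isT bw Pn Qn PQ QP
      (input_state s) (tree_edges l) (fun st => [/\ reg_of st 0 = n, reg_of st 1 = N,
        reg_of st 2 = croot n, ((reg_of st 3)%:R = -1 :> 'Z_(2 ^ w))%R &
        (forall j, j < n -> ar N st 0 j = P j) /\ (forall j, j < n -> ar N st 1 j = Q j) /\
        (forall k j, 8 < k < K -> j < n ->
           (ar N st k j)%:R%R = weights w P (tree_edges l) k j)])) => //.
    exact: tree_edges_ok.
  move=> st [r0 r1 r2 r3 [aP [aQ aW]]].
  apply: (@count_cmdP w sp K L N w_gt0 erefl KNs KNw n P Q erefl isT bw Pn Qn PQ QP h
    (u (vertex1 h D)) (u (vertex2 h D)) (u (vertex3 h D)) st) => //;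
    try exact: array_of_bounds;
    try (by move=> j jn; rewrite aW // array_of_bounds).
  move=> st' lt; rewrite (weighted_countP w s lD ul rkP pw) => E.
  have w1 : 1 < 2 ^ w by rewrite -{1}(expn0 2) ltn_exp2l.
  (* Both numbers are below [2 ^ w], so equality of residues is equality. *)
  have := congr1 val E; rewrite /= !val_Zp_nat // !modn_small //.
have [t [st [ex tT r0]]] := tr; exists t, st; split=> //.
apply: leq_trans tT _.
have := div_croot n; move: (n %/ croot n) => d; move: (croot n) => b db.
have L1 : 0 < L by [].
(* Every term is brought to a multiple of [X], after which linear arithmetic finishes. *)
pose e := b.+1 ^ 2; pose X := n.+1 * (e * L).
have e1 : 0 < e by rewrite expn_gt0.
have eL : n.+1 * L <= X by rewrite leq_mul2l leq_pmull.
have LX : L <= X by apply: leq_trans eL; rewrite leq_pmull.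
have eX : e <= X by apply: (@leq_trans (e * L)); [apply: leq_pmulr | apply: leq_pmull].
have mX : n.+1 <= X by apply: leq_trans eL; rewrite leq_pmulr.
have be : b + 2 <= 2 * e by rewrite /e -mulnn; nia.
have de : d + 2 <= 2 * e by rewrite /e -mulnn; move: db; rewrite -mulnn; nia.
have NL : N * (L + 3) <= 8 * (n.+1 * L).
  by apply: (@leq_trans ((2 * n.+1) * (4 * L))); [apply: leq_mul; lia | rewrite -mulnACA; lia].
have t4 : 200 * N * (L + 3) <= 1600 * X.
  by rewrite -mulnA; lia.
have t5 : 1400 * N * (L + 3) * (d + 2) <= 1400 * (16 * X).
  have -> : 1400 * N * (L + 3) * (d + 2) = 1400 * (N * (L + 3) * (d + 2)) by ring.
  have -> : 1400 * (16 * X) = 1400 * (8 * (n.+1 * L) * (2 * e)) by rewrite /X; ring.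
  by rewrite leq_mul2l leq_mul ?orbT.
have t6 : 1000 * N * (L + 3) * (b + 1) * (b + 1) <= 1000 * (8 * X).
  have -> : 1000 * N * (L + 3) * (b + 1) * (b + 1) = 1000 * (N * (L + 3) * e).
    by rewrite /e -addn1; ring.
  have -> : 1000 * (8 * X) = 1000 * (8 * (n.+1 * L) * e) by rewrite /X; ring.
  by rewrite leq_mul2l leq_mul ?orbT.
have t4' : (K + size (tree_edges l) + 2) * (200 * N * (L + 3)) <=
    (K + size (tree_edges l) + 2) * (1600 * X) by rewrite leq_mul2l t4 orbT.
have t3 : w <= c.+1 * X by rewrite /w wE leq_mul2l LX orbT.
have CX : C * X = 100 * c * X + 20 * (c + 4) * X +
    (K + size (tree_edges l) + 2) * (1600 * X) + 40 * (1000 * X) + K * 2 * X.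
  by rewrite /C; ring.
rewrite -/e -/L -/X CX.
have : 20 * (c + 4) * X = 20 * (c.+1 * X) + 60 * X by rewrite -addn1; ring.
move: t3 t4' t5 t6; move: (c.+1 * X) ((K + size (tree_edges l) + 2) * (1600 * X)) => A1 A2.
move: ((K + size (tree_edges l) + 2) * _) (1400 * _ * _ * _) (1000 * _ * _ * _ * _) => A3 A4 A5.
move: (20 * (c + 4) * X) (100 * c * X) (K * 2 * X) => A6 A7 A8.
clear -be eX LX mX Nn; lia.
Qed.

End Assembly.

(** * Soft-O estimates *)

Section Asymptotics.
Local Open Scope classical_set_scope.
Local Open Scope ring_scope.
Variable R : realType.

Lemma softO_le (f : nat -> nat) (g : nat -> R) (k : nat) (C : R) :
  (forall n, (1 < n)%N -> 0 <= g n) ->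
  (forall n, (1 < n)%N -> (f n)%:R <= C * (g n * ln n%:R ^+ k)) -> softO f g.
Proof.
move=> g0 fg; exists k; apply/eqO_exP; exists (`|C| + 1).
  by rewrite ltr_wpDl // normr_ge0.
exists 2%N => // n /= n2.
have lg : 0 <= g n * ln n%:R ^+ k.
  by rewrite mulr_ge0 ?g0 // exprn_ge0 // ln_ge0 // ler1n ltnW.
rewrite ger0_norm ?ler0n // (ger0_norm lg).
apply: le_trans (fg n n2) _; apply: ler_wpM2r => //.
by rewrite (le_trans (ler_norm C)) // lerDl.
Qed.

(** The factor 2 absorbs the successor, since [ln 2 <= ln n]. *)
Lemma trunc_log_ln n : (1 < n)%N ->
  (trunc_log 2 n).+1%:R <= 2 / ln 2 * ln n%:R :> R.
Proof.
move=> n1; have l2 : 0 < ln 2 :> R by rewrite ln_gt0 // ltr1n.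
have lt : (trunc_log 2 n)%:R * ln 2 <= ln n%:R :> R.
  rewrite mulr_natl -lnXn ?ltr0n // ler_ln ?posrE ?exprn_gt0 ?ltr0n //; last by lia.
  by rewrite -natrX ler_nat trunc_logP //; lia.
have le2 : ln 2 <= ln n%:R :> R by rewrite ler_ln ?posrE ?ltr0n ?ler_nat //; lia.
rewrite mulrAC ler_pdivlMr // -natr1 mulrDl mul1r [2 * _]mulr_natl mulr2n.
exact: lerD.
Qed.

(** Only [b.-1] is bounded by the cube root; the missing 2 costs two more cube roots, each at least
    1. *)
Lemma cube_root_le (n b : nat) : (0 < n)%N -> (b.-1 ^ 3 <= n)%N ->
  b.+1%:R <= 3 * n%:R `^ (1 / 3) :> R.
Proof.
move=> n0 bn; have n1 : 1 <= n%:R :> R by rewrite ler1n.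
have r1 : 1 <= n%:R `^ (1 / 3) :> R.
  by rewrite -[X in X <= _](powRr0 n%:R) ler_powR // divr_ge0.
have br : b.-1%:R <= n%:R `^ (1 / 3) :> R.
  rewrite -(@ler_pXn2r _ 3) ?nnegrE ?powR_ge0 //.
  rewrite -[X in _ <= X]powR_mulrn ?powR_ge0 // -powRrM divfK ?pnatr_eq0 //.
  by rewrite powRr1 ?ler0n // -natrX ler_nat.
have : b.+1%:R <= b.-1%:R + 2 :> R by rewrite -natrD ler_nat; lia.
move=> /le_trans; apply.
have -> : 3 * n%:R `^ (1 / 3) = n%:R `^ (1 / 3) + (n%:R `^ (1 / 3) + n%:R `^ (1 / 3)) :> R.
  by ring.
by rewrite lerD // [2](natrD _ 1 1) lerD.
Qed.

Lemma softO_time C (b : nat -> nat) : (forall n, (0 < n)%N -> (b n).-1 ^ 3 <= n)%N ->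
  softO (fun n => C * (n.+1 * ((b n).+1 ^ 2 * (trunc_log 2 n).+1)))%N
    (fun n => n%:R `^ (5%:R / 3%:R) : R).
Proof.
move=> bn; apply: (@softO_le _ _ 1 (C%:R * (2 * (9 * (2 / ln 2))))).
  by move=> n _; apply: powR_ge0.
move=> n n1; have n0 : (0 < n)%N by lia.
set r : R := n%:R `^ (1 / 3).
have rE : n%:R `^ (5%:R / 3%:R) = n%:R * r ^+ 2 :> R.
  have -> : 5%:R / 3%:R = 1 + 1 / 3 * 2%:R :> R by field.
  rewrite powRD; last by rewrite pnatr_eq0; apply/implyP => _; lia.
  by rewrite powRr1 ?ler0n // powRrM powR_mulrn ?powR_ge0.
rewrite rE expr1 natrM -[leRHS]mulrA ler_wpM2l ?ler0n //.
have -> : 2 * (9 * (2 / ln 2)) * (n%:R * r ^+ 2 * ln n%:R) =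
  (2 * n%:R) * ((3 * r) ^+ 2 * (2 / ln 2 * ln n%:R)) :> R by ring.
rewrite natrM [X in _ * X <= _]natrM.
apply: ler_pM; rewrite ?mulr_ge0 ?ler0n //.
  by rewrite -natrM ler_nat; lia.
apply: ler_pM; rewrite ?ler0n //; last exact: trunc_log_ln.
rewrite natrX ler_pXn2r ?nnegrE ?ler0n //; last by rewrite mulr_ge0 ?powR_ge0.
exact: cube_root_le n0 (bn n n0).
Qed.

Lemma softO_space C : softO (fun n => C * n.+1)%N (fun n => n%:R : R).
Proof.
apply: (@softO_le _ _ 0 (2 * C%:R)) => n n1; first exact: ler0n.
by rewrite expr0 mulr1 -!natrM ler_nat; nia.
Qed.

End Asymptotics.

Theorem theorem4p1 (R : realType) (a : dposet) (ha : familyA a) :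
  exists time space : nat -> nat,
    [/\ softO time (fun n => n%:R `^ (5%:R / 3%:R) : R)%R,
        softO space (fun n => n%:R : R)%R &
        computable_within (fun n (Pi : 'S_n) => #|Mor a (iota_perm Pi)|)
          time space].
Proof.
case: ha => h D p hp; have [C prog] := tree_computable hp.
eexists; eexists; split; last exact: prog.
  exact/softO_time/croot_pred_le.
exact: softO_space.
Qed.
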